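(* Let $n,d\ge1$, let $(\mathsf A,\mathcal A)$ be a standard Borel action space, and let $L(\rho,a)=\ell(\operatorname{Spec}(\rho),a)$ be a spectrum-only loss on $\mathcal S(\mathbb C^d)\times\mathsf A$, with $\ell:\Theta_\downarrow\times\mathsf A\to[0,\infty]$ measurable. Let $\widetilde\Pi$ be a unitarily invariant prior probability measure on $\mathcal S(\mathbb C^d)$, and let $\Pi:=\widetilde\Pi\circ\operatorname{Spec}^{-1}$ be the induced prior on $\Theta_\downarrow$. Then for every quantum decision procedure $D$ (action-valued POVM on $(\mathbb C^d)^{\otimes n}$ with outcomes in $\mathsf A$) there exists a randomized decision rule $\delta_D$ based on weak Schur sampling such that $$R_{\widetilde\Pi}(D)=R_{\widetilde\Pi}(M^{\mathrm{WSS}},\delta_D).$$ Consequently, $$\inf_D R_{\widetilde\Pi}(D)=\inf_\delta R_{\widetilde\Pi}(M^{\mathrm{WSS}},\delta),$$ where the first infimum is over all quantum decision procedures and the second over all randomized decision rules based on weak Schur sampling. If a measurable posterior Bayes action $a_\Pi(\lambda)$ exists, then weak Schur sampling followed by $a_\Pi$ attains this common infimum, and is therefore Bayes optimal among all quantum decision procedures.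
   Context: $\mathcal S(\mathbb C^d)$ is the set of density operators on $\mathbb C^d$. $\Theta_\downarrow=\{\theta\in[0,1]^d:\theta_1\ge\dots\ge\theta_d,\ \sum_i\theta_i=1\}$, and $\operatorname{Spec}(\rho)\in\Theta_\downarrow$ is the decreasingly ordered vector of eigenvalues of $\rho$. $\widetilde\Pi$ is unitarily invariant if it is invariant under $\rho\mapsto U\rho U^\dagger$ for every $U\in U(d)$. **Decision procedures.** An action-valued POVM $D$ is a map from $\mathcal A$ to positive operators on $(\mathbb C^d)^{\otimes n}$, countably additive in the weak operator topology, with $D(\mathsf A)=I$. Its Bayes risk is $R_{\widetilde\Pi}(D)=\int\int_{\mathsf A}L(\rho,a)\operatorname{Tr}[\rho^{\otimes n}D(da)]\,\widetilde\Pi(d\rho)$. **Weak Schur sampling.** $\mathbb Y_{n,d}$ is the set of partitions $\lambda=(\lambda_1\ge\dots\ge\lambda_d\ge0)$ of $n$. By Schur–Weyl duality $(\mathbb C^d)^{\otimes n}\cong\bigoplus_{\lambda\in\mathbb Y_{n,d}}\mathcal U_\lambda\otimes\mathcal V_\lambda$ with $\mathcal U_\lambda$, $\mathcal V_\lambda$ irreducible modules of $U(d)$ and $S_n$; $\Pi_\lambda$ is the orthogonal projection onto the $\lambda$-block, and $M^{\mathrm{WSS}}=\{\Pi_\lambda\}_{\lambda\in\mathbb Y_{n,d}}$. Write $P_\theta^{(n)}(\lambda)=\operatorname{Tr}[\operatorname{diag}(\theta)^{\otimes n}\Pi_\lambda]$; one has $\operatorname{Tr}[\rho^{\otimes n}\Pi_\lambda]=P^{(n)}_{\operatorname{Spec}(\rho)}(\lambda)$.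 A randomized decision rule based on weak Schur sampling is a Markov kernel $\delta$ from $\mathbb Y_{n,d}$ to $\mathsf A$, and $R_{\widetilde\Pi}(M^{\mathrm{WSS}},\delta)=\int\sum_\lambda\operatorname{Tr}[\rho^{\otimes n}\Pi_\lambda]\int_{\mathsf A}L(\rho,a)\,\delta(\lambda,da)\,\widetilde\Pi(d\rho)$. **Posterior Bayes action.** For $\lambda$ with $\int P_\theta^{(n)}(\lambda)\Pi(d\theta)>0$ the posterior is $\Pi(d\theta\mid\lambda)=P_\theta^{(n)}(\lambda)\Pi(d\theta)/\int P_{\theta'}^{(n)}(\lambda)\Pi(d\theta')$; for other $\lambda$ it is defined arbitrarily. A posterior Bayes action is a measurable selection $a_\Pi(\lambda)\in\arg\min_{a\in\mathsf A}\int_{\Theta_\downarrow}\ell(\theta,a)\,\Pi(d\theta\mid\lambda)$. *)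

(* Defs.v *)
From HB Require Import structures.
From mathcomp Require Import all_boot all_order all_algebra all_fingroup.
From mathcomp Require Import complex.
From mathcomp Require Import all_classical all_reals all_analysis.
From mathcomp Require Import measurable_realfun.

Set Implicit Arguments.
Unset Strict Implicit.
Unset Printing Implicit Defensive.

Import Order.TTheory GRing.Theory Num.Theory.
Import numFieldNormedType.Exports.

Local Open Scope classical_set_scope.
Local Open Scope ring_scope.
Local Open Scope sesquilinear_scope.

Notation "R [i]" := (complex R) : type_scope.

Definition psdmx (R : realType) (N : nat) (M : 'M[R[i]]_N) : Prop :=
  M \is hermsymmx /\ forall v : 'cV[R[i]]_N, 0 <= (v^t* *m M *m v) 0 0.

Definition is_density (R : realType) (d : nat) (M : 'M[R[i]]_d) : Prop :=
  psdmx M /\ \tr M = 1.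

Record density (R : realType) (d : nat) : Type := Density {
  density_mx :> 'M[R[i]]_d;
  densityP : is_density density_mx }.

Definition is_ordered_prob (R : realType) (d : nat) (t : d.-tuple R) : Prop :=
  [/\ forall i, 0 <= tnth t i <= 1, sorted >=%R t & \sum_(i < d) tnth t i = 1].

Record Theta (R : realType) (d : nat) : Type := MkTheta {
  theta_val :> d.-tuple R;
  thetaP : is_ordered_prob theta_val }.

Lemma psdmx_conj (R : realType) (N : nat) (U M : 'M[R[i]]_N) :
  psdmx M -> psdmx (U *m M *m U^t*).
Proof.
move=> [/is_hermitianmxP hM pM]; split.
  apply/is_hermitianmxP; rewrite expr0 scale1r in hM; rewrite expr0.
  by rewrite scale1r !trmx_mul !map_mxM trmxCK -hM mulmxA.
by move=> v; have := pM (U^t* *m v); rewrite trmx_mul map_mxM trmxCK !mulmxA.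
Qed.

Lemma unitary_conj_density (R : realType) (d : nat) (U : 'M[R[i]]_d)
  (hU : U \is unitarymx) (rho : density R d) : is_density (U *m rho *m U^t*).
Proof.
have [hp ht] := densityP rho; split; first exact: psdmx_conj.
by rewrite mxtrace_mulC mulmxA -invmx_unitary// mulVmx ?mul1mx// unitarymx_unit.
Qed.

Definition conj_density (R : realType) (d : nat) (U : 'M[R[i]]_d)
    (hU : U \is unitarymx) (rho : density R d) : density R d :=
  Density (unitary_conj_density hU rho).

(* spectral_diag lists the eigenvalues with multiplicity, in no fixed order.  *)
Definition spec_tuple (R : realType) (d : nat) (M : 'M[R[i]]_d) : d.-tuple R :=
  sort_tuple >=%R [tuple complex.Re (spectral_diag M 0 i) | i < d].

Lemma psdmx_diag (R : realType) (N : nat) (M : 'M[R[i]]_N) i :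
  psdmx M -> 0 <= M i i.
Proof.
move=> [_ /(_ (delta_mx i 0))].
by rewrite trmx_delta map_delta_mx -rowE -colE !mxE.
Qed.

Lemma spectral_conj (R : realType) (N : nat) (M : 'M[R[i]]_N) :
  psdmx M ->
  spectralmx M *m M *m (spectralmx M)^t* = diag_mx (spectral_diag M).
Proof.
move=> [hM _]; have /orthomx_spectralP {2}-> := hermitian_normalmx hM.
rewrite -invmx_unitary ?spectral_unitarymx//.
by rewrite !mulmxA mulmxV ?spectral_unit// mul1mx mulmxK ?spectral_unit.
Qed.

Lemma spectral_diag_ge0 (R : realType) (N : nat) (M : 'M[R[i]]_N) i :
  psdmx M -> 0 <= spectral_diag M 0 i.
Proof.
move=> hM; have := psdmx_diag i (psdmx_conj (spectralmx M) hM).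
by rewrite spectral_conj// mxE eqxx mulr1n.
Qed.

Lemma sum_spectral_diag (R : realType) (N : nat) (M : 'M[R[i]]_N) :
  psdmx M -> \sum_i spectral_diag M 0 i = \tr M.
Proof.
move=> hM; rewrite -mxtrace_diag -spectral_conj// mxtrace_mulC mulmxA.
by rewrite -invmx_unitary ?spectral_unitarymx// mulVmx ?spectral_unit// mul1mx.
Qed.

Lemma spec_tupleP (R : realType) (d : nat) (rho : density R d) :
  is_ordered_prob (spec_tuple rho).
Proof.
have [hp ht] := densityP rho.
pose f i := complex.Re (spectral_diag rho 0 i).
have f0 i : 0 <= f i.
  by have := spectral_diag_ge0 i hp; rewrite /f; case: (spectral_diag _ 0 i) => a b /andP[].
have pe : perm_eq (spec_tuple rho) [tuple f i | i < d] by rewrite perm_sort.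
have sum1 : \sum_(i < d) tnth (spec_tuple rho) i = 1.
  rewrite -(big_tuple _ _ (spec_tuple rho) xpredT id)/= (perm_big _ pe)/=.
  rewrite big_map big_enum/= -[RHS](_ : complex.Re (1 : R[i]) = 1)//.
  by rewrite -ht -sum_spectral_diag// raddf_sum.
have t0 i : 0 <= tnth (spec_tuple rho) i.
  have := mem_tnth i (spec_tuple rho).
  by rewrite (perm_mem pe) => /mapP[j _ ->].
split => //; last by rewrite sort_sorted// => x y; exact: le_total.
move=> i; rewrite t0/= -sum1 (bigD1 i)//= lerDl sumr_ge0//.
Qed.

Definition Spec (R : realType) (d : nat) (rho : density R d) : Theta R d :=
  MkTheta (spec_tupleP rho).

(* S(C^d) carries the Borel sigma-algebra of its subspace topology (R[i]^o is *)
(* the copy of R[i] carrying the norm topology); Theta_down carries the trace *)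
(* of the Borel sigma-algebra of R^d. Measurable types are pointed, so both   *)
(* are declared for a positive dimension d.+1.                                *)

HB.instance Definition _ (R : realType) (d : nat) := gen_eqMixin (density R d).
HB.instance Definition _ (R : realType) (d : nat) :=
  gen_choiceMixin (density R d).
HB.instance Definition _ (R : realType) (d : nat) := gen_eqMixin (Theta R d).
HB.instance Definition _ (R : realType) (d : nat) := gen_choiceMixin (Theta R d).

Lemma is_density_delta (R : realType) (d : nat) :
  is_density (delta_mx 0 0 : 'M[R[i]]_d.+1).
Proof.
split; last first.
  rewrite /mxtrace (bigD1 0)//= big1 ?addr0; first by rewrite mxE eqxx.
  by move=> i /negbTE i0; rewrite mxE i0.
split.
  apply/is_hermitianmxP; rewrite expr0 scale1r.
  by apply/matrixP => i j; rewrite !mxE rmorph_nat andbC.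
move=> v; rewrite -(mul_delta_mx (0 : 'I_1)) mulmxA -mulmxA -rowE -colE.
by rewrite !mxE big_ord1 !mxE mulrC -normCK exprn_ge0.
Qed.

HB.instance Definition _ (R : realType) (d : nat) :=
  isPointed.Build (density R d.+1) (Density (@is_density_delta R d)).
HB.instance Definition _ (R : realType) (d : nat) :=
  isPointed.Build (Theta R d.+1) (Spec (point : density R d.+1)).

Definition density_open (R : realType) (d : nat) : set (set (density R d)) :=
  [set B | exists2 O : set 'M[(R[i])^o]_d, open O &
     B = [set rho : density R d | O (density_mx rho)]].

Definition density_borel (R : realType) (d : nat) : set (set (density R d)) :=
  <<s @density_open R d >>.

HB.instance Definition _ (R : realType) (d : nat) :=
  @isMeasurable.Build default_measure_display (density R d.+1)
    (@density_borel R d.+1)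
    (@sigma_algebra0 _ setT (@density_open R d.+1))
    (@sigma_algebraC _ (@density_open R d.+1))
    (@sigma_algebra_bigcup _ setT (@density_open R d.+1)).

Definition Theta_borel (R : realType) (d : nat) : set (set (Theta R d)) :=
  preimage_set_system [set: Theta R d] (@theta_val R d) measurable.

Lemma sigma_algebra_Theta_borel (R : realType) (d : nat) :
  sigma_algebra setT (@Theta_borel R d).
Proof. exact/sigma_algebra_preimage/sigma_algebra_measurable. Qed.

Lemma Theta_borel0 (R : realType) (d : nat) : @Theta_borel R d set0.
Proof. by case: (@sigma_algebra_Theta_borel R d). Qed.

Lemma Theta_borelC (R : realType) (d : nat) (B : set (Theta R d)) :
  Theta_borel B -> Theta_borel (~` B).
Proof. by rewrite -setTD; case: (@sigma_algebra_Theta_borel R d) => _ + _; exact. Qed.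

Lemma Theta_borel_bigcup (R : realType) (d : nat) (F : (set (Theta R d))^nat) :
  (forall k, Theta_borel (F k)) -> Theta_borel (\bigcup_k F k).
Proof. by case: (@sigma_algebra_Theta_borel R d) => _ _; exact. Qed.

HB.instance Definition _ (R : realType) (d : nat) :=
  @isMeasurable.Build default_measure_display (Theta R d.+1)
    (@Theta_borel R d.+1) (@Theta_borel0 R d.+1) (@Theta_borelC R d.+1)
    (@Theta_borel_bigcup R d.+1).

(* (C^d)^{(x) n}: its basis vectors e_g = e_{g 0} (x) ... (x) e_{g (n-1)} are  *)
(* indexed by the maps g : 'I_n -> 'I_d, enumerated by enum_val.              *)

Definition tdim (n d : nat) : nat := #|{: {ffun 'I_n -> 'I_d}}|.

Definition basis_map (n d : nat) (a : 'I_(tdim n d)) : {ffun 'I_n -> 'I_d} :=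
  enum_val a.

Definition tensor_power (R : realType) (n d : nat) (M : 'M[R[i]]_d) :
    'M[R[i]]_(tdim n d) :=
  \matrix_(a, b) \prod_(k < n) M (basis_map a k) (basis_map b k).

(* s sends e_g to e_{g o s^-1}: the factor in position k moves to s k.        *)
Definition perm_op (R : realType) (n d : nat) (s : 'S_n) :
    'M[R[i]]_(tdim n d) :=
  \matrix_(a, b) [forall k, basis_map a (s k) == basis_map b k]%:R.

(* Y_{n,d}; trailing parts may be zero.                                       *)
Definition is_young (n d : nat) (p : d.-tuple 'I_n.+1) : bool :=
  sorted geq [seq val k | k <- p] && (sumn [seq val k | k <- p] == n).

Definition young (n d : nat) : Type := {p : d.-tuple 'I_n.+1 | is_young p}.

HB.instance Definition _ (n d : nat) := Finite.on (young n d).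

Definition parts (n d : nat) (lam : young n d) : seq nat :=
  [seq val k | k <- val lam].

Lemma is_young_row (n d : nat) :
  is_young [tuple of ord_max :: nseq d (ord0 : 'I_n.+1)].
Proof.
rewrite /is_young /= map_nseq /= sumn_nseq mul0n addn0 eqxx andbT.
by elim: d n => //= d IH n; rewrite leq0n; exact: (IH 0).
Qed.

HB.instance Definition _ (n d : nat) :=
  isPointed.Build (young n d.+1)
    (exist (fun p => is_true (@is_young n d.+1 p)) _ (is_young_row n d)).

HB.instance Definition _ (n d : nat) :=
  @isMeasurable.Build default_measure_display (young n d.+1)
    discrete_measurable discrete_measurable0 discrete_measurableC
    discrete_measurableU.

(* The standard tableau of shape lam: the boxes are numbered 0, ..., n - 1    *)
(* row by row, so that reshape_index and reshape_offset give the row and the  *)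
(* column of a box.                                                           *)
Definition row_group (n d : nat) (lam : young n d) : {set 'S_n} :=
  [set s : 'S_n | [forall k : 'I_n,
     reshape_index (parts lam) (s k) == reshape_index (parts lam) k]]%SET.

Definition col_group (n d : nat) (lam : young n d) : {set 'S_n} :=
  [set s : 'S_n | [forall k : 'I_n,
     reshape_offset (parts lam) (s k) == reshape_offset (parts lam) k]]%SET.

(* The action on (C^d)^{(x) n} of the Young symmetrizer c_lam; the left ideal *)
(* C[S_n] c_lam is the irreducible (Specht) module V_lam.                     *)
Definition young_symmetrizer (R : realType) (n d : nat) (lam : young n d) :
    'M[R[i]]_(tdim n d) :=
  (\sum_(s in row_group lam) perm_op R d s) *m
  (\sum_(s in col_group lam) (-1) ^+ odd_perm s *: perm_op R d s).

(* The lam-block U_lam (x) V_lam is the V_lam-isotypic component, that is the *)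
(* sum of the images of all S_n-homomorphisms from C[S_n] c_lam; each of them *)
(* is x |-> x w for some w, so the block is the linear span of the vectors    *)
(* s c_lam w. Subspaces are row spaces, whence the transposition.             *)
Definition schur_weyl_block (R : realType) (n d : nat) (lam : young n d) :
    'M[R[i]]_(tdim n d) :=
  (\sum_(s : 'S_n) <<(perm_op R d s *m young_symmetrizer R lam)^T>>)%MS.

Definition wss_proj (R : realType) (n d : nat) (lam : young n d) :
    'M[R[i]]_(tdim n d) :=
  (proj_ortho (schur_weyl_block R lam))^T.

Definition wss_prob (R : realType) (n d : nat) (M : 'M[R[i]]_d)
    (lam : young n d) : R :=
  complex.Re (\tr (tensor_power n M *m wss_proj R lam)).

Definition diag_theta (R : realType) (d : nat) (theta : Theta R d) :
    'M[R[i]]_d :=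
  diag_mx (\row_(k < d) (tnth theta k)%:C%C).

(* A Hausdorff pseudometric is a metric, so these are the completely          *)
(* metrizable separable spaces.                                               *)
Definition polish (R : realType) (T : completePseudoMetricType R) : Prop :=
  hausdorff_space T /\ exists S : set T, countable S /\ dense S.

Definition standard_borel (R : realType) (dA : measure_display)
    (A : measurableType dA) : Prop :=
  exists (T : completePseudoMetricType R) (f : A -> T),
    [/\ polish T, bijective f &
        forall B : set A, measurable B <-> <<s @open T >> (f @` B)].

(* Only the values of effect on measurable sets matter. The limit is taken in *)
(* the weak operator topology.                                                *)
Record povm (R : realType) (dA : measure_display) (A : measurableType dA)
    (N : nat) : Type := Povm {
  effect :> set A -> 'M[R[i]]_N;
  effect_psd : forall B, measurable B -> psdmx (effect B);
  effect_sigma_additive : forall F : (set A)^nat,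
    (forall k, measurable (F k)) -> trivIset setT F ->
    forall u v : 'cV[R[i]]_N,
      (fun m => \sum_(k < m) (u^t* *m effect (F k) *m v) 0 0 : (R[i])^o)
        @ \oo --> ((u^t* *m effect (\bigcup_k F k) *m v) 0 0 : (R[i])^o);
  effectT : effect [set: A] = 1%:M }.

Definition outcome_measure (R : realType) (dA : measure_display)
    (A : measurableType dA) (n d : nat) (D : povm R A (tdim n d))
    (rho : density R d) : set A -> \bar R :=
  fun B => (complex.Re (\tr (tensor_power n rho *m D B)))%:E.

Definition bayes_risk (R : realType) (dA : measure_display)
    (A : measurableType dA) (n d : nat) (prior : probability (density R d.+1) R)
    (L : density R d.+1 -> A -> \bar R) (D : povm R A (tdim n d.+1)) : \bar R :=
  \int[prior]_(rho in setT)
    \int[outcome_measure D rho]_(a in setT) L rho a.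

Definition wss_risk (R : realType) (dA : measure_display)
    (A : measurableType dA) (n d : nat) (prior : probability (density R d.+1) R)
    (L : density R d.+1 -> A -> \bar R)
    (delta : R.-pker (young n d.+1) ~> A) : \bar R :=
  \int[prior]_(rho in setT)
    (\sum_(lam : young n d.+1)
      (wss_prob rho lam)%:E * \int[delta lam]_(a in setT) L rho a)%E.

Definition bayes_optimal (R : realType) (dA : measure_display)
    (A : measurableType dA) (n d : nat) (prior : probability (density R d.+1) R)
    (L : density R d.+1 -> A -> \bar R) (D : povm R A (tdim n d.+1)) : Prop :=
  forall D' : povm R A (tdim n d.+1),
    (bayes_risk prior L D <= bayes_risk prior L D')%E.

Definition is_wss_then (R : realType) (dA : measure_display)
    (A : measurableType dA) (n d : nat) (a : young n d -> A)
    (D : povm R A (tdim n d)) : Prop :=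
  forall B, measurable B ->
    D B = \sum_(lam : young n d | a lam \in B) wss_proj R lam.

Definition unitarily_invariant (R : realType) (d : nat)
    (prior : probability (density R d.+1) R) : Prop :=
  forall (U : 'M[R[i]]_d.+1) (hU : U \is unitarymx) (B : set (density R d.+1)),
    measurable B -> prior (conj_density hU @^-1` B) = prior B.

Definition spectral_prior (R : realType) (d : nat)
    (prior : probability (density R d.+1) R) : set (Theta R d.+1) -> \bar R :=
  pushforward prior (@Spec R d.+1).

Definition evidence (R : realType) (n d : nat)
    (Pi : set (Theta R d.+1) -> \bar R) (lam : young n d.+1) : \bar R :=
  \int[Pi]_(theta in setT) (wss_prob (diag_theta theta) lam)%:E.

(* The posterior is unconstrained at the lam of zero evidence.                *)
Definition is_posterior (R : realType) (n d : nat)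
    (Pi : set (Theta R d.+1) -> \bar R)
    (post : young n d.+1 -> probability (Theta R d.+1) R) : Prop :=
  forall lam, (0 < evidence Pi lam)%E ->
    forall B, measurable B ->
      post lam B = ((\int[Pi]_(theta in B) (wss_prob (diag_theta theta) lam)%:E)
                    / evidence Pi lam)%E.

Definition is_posterior_bayes_action (R : realType) (dA : measure_display)
    (A : measurableType dA) (n d : nat) (ell : Theta R d.+1 * A -> \bar R)
    (post : young n d.+1 -> probability (Theta R d.+1) R)
    (a : young n d.+1 -> A) : Prop :=
  forall lam (b : A),
    (\int[post lam]_(theta in setT) ell (theta, a lam) <=
     \int[post lam]_(theta in setT) ell (theta, b))%E.

(* Main.v *)
(* Unitary invariance makes the operator T_G, the integral of rho^{(x) n} over *)
(* the states whose spectrum lies in G, commute with every U^{(x) n} as well  *)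
(* as with every permutation of the factors. Such a T is a scalar on each     *)
(* Schur-Weyl block: T commutes with all M^{(x) n} (spectral theorem, then    *)
(* polynomial continuation), hence by polarization with all averages of       *)
(* s X s^{-1} over S_n. Let a and b be the row and signed column sums of a    *)
(* diagram, and f = a b a, a positive operator. As f s f is a multiple of f   *)
(* for every permutation s, T commutes with all f X f, so T f = c f, and the  *)
(* images of the s f span the block. The blocks are orthogonal and fill the   *)
(* tensor space, because the class sums generated by the f are orthogonal and *)
(* as many as the conjugacy classes of S_n. Therefore                         *)
(*   Tr(T_G E) = sum_lam Tr(T_G Pi_lam) Tr(Pi_lam E) / Tr Pi_lam,             *)
(* and delta_D(lam, B) = Tr(Pi_lam D(B)) / Tr Pi_lam induces with D the same  *)
(* joint law of spectrum and action, since the two laws agree on rectangles.  *)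
(* Conversely a rule delta comes from the POVM sum_lam delta(lam, B) Pi_lam,  *)
(* and by Tonelli its risk is a sum over lam of integrals against             *)
(* delta(lam, .) of the posterior loss, up to the evidence of lam.            *)

Require Import Defs.
From HB Require Import structures.
From mathcomp Require Import all_boot all_order all_algebra all_fingroup.
From mathcomp Require Import complex.
From mathcomp Require Import all_classical all_reals all_analysis.
From mathcomp Require Import measurable_realfun.

Set Implicit Arguments.
Unset Strict Implicit.
Unset Printing Implicit Defensive.

Import Order.TTheory GRing.Theory Num.Theory.
Import numFieldNormedType.Exports.

Local Open Scope classical_set_scope.
Local Open Scope ring_scope.
Local Open Scope sesquilinear_scope.

(** The loss sees a state only through its spectrum, so the Bayes risk of [D] depends only on the
    joint law of spectrum and action, and that law is fixed by the numbers
    $\operatorname{Tr}(T_G\,D(B))$ ([eq_mixture], [eq_bayes_integral]), where $T_G$ is [average].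
    This operator commutes with permutations ([average_perm]) and with all $U^{\otimes n}$
    ([average_unitary]). Schur-Weyl duality makes it scalar on each block ([young_block_eigen]), so
    replacing [D] by its block averages keeps these numbers ([trace_blocks], [decision_average]).

    The duality has two halves. On the combinatorial side, [row_factor] and [shape_dichotomy] yield
    one-dimensional corners ([young_psd_corner]) and orthogonality of distinct shapes
    ([young_sym_orth]); counting conjugacy classes ([class_coef_complete]) shows that the blocks
    exhaust the space ([wss_proj_sum]). On the side of the commutant, commutation with unitary
    powers is extended to all powers ([commute_power]), then by [polarization] to symmetrized
    operators ([commute_average]), and [corner_eigen] turns this into Schur's lemma.

    Conversely every rule is realized by a POVM of equal risk ([rule_povm], [wss_risk_rule]), so
    both families attain the same risks. The risk of a rule splits over diagrams
    ([wss_risk_density]), and a posterior Bayes action minimizes each summand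
    ([posterior_action_min]). *)

Section LevelStabilizer.
Variables (n : nat) (T : eqType) (f : 'I_n -> T).
Local Open Scope group_scope.

Definition stab : {set 'S_n} := [set s : 'S_n | [forall k, f (s k) == f k]]%SET.

Lemma stabP (s : 'S_n) : reflect (forall k, f (s k) = f k) (s \in stab).
Proof. by rewrite inE; apply: (iffP forallP) => h k; apply/eqP/h. Qed.

Lemma stab_group_set : group_set stab.
Proof.
apply/group_setP; split; first by apply/stabP => k; rewrite perm1.
move=> s t /stabP hs /stabP ht; apply/stabP => k.
by rewrite permM ht hs.
Qed.

Canonical stab_group := Group stab_group_set.

Lemma tperm_stab (k l : 'I_n) : f k = f l -> tperm k l \in stab.
Proof. by move=> kl; apply/stabP => i; case: tpermP => [->|->|]. Qed.
End LevelStabilizer.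

(** * Row and column groups of a diagram *)

Section Shapes.
Variable n : nat.
Implicit Types (sh : seq nat) (s : 'S_n) (i j k l : 'I_n).
Local Open Scope nat_scope.

Local Notation Row sh k := (reshape_index sh (@nat_of_ord n k)).
Local Notation Col sh k := (reshape_offset sh (@nat_of_ord n k)).

(** Shapes are bare sequences here, so that trailing zeros can be added or removed; on [parts lam]
    these sets are [row_group] and [col_group]. *)
Definition rowg sh : {set 'S_n} := stab (fun k => Row sh k).
Definition colg sh : {set 'S_n} := stab (fun k => Col sh k).

Lemma row_col_inj sh k l : Row sh k = Row sh l -> Col sh k = Col sh l -> k = l.
Proof.
move=> rkl ckl; apply/val_inj => /=.
by rewrite -(reshape_indexK sh k) -(reshape_indexK sh l) rkl ckl.
Qed.

Lemma rowg_colg sh s : s \in rowg sh -> s \in colg sh -> s = 1%g.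
Proof.
move=> /stabP hr /stabP hc; apply/permP => k; rewrite perm1.
exact: row_col_inj (hr k) (hc k).
Qed.

Lemma exists_box sh r c : sumn sh = n -> c < nth 0 sh r ->
  exists2 k : 'I_n, Row sh k = r & Col sh k = c.
Proof.
move=> shn hc; have := flatten_indexP hc; rewrite shn => hk.
by exists (Ordinal hk); rewrite /= ?flatten_indexKl ?flatten_indexKr.
Qed.

Lemma col_lt_row sh k : sumn sh = n -> Col sh k < nth 0 sh (Row sh k).
Proof. by move=> shn; apply: reshape_offsetP; rewrite shn. Qed.

Lemma nth_sorted sh p q : sorted geq sh -> p <= q -> nth 0 sh q <= nth 0 sh p.
Proof.
move=> srt pq; have [qs|qs] := ltnP q (size sh); last by rewrite nth_default.
apply: (sorted_leq_nth (leT := geq)) => //.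
- by move=> x y z yx zy; apply: leq_trans zy yx.
- exact: leqnn.
- by rewrite inE (leq_ltn_trans pq).
Qed.

Lemma exists_box_above sh k p : sorted geq sh -> sumn sh = n ->
  p <= Row sh k -> exists2 l, Row sh l = p & Col sh l = Col sh k.
Proof.
move=> srt shn pk; apply: exists_box => //.
by apply: leq_trans (col_lt_row k shn) _; exact: nth_sorted.
Qed.

(** When this fails, [s] carries a transposition in the row group of [sh] to one in the column group
    of [sh']. *)
Definition row_col_free sh sh' s :=
  [forall k, forall l, (Row sh k == Row sh l) && (Col sh' (s k) == Col sh' (s l))
    ==> (k == l)].

Lemma row_col_freeP sh sh' s : reflect
  (forall k l, Row sh k = Row sh l -> Col sh' (s k) = Col sh' (s l) -> k = l)
  (row_col_free sh sh' s).
Proof.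
apply: (iffP idP) => [h k l rkl ckl|h].
  by move/forallP: h => /(_ k)/forallP/(_ l); rewrite rkl ckl !eqxx => /eqP.
apply/forallP => k; apply/forallP => l; apply/implyP => /andP[/eqP rkl /eqP ckl].
exact/eqP/h.
Qed.

(** If column [j] of [sh'] stops before row [p], then [s] injects the left set into that column.
    Otherwise the column has a box in each of the first [p] rows, while freeness allows at most one
    box from each of these rows of [sh] on the left. *)
Lemma row_col_count sh sh' s (p j : nat) : sorted geq sh' -> sumn sh' = n ->
  row_col_free sh sh' s ->
  #|[set k | (Row sh k < p) && (Col sh' (s k) == j)]%SET| <=
  #|[set k : 'I_n | (Row sh' k < p) && (Col sh' k == j)]%SET|.
Proof.
move=> srt shn /row_col_freeP hfree.
case: (boolP [exists k : 'I_n, (p <= Row sh' k) && (Col sh' k == j)]); last first.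
  rewrite negb_exists => /forallP hk.
  apply: (@leq_trans #|s @: [set k | (Row sh k < p) && (Col sh' (s k) == j)]%SET|).
    by rewrite card_imset //; exact: perm_inj.
  apply/subset_leq_card/fintype.subsetP => x /imsetP[k + ->]; rewrite inE => /andP[_ ck].
  by rewrite inE ck andbT ltnNge; have := hk (s k); rewrite ck andbT.
move=> /existsP[k0 /andP[pk0 /eqP ck0]].
have inj1 : {in [set k | (Row sh k < p) && (Col sh' (s k) == j)]%SET &,
    injective (fun k => Row sh k)}.
  move=> k l; rewrite !inE => /andP[_ /eqP ck] /andP[_ /eqP cl] rkl.
  by apply: hfree => //; rewrite ck cl.
apply: (@leq_trans p).
  rewrite cardE -(size_map (fun k => Row sh k)) -[leqRHS](size_iota 0).
  apply: uniq_leq_size.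
    rewrite map_inj_in_uniq ?enum_uniq // => k l; rewrite !mem_enum.
    exact: inj1.
  move=> _ /mapP[k + ->]; rewrite mem_enum inE mem_iota => /andP[->].
  by [].
rewrite -[leqLHS](size_iota 0) cardE -(size_map (fun k : 'I_n => Row sh' k)).
apply: uniq_leq_size; first exact: iota_uniq.
move=> q; rewrite mem_iota /= add0n => qp.
have [|l rl cl] := @exists_box_above sh' k0 q srt shn.
  by apply: leq_trans pk0; exact: ltnW.
by apply/mapP; exists l => //; rewrite mem_enum inE rl qp cl ck0 eqxx.
Qed.

Lemma col_ltn sh k : sumn sh = n -> Col sh k < n.
Proof.
by move=> shn; apply: leq_ltn_trans (ltn_ord k); rewrite /reshape_offset leq_subr.
Qed.

Lemma card_by_col sh' s (P : pred 'I_n) : sumn sh' = n ->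
  #|[set k | P k]%SET| = \sum_(j < n) #|[set k | P k && (Col sh' (s k) == j)]%SET|.
Proof.
move=> shn; rewrite -sum1_card.
rewrite (partition_big (fun k => Ordinal (col_ltn (s k) shn)) xpredT) //=.
apply: eq_bigr => j _; rewrite -sum1_card; apply: eq_bigl => k.
by rewrite !inE; congr andb; apply/eqP/eqP => [<-//|h]; exact: val_inj.
Qed.

(** Summation over the columns: a free permutation exists only if [sh'] dominates [sh]. *)
Lemma row_count_le sh sh' s p : sorted geq sh' -> sumn sh' = n ->
  row_col_free sh sh' s ->
  #|[set k : 'I_n | Row sh k < p]%SET| <= #|[set k : 'I_n | Row sh' k < p]%SET|.
Proof.
move=> srt shn hfree; rewrite (card_by_col s _ shn).
rewrite (@card_by_col sh' 1%g _ shn); apply: leq_sum => j _.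
under [X in _ <= #|pred_of_set X|]eq_finset do rewrite perm1.
exact: row_col_count.
Qed.

(** The totals over the columns agree, so every bound of [row_col_count] is an equality. Hence there
    is a box in the row of [k] and the column of [s k], and sending [k] there is injective by
    freeness. A free permutation is thus a product of a row and a column permutation. *)
Lemma row_factor sh s : sorted geq sh -> sumn sh = n -> row_col_free sh sh s ->
  exists2 r, r \in rowg sh & forall k, Col sh (r k) = Col sh (s k).
Proof.
move=> srt shn hfree.
have count_eq (p j : nat) : j < n ->
    #|[set k | (Row sh k < p) && (Col sh (s k) == j)]%SET| =
    #|[set k : 'I_n | (Row sh k < p) && (Col sh k == j)]%SET|.
  move=> jn; have := card_by_col s (fun k => Row sh k < p) shn.
  rewrite (@card_by_col sh 1%g _ shn).
  under eq_bigr do under eq_finset do rewrite perm1.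
  move=> /esym/eqP; rewrite eqn_leq => /andP[_].
  rewrite leqNgt => hge; apply/eqP; rewrite eqn_leq row_col_count //=.
  rewrite leqNgt; apply: contra hge => hlt.
  rewrite (bigD1 (Ordinal jn)) //= [ltnRHS](bigD1 (Ordinal jn)) //=.
  by rewrite -addSn leq_add // leq_sum // => i _; exact: row_col_count.
(* Otherwise the column of [s k] lies wholly above the row of [k], and the equality of counts for
   the rows above [k] leaves no place for [k] itself. *)
have box k : Col sh (s k) < nth 0 sh (Row sh k).
  rewrite ltnNge; apply/negP => hbox.
  pose j := Col sh (s k); pose p := Row sh k.
  have jn : j < n by exact: col_ltn.
  have sub1 : [set l : 'I_n | (Row sh l < p) && (Col sh l == j)]%SET =
              [set l : 'I_n | Col sh l == j]%SET.
    apply/setP => l; rewrite !inE andb_idl // => /eqP cl.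
    rewrite ltnNge; apply/negP => pl.
    have := col_lt_row l shn; rewrite cl ltnNge => /negP; apply.
    by apply: leq_trans hbox; exact: nth_sorted.
  have := count_eq p j jn; rewrite sub1.
  have -> : #|[set l : 'I_n | Col sh l == j]%SET| =
            #|[set l | Col sh (s l) == j]%SET|.
    rewrite -(card_preimset [set l : 'I_n | Col sh l == j]%SET (@perm_inj _ s)).
    by apply: eq_card => l; rewrite !inE.
  move=> /eqP; rewrite eqn_leq => /andP[_ ]; rewrite leqNgt => /negP; apply.
  apply: proper_card; apply/properP; split.
    by apply/fintype.subsetP => l; rewrite !inE => /andP[].
  by exists k; rewrite !inE ?eqxx // ltnn.
have r_lt k : flatten_index sh (Row sh k) (Col sh (s k)) < n.
  by rewrite -[ltnRHS]shn; exact: flatten_indexP.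
pose r0 k := Ordinal (r_lt k).
have r0row k : Row sh (r0 k) = Row sh k by rewrite /= flatten_indexKl.
have r0col k : Col sh (r0 k) = Col sh (s k) by rewrite /= flatten_indexKr.
have r0inj : injective r0.
  move=> k l e; move/row_col_freeP: hfree; apply.
    by rewrite -r0row e r0row.
  by rewrite -r0col e r0col.
exists (perm r0inj); first by apply/stabP => k; rewrite permE r0row.
by move=> k; rewrite permE r0col.
Qed.

Lemma card_row sh p : sumn sh = n -> #|[set k : 'I_n | Row sh k == p]%SET| = nth 0 sh p.
Proof.
move=> shn; rewrite -[RHS]card_ord.
have h (c : 'I_(nth 0 sh p)) : flatten_index sh p c < n.
  by rewrite -[ltnRHS]shn; exact: flatten_indexP.
rewrite -(@card_imset _ _ (fun c => Ordinal (h c))); last first.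
  move=> c1 c2 /(congr1 (fun x : 'I_n => Col sh x)).
  by rewrite /= !flatten_indexKr // => /val_inj.
apply: eq_card => k; rewrite inE; apply/eqP/imsetP => [rk|[c _ ->]].
  have ck : Col sh k < nth 0 sh p by rewrite -rk; exact: col_lt_row.
  exists (Ordinal ck) => //; apply: val_inj => /=.
  by rewrite -{1}rk reshape_indexK.
by rewrite /= flatten_indexKl.
Qed.

Lemma row_count_inj sh sh' : size sh = size sh' -> sumn sh = n -> sumn sh' = n ->
  (forall p, #|[set k : 'I_n | Row sh k < p]%SET| =
             #|[set k : 'I_n | Row sh' k < p]%SET|) -> sh = sh'.
Proof.
move=> szE shn shn' h; apply: (eq_from_nth (x0 := 0)) => // p _.
have split_row sh1 : sumn sh1 = n -> #|[set k : 'I_n | Row sh1 k < p.+1]%SET| =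
    #|[set k : 'I_n | Row sh1 k < p]%SET| + nth 0 sh1 p.
  move=> sh1n; rewrite -(card_row p sh1n) -cardsUI.
  rewrite [X in _ = _ + X](_ : _ = 0) ?addn0; last first.
    apply/eqP; rewrite cards_eq0; apply/eqP/setP => k; rewrite !inE.
    by case: ltngtP.
  by apply: eq_card => k; rewrite !inE ltnS leq_eqVlt orbC.
have := h p.+1; rewrite !split_row // h => /eqP.
by rewrite eqn_add2l => /eqP.
Qed.

(** Free permutations in both directions would make each shape dominate the other. *)
Lemma shape_dichotomy sh sh' : sorted geq sh -> sorted geq sh' ->
  size sh = size sh' -> sumn sh = n -> sumn sh' = n -> sh != sh' ->
  (forall s, ~~ row_col_free sh sh' s) \/ (forall s, ~~ row_col_free sh' sh s).
Proof.
move=> srt srt' szE shn shn' neq.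
have [|] := pselect (exists s, row_col_free sh sh' s); last first.
  by move=> h; left=> s; apply/negP => hs; apply: h; exists s.
have [|] := pselect (exists s, row_col_free sh' sh s); last first.
  by move=> h _; right=> s; apply/negP => hs; apply: h; exists s.
move=> [s hs] [t ht]; case/eqP: neq; apply: row_count_inj => // p.
by apply/eqP; rewrite eqn_leq (row_count_le _ _ _ ht) // (row_count_le _ _ _ hs).
Qed.
End Shapes.

(** * Cycle types and conjugacy *)

Section CycleType.
Variable n : nat.
Local Open Scope nat_scope.

Lemma young_of_seq N (sh : seq nat) : sorted geq sh -> sumn sh = n ->
  size sh <= N -> {lam : young n N | parts lam = sh ++ nseq (N - size sh) 0}.
Proof.
move=> srt shn szN.
have le_n i : nth 0 sh i < n.+1.
  rewrite ltnS -shn; have [si|si] := ltnP i (size sh); last by rewrite nth_default.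
  rewrite -[X in sumn X](cat_take_drop i sh) (drop_nth 0 si) sumn_cat /=.
  by rewrite addnCA leq_addr.
pose p : N.-tuple 'I_n.+1 := [tuple inord (nth 0 sh i) | i < N].
have pE : [seq val k | k <- p] = sh ++ nseq (N - size sh) 0.
  apply: (eq_from_nth (x0 := 0)).
    by rewrite size_map size_tuple size_cat size_nseq subnKC.
  move=> i; rewrite size_map size_tuple => iN.
  rewrite (nth_map ord0) ?size_tuple // -[ i ]/(nat_of_ord (Ordinal iN)).
  rewrite -(tnth_nth ord0) tnth_mktuple /= inordK // nth_cat nth_nseq.
  by case: ltnP => // h; rewrite nth_default //; case: ifP.
have py : is_young p.
  rewrite /is_young pE sumn_cat sumn_nseq mul0n addn0 shn eqxx andbT.
  move: srt; case: sh {shn szN le_n p pE} => [_|a sh] /=.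
    by elim: (N - 0) => //= -[|m] //=.
  rewrite cat_path => ->; elim: (N - _) (last a sh) => //=.
by exists (exist _ p py); rewrite /parts /= pE.
Qed.

Definition cycle_reps (s : 'S_n) : seq 'I_n :=
  sort (fun x y => fingraph.order s y <= fingraph.order s x) (enum (froots s)).

Definition cycle_lengths (s : 'S_n) : seq nat := map (fingraph.order s) (cycle_reps s).

Lemma cycle_repsE (s : 'S_n) x : (x \in cycle_reps s) = (froot s x == x).
Proof. by rewrite mem_sort mem_enum. Qed.

Lemma cycle_reps_uniq (s : 'S_n) : uniq (cycle_reps s).
Proof. by rewrite sort_uniq enum_uniq. Qed.

Lemma sorted_cycle_lengths (s : 'S_n) : sorted geq (cycle_lengths s).
Proof.
rewrite /cycle_lengths sorted_map; apply: sort_sorted => x y /=.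
exact: leq_total.
Qed.

Lemma fconnect_perm_sym (s : 'S_n) : fingraph.connect_sym (frel s).
Proof. exact: fconnect_sym (@perm_inj _ s). Qed.

Lemma sumn_cycle_lengths (s : 'S_n) : sumn (cycle_lengths s) = n.
Proof.
rewrite /cycle_lengths sumnE big_map (perm_big (enum (froots s))) /=; last first.
  by rewrite /cycle_reps perm_sort.
rewrite big_enum /= -[RHS](card_ord n) -sum1_card.
rewrite [RHS](partition_big (froot s) [in froots s]) /=; last first.
  by move=> x _; apply: (roots_root (fconnect_perm_sym s)).
apply: eq_bigr => x /eqP rx; rewrite sum1_card.
apply: eq_card => y; rewrite [LHS]unfold_in [RHS]unfold_in /= -[x in RHS]rx.
by rewrite -[RHS]/(froot s y == froot s x) (root_connect (fconnect_perm_sym s)) fconnect_perm_sym.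
Qed.

Lemma size_cycle_lengths (s : 'S_n) : size (cycle_lengths s) <= n.
Proof.
rewrite size_map; rewrite -[leqRHS](card_ord n) cardE.
apply: uniq_leq_size (cycle_reps_uniq s) _ => x _.
by rewrite mem_enum.
Qed.

Definition cycle_type (s : 'S_n) : young n n :=
  sval (young_of_seq (sorted_cycle_lengths s) (sumn_cycle_lengths s)
                     (size_cycle_lengths s)).

Lemma cycle_type_lengths (s t : 'S_n) :
  cycle_type s = cycle_type t -> cycle_lengths s = cycle_lengths t.
Proof.
move=> e.
have filterE (u : 'S_n) : [seq m <- parts (cycle_type u) | 0 < m] = cycle_lengths u.
  rewrite /cycle_type; case: young_of_seq => lam /= ->.
  rewrite filter_cat (_ : [seq m <- nseq _ 0 | 0 < m] = [::]); last by elim: (n - _).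
  rewrite cats0; apply/all_filterP/allP => _ /mapP[x _ ->].
  exact: fingraph.order_gt0.
by rewrite -!filterE e.
Qed.

(** Cycles of equal length are paired by their rank in the sorted lists; matching their
    representatives extends along the orbits to the conjugating permutation. *)
Lemma cycle_type_conj (s t : 'S_n) :
  cycle_type s = cycle_type t -> exists u : 'S_n, forall x, u (s x) = t (u x).
Proof.
move=> /cycle_type_lengths; rewrite /cycle_lengths.
move: (cycle_reps s) (cycle_reps t) (cycle_repsE s) (cycle_repsE t)
  (cycle_reps_uniq s) (cycle_reps_uniq t) => xs ys xsE ysE xs_uniq ys_uniq lenE.
have szE : size xs = size ys by rewrite -(size_map (fingraph.order s)) lenE size_map.
pose base x := nth x ys (index x xs).
have ssym := fconnect_perm_sym s; have tsym := fconnect_perm_sym t.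
have root_in x : froot s x \in xs by rewrite xsE (root_root ssym).
have base_order x : x \in xs -> fingraph.order t (base x) = fingraph.order s x.
  move=> xx; have ix : index x xs < size xs by rewrite index_mem.
  rewrite /base -(nth_map x 0) -?szE // -lenE (nth_map x) //.
  by rewrite nth_index.
have base_in x : x \in xs -> base x \in ys.
  by move=> xx; rewrite mem_nth // -szE index_mem.
have base_inj : {in xs &, injective base}.
  move=> x y xx yx; rewrite /base (set_nth_default y) -?szE ?index_mem // => /eqP.
  rewrite nth_uniq -?szE ?index_mem // => /eqP e.
  by rewrite -(nth_index x xx) e nth_index.
pose idx x := findex s (froot s x) x.
pose u0 x := iter (idx x) t (base (froot s x)).
have conn x : fconnect s (froot s x) x by rewrite ssym; exact: connect_root.
have idxK x : iter (idx x) s (froot s x) = x by exact: iter_findex.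
have idx_lt x : idx x < fingraph.order t (base (froot s x)).
  by rewrite base_order //; exact: findex_max.
have rootS x : froot s (s x) = froot s x.
  by apply/esym/eqP; rewrite (root_connect ssym) fconnect1.
have u0S x : u0 (s x) = t (u0 x).
  rewrite /u0 rootS -iterS.
  (* At the last point of a cycle both orbits wrap around together, the paired cycles having the
     same length. *)
  have := idx_lt x; rewrite base_order // leq_eqVlt => /orP[/eqP e|lt].
    have sx : s x = froot s x.
      by rewrite -[in LHS](idxK x) -iterS e iter_order //; exact: perm_inj.
    rewrite e -base_order // iter_order; last exact: perm_inj.
    by rewrite /idx rootS sx findex0.
  by congr iter; rewrite /idx rootS -{2}(idxK x) -iterS findex_iter.
have u0_inj : injective u0.
  move=> x y e.
  have root_base z : froot t (u0 z) = base (froot s z).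
    have /base_in := root_in z; rewrite ysE => /eqP bE; rewrite -[RHS]bE.
    by apply/esym/eqP; rewrite (root_connect tsym) fconnect_iter.
  have rE : froot s x = froot s y.
    by apply: base_inj => //; rewrite -!root_base e.
  rewrite -(idxK x) -(idxK y) rE; congr iter.
  rewrite -(findex_iter (idx_lt x)) -(findex_iter (idx_lt y)) -/(u0 y) -e rE.
  by rewrite /u0 rE.
by exists (perm u0_inj) => x; rewrite !permE.
Qed.
End CycleType.

(** * Young symmetrizers on the tensor space *)

Section TensorBasis.
Variables (R : realType) (n d : nat).
Local Notation C := R[i].
Implicit Types (s t : 'S_n) (X Y : 'M[C]_(tdim n d)).

Lemma sum_basis (V : nmodType) (F : {ffun 'I_n -> 'I_d} -> V) :
  \sum_(a < tdim n d) F (basis_map a) = \sum_g F g.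
Proof.
rewrite [RHS](reindex_onto (@basis_map n d) (@enum_rank _)) /=; last first.
  by move=> g _; rewrite /basis_map enum_rankK.
by apply: eq_bigl => a; rewrite /basis_map enum_valK eqxx.
Qed.

Lemma basis_map_inj : injective (@basis_map n d).
Proof. exact: enum_val_inj. Qed.

Lemma matrix_basisP X Y :
  (forall g h, X (enum_rank g) (enum_rank h) = Y (enum_rank g) (enum_rank h)) -> X = Y.
Proof.
by move=> h; apply/matrixP => a b; rewrite -(enum_valK a) -(enum_valK b).
Qed.

(** The elementary tensor $M_0\otimes\dots\otimes M_{n-1}$. *)
Definition tens (M : 'I_n -> 'M[C]_d) : 'M[C]_(tdim n d) :=
  \matrix_(a, b) \prod_(k < n) M k (basis_map a k) (basis_map b k).

Lemma tens_power (M : 'M[C]_d) : tensor_power n M = tens (fun=> M).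
Proof. by []. Qed.

Lemma tensM M M' : tens M *m tens M' = tens (fun k => M k *m M' k).
Proof.
apply/matrixP => a b; rewrite !mxE.
under eq_bigr do rewrite !mxE -big_split /=.
rewrite (sum_basis (fun g => \prod_k (M k (basis_map a k) (g k) *
  M' k (g k) (basis_map b k)))).
rewrite -(bigA_distr_bigA (fun k j => M k (basis_map a k) j * M' k j (basis_map b k))).
by apply: eq_bigr => k _; rewrite mxE.
Qed.

Lemma tens1 : tens (fun=> 1%:M) = 1%:M.
Proof.
apply/matrixP => a b; rewrite !mxE.
have [->|neq] := eqVneq a b; first by rewrite big1 // => k _; rewrite mxE eqxx.
case: (boolP [forall k, basis_map a k == basis_map b k]) => [/forallP h|].
  by case/eqP: neq; apply: basis_map_inj; apply/ffunP => k; exact/eqP.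
rewrite negb_forall => /existsP[k hk]; rewrite (bigD1 k) //= mxE.
by rewrite (negbTE hk) mul0r.
Qed.

Lemma tens_adj M : (tens M)^t* = tens (fun k => (M k)^t*).
Proof.
apply/matrixP => a b; rewrite !mxE rmorph_prod; apply: eq_bigr => k _.
by rewrite !mxE.
Qed.

Local Notation P s := (@perm_op R n d s).

Definition precomp (g : {ffun 'I_n -> 'I_d}) s : {ffun 'I_n -> 'I_d} :=
  [ffun k => g (s k)].

Lemma perm_opE s a b : P s a b = (precomp (basis_map a) s == basis_map b)%:R.
Proof.
rewrite mxE; congr (nat_of_bool _)%:R; apply/forallP/eqP => [h|<- k].
  by apply/ffunP => k; rewrite ffunE; exact/eqP.
by rewrite ffunE.
Qed.

Lemma mul_perm_opl s X a b :
  (P s *m X) a b = X (enum_rank (precomp (basis_map a) s)) b.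
Proof.
rewrite mxE (bigD1 (enum_rank (precomp (basis_map a) s))) //= big1 ?addr0.
  by rewrite perm_opE /basis_map enum_rankK eqxx mul1r.
move=> c hc; rewrite perm_opE; case: eqP => [e|_]; last by rewrite mul0r.
by case/eqP: hc; rewrite e /basis_map enum_valK.
Qed.

Lemma mul_perm_opr s X a b :
  (X *m P s) a b = X a (enum_rank (precomp (basis_map b) s^-1)).
Proof.
rewrite mxE (bigD1 (enum_rank (precomp (basis_map b) s^-1))) //= big1 ?addr0.
  rewrite perm_opE /basis_map enum_rankK; case: eqP => [_|[]]; first by rewrite mulr1.
  by apply/ffunP => k; rewrite !ffunE permK.
move=> c hc; rewrite perm_opE; case: eqP => [e|_]; last by rewrite mulr0.
case/eqP: hc; rewrite -e -[LHS]enum_valK; congr enum_rank.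
by apply/ffunP => k; rewrite !ffunE permKV.
Qed.

Lemma perm_op1 : P 1%g = 1%:M.
Proof.
apply/matrixP => a b; rewrite perm_opE mxE; congr (nat_of_bool _)%:R.
rewrite (_ : precomp _ _ = basis_map a); last by apply/ffunP => k; rewrite ffunE perm1.
exact: (inj_eq basis_map_inj).
Qed.

(** The order is reversed because products in ['S_n] compose from left to right. *)
Lemma perm_opM s t : P s *m P t = P (t * s)%g.
Proof.
apply/matrixP => a b; rewrite mul_perm_opl !perm_opE /basis_map enum_rankK.
by congr (nat_of_bool (_ == _))%:R; apply/ffunP => k; rewrite !ffunE permM.
Qed.

Lemma perm_op_adj s : (P s)^t* = P s^-1%g.
Proof.
apply/matrixP => a b; rewrite mxE mxE !perm_opE rmorph_nat.
congr (nat_of_bool _)%:R; apply/eqP/eqP => [<-|<-]; apply/ffunP => k;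
  by rewrite !ffunE ?permKV ?permK.
Qed.

Lemma perm_op_tens s M : P s *m tens M = tens (fun k => M ((s^-1)%g k)) *m P s.
Proof.
apply/matrixP => a b; rewrite mul_perm_opl mul_perm_opr !mxE.
rewrite [RHS](reindex_inj (@perm_inj _ s)) /=; apply: eq_bigr => k _.
by rewrite /basis_map !enum_rankK !ffunE permK.
Qed.

Lemma perm_op_power s (M : 'M[C]_d) :
  P s *m tensor_power n M = tensor_power n M *m P s.
Proof. exact: perm_op_tens. Qed.

End TensorBasis.

(** * Operators coming from the group algebra of the symmetric group *)

Section GroupAlgebra.
Variables (R : realType) (n d : nat).
Local Notation C := R[i].
Local Notation P s := (@perm_op R n d s).
Implicit Types (s t u v : 'S_n) (X Y : 'M[C]_(tdim n d)) (k l : 'S_n -> C).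

Definition gop k : 'M[C]_(tdim n d) := \sum_s k s *: P s.

(** Convolution in the order imposed by [perm_opM]: the pair [s], [t] contributes to [t * s]. *)
Definition conv k l : 'S_n -> C := fun u => \sum_s k s * l (u * s^-1)%g.

Lemma gopM k l : gop k *m gop l = gop (conv k l).
Proof.
rewrite /gop mulmx_suml.
under eq_bigr do rewrite mulmx_sumr.
under [RHS]eq_bigr do rewrite scaler_suml.
rewrite [RHS]exchange_big /=; apply: eq_bigr => s _.
rewrite [RHS](reindex_inj (mulIg s)) /=; apply: eq_bigr => t _.
by rewrite -scalemxAl -scalemxAr perm_opM scalerA mulgK.
Qed.

Lemma eq_gop k l : k =1 l -> gop k = gop l.
Proof. by move=> e; apply: eq_bigr => s _; rewrite e. Qed.

Lemma gop_sum (I : finType) (x : I -> C) (f : I -> 'S_n -> C) :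
  \sum_i x i *: gop (f i) = gop (fun t => \sum_i x i * f i t).
Proof.
rewrite /gop; under eq_bigr do rewrite scaler_sumr.
rewrite exchange_big /=; apply: eq_bigr => s _.
by rewrite scaler_suml; apply: eq_bigr => i _; rewrite scalerA.
Qed.

Lemma gop_delta : gop (fun t => (t == 1%g)%:R) = 1%:M.
Proof.
rewrite /gop (bigD1 1%g) //= eqxx scale1r perm_op1 big1 ?addr0 //.
by move=> s /negbTE ->; rewrite scale0r.
Qed.

Lemma gop_perm s : P s = gop (fun t => (t == s)%:R).
Proof.
rewrite /gop (bigD1 s) //= eqxx scale1r big1 ?addr0 //.
by move=> t /negbTE ->; rewrite scale0r.
Qed.

Lemma gop_conj k : \sum_s P s *m gop k *m P s^-1%g =
  gop (fun u => \sum_s k (u ^ s)%g).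
Proof.
rewrite /gop; under [RHS]eq_bigr do rewrite scaler_suml.
rewrite [RHS]exchange_big /= [RHS](reindex_inj invg_inj) /=; apply: eq_bigr => s _.
rewrite mulmx_sumr mulmx_suml [RHS](reindex_inj (conjg_inj s)) /=.
apply: eq_bigr => t _; rewrite -scalemxAr -scalemxAl !perm_opM conjgK.
by rewrite /conjg mulgA.
Qed.

End GroupAlgebra.

Section Positivity.
Variables (R : realType).
Local Notation C := R[i].

Lemma adjM m p q (A : 'M[C]_(m, p)) (B : 'M[C]_(p, q)) :
  (A *m B)^t* = B^t* *m A^t*.
Proof. by rewrite trmx_mul map_mxM. Qed.

Lemma adjZ m p (c : C) (A : 'M[C]_(m, p)) : (c *: A)^t* = c^* *: A^t*.
Proof. by apply/matrixP => i j; rewrite !mxE rmorphM. Qed.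

Lemma adj_inj m p (A B : 'M[C]_(m, p)) : A^t* = B^t* -> A = B.
Proof. by move=> e; rewrite -[A]trmxCK e trmxCK. Qed.

Lemma adj_sum m p (I : Type) (r : seq I) (Q : pred I) (F : I -> 'M[C]_(m, p)) :
  (\sum_(i <- r | Q i) F i)^t* = \sum_(i <- r | Q i) (F i)^t*.
Proof. by rewrite linear_sum /= map_mx_sum. Qed.

Lemma trace_gram m p (A : 'M[C]_(m, p)) :
  \tr (A *m A^t*) = \sum_i \sum_j `|A i j| ^+ 2.
Proof.
rewrite /mxtrace; apply: eq_bigr => i _; rewrite mxE.
by apply: eq_bigr => j _; rewrite !mxE normCK.
Qed.

Lemma gram_eq0 m p (A : 'M[C]_(m, p)) : \tr (A *m A^t*) = 0 -> A = 0.
Proof.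
rewrite trace_gram => /eqP; rewrite psumr_eq0; last first.
  by move=> i _; rewrite sumr_ge0 // => j _; rewrite exprn_ge0.
move=> /allP h; apply/matrixP => i j; rewrite mxE.
have := h i (mem_index_enum _); rewrite psumr_eq0 => [/allP h'|k _]; last first.
  by rewrite exprn_ge0.
by have := h' j (mem_index_enum _); rewrite expf_eq0 /= normr_eq0 => /eqP.
Qed.
End Positivity.

(** * Young symmetrizers: absorption, corners and orthogonality *)

Section YoungSymmetrizer.
Variables (R : realType) (n d : nat).
Local Notation C := R[i].
Local Notation P s := (@perm_op R n d s).
Implicit Types (s t u v : 'S_n) (X Y : 'M[C]_(tdim n d)) (k l : 'S_n -> C).
Implicit Types (sh : seq nat).

Lemma mul_gop k X Y : X *m gop d k *m Y = \sum_s k s *: (X *m P s *m Y).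
Proof.
rewrite /gop mulmx_sumr mulmx_suml; apply: eq_bigr => s _.
by rewrite -scalemxAr -scalemxAl.
Qed.

Definition row_coef sh : 'S_n -> C := fun s => (s \in rowg n sh)%:R.
Definition col_coef sh : 'S_n -> C :=
  fun s => (s \in colg n sh)%:R * (-1) ^+ odd_perm s.

Definition row_sym sh := @gop R n d (row_coef sh).
Definition col_alt sh := @gop R n d (col_coef sh).

Lemma row_symE sh : row_sym sh = \sum_(s in rowg n sh) P s.
Proof.
rewrite /row_sym /gop [RHS]big_mkcond /=; apply: eq_bigr => s _.
by rewrite /row_coef; case: (s \in _); rewrite ?scale1r ?scale0r.
Qed.

Lemma col_altE sh : col_alt sh = \sum_(s in colg n sh) (-1) ^+ odd_perm s *: P s.
Proof.
rewrite /col_alt /gop [RHS]big_mkcond /=; apply: eq_bigr => s _.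
by rewrite /col_coef; case: (s \in _); rewrite ?mul1r // mul0r scale0r.
Qed.

Lemma row_sym_permr sh s : s \in rowg n sh -> row_sym sh *m P s = row_sym sh.
Proof.
move=> hs; rewrite row_symE mulmx_suml.
rewrite [RHS](reindex_inj (mulgI s)) /=; apply: eq_big => t.
  by rewrite -[rowg n sh]/(gval (stab_group _)) groupMl.
by move=> _; rewrite perm_opM.
Qed.

Lemma col_alt_perml sh s : s \in colg n sh ->
  P s *m col_alt sh = (-1) ^+ odd_perm s *: col_alt sh.
Proof.
move=> hs; rewrite col_altE mulmx_sumr scaler_sumr.
rewrite [RHS](reindex_inj (mulIg s)) /=; apply: eq_big => t.
  by rewrite -[colg n sh]/(gval (stab_group _)) groupMr.
move=> _; rewrite -scalemxAr perm_opM scalerA odd_permM signr_addb.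
by rewrite mulrCA -signr_addb addbb mulr1.
Qed.

Lemma row_sym_adj sh : (row_sym sh)^t* = row_sym sh.
Proof.
rewrite row_symE adj_sum [RHS](reindex_inj invg_inj) /=; apply: eq_big => t.
  by rewrite -[rowg n sh]/(gval (stab_group _)) groupV.
by move=> _; rewrite perm_op_adj.
Qed.

Lemma col_alt_adj sh : (col_alt sh)^t* = col_alt sh.
Proof.
rewrite col_altE adj_sum [RHS](reindex_inj invg_inj) /=; apply: eq_big => t.
  by rewrite -[colg n sh]/(gval (stab_group _)) groupV.
by move=> _; rewrite adjZ perm_op_adj odd_permV rmorphXn rmorphN rmorph1.
Qed.

Lemma col_alt_permr sh s : s \in colg n sh ->
  col_alt sh *m P s = (-1) ^+ odd_perm s *: col_alt sh.
Proof.
move=> hs; rewrite -{1}col_alt_adj -[P s]trmxCK -adjM perm_op_adj.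
rewrite col_alt_perml; last by rewrite -[colg n sh]/(gval (stab_group _)) groupV.
by rewrite adjZ col_alt_adj odd_permV rmorphXn rmorphN rmorph1.
Qed.

Lemma row_sym_sqr sh : row_sym sh *m row_sym sh = #|rowg n sh|%:R *: row_sym sh.
Proof.
rewrite {2}row_symE mulmx_sumr (eq_bigr (fun=> row_sym sh)).
  by rewrite sumr_const scaler_nat.
by move=> s hs; rewrite row_sym_permr.
Qed.

Lemma col_alt_sqr sh : col_alt sh *m col_alt sh = #|colg n sh|%:R *: col_alt sh.
Proof.
rewrite {1}col_altE mulmx_suml (eq_bigr (fun=> col_alt sh)).
  by rewrite sumr_const scaler_nat.
by move=> s hs; rewrite -scalemxAl col_alt_perml // scalerA -signr_addb addbb scale1r.
Qed.

Lemma eq_opp_0 X : X = - X -> X = 0.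
Proof.
move=> e; apply/eqP; have /eqP : X + X = 0 by rewrite {2}e subrr.
by rewrite -mulr2n -scaler_nat scaler_eq0 pnatr_eq0.
Qed.

(* A transposition in the row group of [sh] that [s] carries into the column  *)
(* group of [sh'] makes the product equal to its opposite.                    *)
Lemma row_perm_col0 sh sh' s : ~~ row_col_free sh sh' s^-1%g ->
  row_sym sh *m P s *m col_alt sh' = 0.
Proof.
rewrite negb_forall => /existsP[x]; rewrite negb_forall => /existsP[y].
rewrite negb_imply => /andP[/andP[/eqP rxy /eqP cxy] xy].
apply: eq_opp_0.
have ht : tperm x y \in rowg n sh by apply: tperm_stab.
have ht' : tperm (s^-1 x)%g (s^-1 y)%g \in colg n sh' by apply: tperm_stab.
rewrite -{1}(row_sym_permr ht) -[_ *m P s]mulmxA perm_opM.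
have -> : (s * tperm x y = tperm (s^-1 x) (s^-1 y) * s)%g.
  by rewrite -[in RHS]tpermJ conjgE invgK !mulgA mulgKV.
rewrite -perm_opM mulmxA -mulmxA col_alt_perml // odd_tperm.
by rewrite (inj_eq perm_inj) xy expr1 scaleN1r mulmxN.
Qed.

(** If [s^-1] is free, [s] factors into a column part, absorbed by [col_alt] up to sign, and a row
    part, absorbed by [row_sym]; otherwise the product is zero. *)
Lemma row_perm_col sh s : sorted geq sh -> sumn sh = n ->
  exists e : C, row_sym sh *m P s *m col_alt sh = e *: (row_sym sh *m col_alt sh).
Proof.
move=> srt shn; case: (boolP (row_col_free sh sh s^-1%g)) => [hfree|]; last first.
  by move=> /row_perm_col0 ->; exists 0; rewrite scale0r.
have [r hr rc] := row_factor srt shn hfree.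
have hc : (s * r)%g \in colg n sh by apply/stabP => k; rewrite permM rc permK.
exists ((-1) ^+ odd_perm (s * r)%g).
have -> : s = (s * r * r^-1)%g by rewrite mulgK.
rewrite -perm_opM mulmxA row_sym_permr; last first.
  by rewrite -[rowg n sh]/(gval (stab_group _)) groupV.
by rewrite mulgK -mulmxA col_alt_perml // -scalemxAr.
Qed.

Lemma row_gop_col sh k : sorted geq sh -> sumn sh = n ->
  exists e : C, row_sym sh *m gop d k *m col_alt sh = e *: (row_sym sh *m col_alt sh).
Proof.
move=> srt shn; have /fin_all_exists[e he] s := row_perm_col s srt shn.
exists (\sum_s k s * e s); rewrite mul_gop scaler_suml.
by apply: eq_bigr => s _; rewrite he scalerA.
Qed.

Lemma row_gop_col0 sh sh' k : (forall s, ~~ row_col_free sh sh' s) ->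
  row_sym sh *m gop d k *m col_alt sh' = 0.
Proof.
move=> h; rewrite mul_gop big1 // => s _.
by rewrite row_perm_col0 // scaler0.
Qed.

Lemma col_gop_row0 sh sh' k : (forall s, ~~ row_col_free sh sh' s) ->
  col_alt sh' *m gop d k *m row_sym sh = 0.
Proof.
move=> h; rewrite mul_gop big1 // => s _.
rewrite (_ : _ *m _ = 0) ?scaler0 //; apply: adj_inj.
rewrite !adjM row_sym_adj col_alt_adj perm_op_adj mulmxA row_perm_col0 //.
by rewrite !(trmx0, map_mx0).
Qed.

Lemma distinct_shapes sh sh' : sorted geq sh -> sorted geq sh' ->
  size sh = size sh' -> sumn sh = n -> sumn sh' = n -> sh != sh' ->
  (forall k, row_sym sh *m gop d k *m col_alt sh' = 0) \/
  (forall k, col_alt sh *m gop d k *m row_sym sh' = 0).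
Proof.
move=> srt srt' szE shn shn' neq.
case: (shape_dichotomy srt srt' szE shn shn' neq) => h.
  by left=> k; apply: row_gop_col0.
by right=> k; apply: col_gop_row0.
Qed.

Definition young_sym sh := row_sym sh *m col_alt sh.
(** Up to the factor [#|colg n sh|] this is $cc^*$ with $c$ the operator [young_sym sh]: a
    self-adjoint substitute for $c$, to which positivity arguments apply. *)
Definition young_psd sh := young_sym sh *m row_sym sh.

Lemma young_gram sh :
  young_sym sh *m (young_sym sh)^t* = #|colg n sh|%:R *: young_psd sh.
Proof.
rewrite /young_psd /young_sym adjM row_sym_adj col_alt_adj !mulmxA.
by rewrite -[X in X *m _]mulmxA col_alt_sqr -scalemxAr -scalemxAl.
Qed.

Lemma young_psd_adj sh : (young_psd sh)^t* = young_psd sh.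
Proof.
by rewrite /young_psd /young_sym !adjM row_sym_adj col_alt_adj mulmxA.
Qed.

Lemma young_psd_eq0 sh : young_psd sh = 0 -> young_sym sh = 0.
Proof. by move=> h; apply: gram_eq0; rewrite young_gram h scaler0 linear0. Qed.

Lemma herm_sqr_eq0 X : X^t* = X -> X *m X = 0 -> X = 0.
Proof. by move=> h h2; apply: gram_eq0; rewrite h h2 linear0. Qed.

Definition young_psd_coef sh : 'S_n -> C :=
  conv (conv (row_coef sh) (col_coef sh)) (row_coef sh).

Lemma young_psd_gop sh : young_psd sh = gop d (young_psd_coef sh).
Proof. by rewrite /young_psd /young_sym !gopM. Qed.

(** With $a$, $b$ the row and column sums, $aba\,g\,aba=a(baga)b\cdot a$, and [row_gop_col]
    collapses the product before the last factor. This is the primitivity of the Young idempotent in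
    self-adjoint form. *)
Lemma young_psd_corner sh k : sorted geq sh -> sumn sh = n ->
  exists e : C, young_psd sh *m gop d k *m young_psd sh = e *: young_psd sh.
Proof.
move=> srt shn.
have [e he] := row_gop_col
  (conv (conv (col_coef sh) (row_coef sh)) (conv k (row_coef sh))) srt shn.
exists e; rewrite /young_psd -[in RHS]/(young_sym sh) scalemxAl -he.
by rewrite /young_sym -!gopM !mulmxA.
Qed.

Lemma young_sym_sqr sh : sorted geq sh -> sumn sh = n ->
  exists e : C, young_sym sh *m young_sym sh = e *: young_sym sh.
Proof.
move=> srt shn.
have [e he] := row_gop_col (conv (col_coef sh) (row_coef sh)) srt shn.
by exists e; rewrite /young_sym -he -!gopM !mulmxA.
Qed.

(** Write $c=ab$, $f=aba$ and $c^2=ec$. Then $fb=ec$, which gives [Y] when $e\ne0$. If $e=0$, then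
    $f^2$ is a multiple of $fba=0$, so $f$ vanishes and $c$ with it. *)
Lemma young_sym_psd sh : sorted geq sh -> sumn sh = n ->
  exists Y, young_sym sh = young_psd sh *m Y.
Proof.
move=> srt shn; have [e he] := young_sym_sqr srt shn.
have psdE : young_psd sh *m col_alt sh = e *: young_sym sh.
  by rewrite -he /young_psd /young_sym !mulmxA.
have [e0|e0] := eqVneq e 0; last first.
  exists (e^-1 *: col_alt sh); rewrite -scalemxAr psdE scalerA mulVf //.
  by rewrite scale1r.
exists 0; rewrite mulmx0; apply: young_psd_eq0; apply: herm_sqr_eq0.
  exact: young_psd_adj.
rewrite {2}/young_psd /young_sym !mulmxA -[young_psd sh *m row_sym sh]mulmxA.
by rewrite row_sym_sqr -scalemxAr -scalemxAl -/(young_psd sh) psdE e0 scale0r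
  scaler0 mul0mx.
Qed.

(** The product contains a row sum of [sh] before a column sum of [sh'], and also a column sum of
    [sh] before a row sum of [sh']; either alternative of [distinct_shapes] thus provides a zero
    factor. *)
Lemma young_psd_orth sh sh' k : sorted geq sh -> sorted geq sh' ->
  size sh = size sh' -> sumn sh = n -> sumn sh' = n -> sh != sh' ->
  young_psd sh *m gop d k *m young_psd sh' = 0.
Proof.
move=> srt srt' szE shn shn' neq.
have [h|h] := distinct_shapes srt srt' szE shn shn' neq.
  have := h (conv (conv (col_coef sh) (row_coef sh)) (conv k (row_coef sh'))).
  rewrite /young_psd /young_sym -!gopM !mulmxA => ->.
  by rewrite mul0mx.
have h' : col_alt sh *m row_sym sh *m gop d k *m row_sym sh' = 0.
  by have := h (conv (row_coef sh) k); rewrite -gopM !mulmxA.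
have -> : young_psd sh *m gop d k *m young_psd sh' = row_sym sh *m
    (col_alt sh *m row_sym sh *m gop d k *m row_sym sh') *m col_alt sh' *m row_sym sh'.
  by rewrite /young_psd /young_sym !mulmxA.
by rewrite h' mulmx0 !mul0mx.
Qed.

(* By adjunction, either inner product below contains a vanishing factor. *)
Lemma young_sym_orth sh sh' k : sorted geq sh -> sorted geq sh' ->
  size sh = size sh' -> sumn sh = n -> sumn sh' = n -> sh != sh' ->
  (young_sym sh)^t* *m gop d k *m young_sym sh' = 0.
Proof.
move=> srt srt' szE shn shn' neq.
rewrite /young_sym adjM row_sym_adj col_alt_adj.
have [h|h] := distinct_shapes srt srt' szE shn shn' neq.
  rewrite -!mulmxA; have := h (conv k (row_coef sh')).
  by rewrite -gopM -!mulmxA => ->; rewrite mulmx0.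
have h' : col_alt sh *m row_sym sh *m gop d k *m row_sym sh' = 0.
  by have := h (conv (row_coef sh) k); rewrite -gopM !mulmxA.
by rewrite !mulmxA h' mul0mx.
Qed.
End YoungSymmetrizer.

(** * Completeness of the Schur-Weyl blocks *)

Section Completeness.
Variables (R : realType) (n : nat).
Local Notation C := R[i].
Implicit Types (s t u v : 'S_n) (k l : 'S_n -> C) (sh : seq nat).

Lemma young_sorted d (lam : young n d) : sorted geq (parts lam).
Proof. by have /andP[] := valP lam. Qed.

Lemma young_sum d (lam : young n d) : sumn (parts lam) = n.
Proof. by have /andP[_ /eqP] := valP lam. Qed.

Lemma size_parts d (lam : young n d) : size (parts lam) = d.
Proof. by rewrite size_map size_tuple. Qed.

Lemma parts_inj d : injective (@parts n d).
Proof.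
move=> [p hp] [q hq] e; apply/val_inj/val_inj => /=.
exact: (inj_map val_inj) e.
Qed.

(* For [d = n] the vector [e_0 (x) ... (x) e_(n-1)] has trivial stabilizer. *)
Lemma gop_inj k : gop n k = 0 -> forall s, k s = 0.
Proof.
move=> k0 s.
pose g0 : {ffun 'I_n -> 'I_n} := [ffun i => i].
have := congr1 (fun X : 'M[C]_(tdim n n) =>
  X (enum_rank (precomp g0 s^-1)) (enum_rank g0)) k0.
rewrite /gop /= summxE (bigD1 s) //= big1 ?addr0 ?mxE => [|t ts].
  rewrite (_ : [forall x, _]) ?mulr1 //.
  by apply/forallP => x; rewrite /basis_map !enum_rankK !ffunE permK.
rewrite !mxE (_ : [forall x, _] = false) ?mulr0 //.
apply/negbTE; apply: contra ts => /forallP h; apply/eqP/permP => x.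
have := h x; rewrite /basis_map !enum_rankK !ffunE => /eqP.
by move=> /(congr1 s); rewrite permKV.
Qed.

(** The coefficient of the identity is 1, since only the identity lies in both the row and the
    column group. *)
Lemma young_sym_neq0 sh : @young_sym R n n sh != 0.
Proof.
apply/eqP; rewrite /young_sym gopM => sym0; have := gop_inj sym0 1%g.
rewrite /conv (bigD1 1%g) //= big1 ?addr0.
  rewrite /row_coef /col_coef mul1g invg1 odd_perm1 expr0 mulr1.
  rewrite -[rowg n sh]/(gval (stab_group _)) -[colg n sh]/(gval (stab_group _)).
  by rewrite !group1 mulr1 => /eqP; rewrite oner_eq0.
move=> s s1; rewrite /row_coef /col_coef mul1g.
case: (boolP (s \in rowg n sh)) => [hr|_]; last by rewrite mul0r.
case: (boolP (s^-1%g \in colg n sh)) => [hc|_]; last by rewrite mul0r mulr0.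
case/eqP: s1; apply: rowg_colg hr _; move: hc.
by rewrite -[colg n sh]/(gval (stab_group _)) groupV.
Qed.

(** The coefficients of $\sum_s sfs^{-1}$ with $f$ the element behind [young_psd], a central element
    of the group algebra; see [class_opE]. *)
Definition class_coef sh : 'S_n -> C := fun u => \sum_s young_psd_coef R sh (u ^ s)%g.

Lemma class_coefJ sh u v : class_coef sh (u ^ v)%g = class_coef sh u.
Proof.
rewrite /class_coef [RHS](reindex_inj (mulgI v)) /=.
by apply: eq_bigr => s _; rewrite conjgM.
Qed.

Lemma class_opE d sh : gop d (class_coef sh) =
  \sum_s perm_op R d s *m young_psd R n d sh *m perm_op R d s^-1%g.
Proof. by rewrite young_psd_gop gop_conj. Qed.

Lemma class_op_adj d sh : (gop d (class_coef sh))^t* = gop d (class_coef sh).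
Proof.
rewrite class_opE adj_sum; apply: eq_bigr => s _.
by rewrite adjM adjM young_psd_adj !perm_op_adj invgK mulmxA.
Qed.

(** Its trace is $n!$ times that of [young_psd], which is a positive multiple of the squared
    Hilbert-Schmidt norm of [young_sym]. *)
Lemma class_op_neq0 sh : gop n (class_coef sh) != 0.
Proof.
apply/eqP => /(congr1 mxtrace); rewrite class_opE linear_sum linear0 /=.
rewrite (eq_bigr (fun=> \tr (young_psd R n n sh))); last first.
  move=> s _; rewrite mxtrace_mulC mulmxA perm_opM mulgV.
  by rewrite perm_op1 mul1mx.
rewrite sumr_const => /eqP; rewrite -mulr_natl mulf_eq0 pnatr_eq0.
case/orP => [|/eqP tr0].
  by rewrite -leqn0 leqNgt; case/negP; apply/card_gt0P; exists 1%g.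
move/eqP: (young_sym_neq0 sh); apply; apply: gram_eq0.
by rewrite young_gram linearZ /= tr0 mulr0.
Qed.

Lemma class_op_orth d (lam mu : young n d) m : lam != mu ->
  gop m (class_coef (parts lam)) *m gop m (class_coef (parts mu)) = 0.
Proof.
move=> neq; rewrite !class_opE mulmx_suml big1 // => s _.
rewrite mulmx_sumr big1 // => t _.
have h := young_psd_orth m (fun u => (u == t * s^-1)%g%:R)
  (young_sorted lam) (young_sorted mu).
have regroup (X A Y Z B W : 'M[C]_(tdim n m)) :
    X *m A *m Y *m (Z *m B *m W) = X *m (A *m (Y *m Z) *m B) *m W.
  by rewrite !mulmxA.
rewrite regroup perm_opM (gop_perm _ _ (t * s^-1)%g) h ?size_parts ?young_sum //.
  by rewrite mulmx0 mul0mx.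
by rewrite (inj_eq (@parts_inj d)).
Qed.

Lemma class_fun_ext (k l : 'S_n -> C) (rep : young n n -> 'S_n) :
  (forall u v, k (u ^ v)%g = k u) -> (forall u v, l (u ^ v)%g = l u) ->
  (forall s, exists v, (s ^ v)%g = rep (cycle_type s)) ->
  (forall lam, k (rep lam) = l (rep lam)) -> k =1 l.
Proof.
move=> kJ lJ hrep kl s; have [v hv] := hrep s.
by rewrite -(kJ s v) -(lJ s v) hv kl.
Qed.

Lemma cycle_type_reps : exists rep : young n n -> 'S_n,
  forall s, exists v, (s ^ v)%g = rep (cycle_type s).
Proof.
(* The default is never reached at a value [cycle_type s]. *)
pose rep lam := odflt 1%g [pick s : 'S_n | cycle_type s == lam].
exists rep => s; rewrite /rep; case: pickP => [t /eqP e|/(_ s)]; last by rewrite eqxx.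
have [u hu] := cycle_type_conj (esym e).
exists u; apply: (mulgI u); rewrite conjgE !mulgA mulgV mul1g.
by apply/permP => x; rewrite !permM hu.
Qed.

(* The class sums attached to distinct partitions are nonzero and orthogonal, *)
(* hence independent, and there are at least as many partitions of [n] as     *)
(* conjugacy classes in [S_n]: so they span all class functions.              *)
Lemma class_coef_complete : exists x : young n n -> C,
  forall t, \sum_lam x lam * class_coef (parts lam) t = (t == 1%g)%:R.
Proof.
have [rep hrep] := cycle_type_reps.
pose m := #|{: young n n}|.
pose K : 'M[C]_m := \matrix_(p, q)
  class_coef (parts (enum_val p : young n n)) (rep (enum_val q)).
have sum_enum (V : nmodType) (F : young n n -> V) :
    \sum_(p < m) F (enum_val p) = \sum_lam F lam.
  rewrite [RHS](reindex_onto enum_val (@enum_rank _)) /=; last first.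
    by move=> g _; rewrite enum_rankK.
  by apply: eq_bigl => a; rewrite enum_valK eqxx.
(* A vector in the left kernel is a linear relation between the class functions on representatives,
   hence everywhere, hence between the class operators. *)
have Kfree : row_free K.
  apply/row_freeP; exists (invmx K); apply: mulmxV.
  rewrite -row_free_unit -kermx_eq0; apply/eqP/row_matrixP => i0.
  rewrite row0; set v := row i0 _; have vK : v *m K = 0.
    by apply/sub_kermxP; exact: row_sub.
  have vcl t : \sum_p v 0 p * class_coef (parts (enum_val p : young n n)) t = 0.
    pose k t := \sum_p v 0 p * class_coef (parts (enum_val p : young n n)) t.
    apply: (@class_fun_ext k (fun=> 0) rep) => //.
      by move=> u w; apply: eq_bigr => p _; rewrite class_coefJ.
    move=> lam; have := congr1 (fun X : 'rV_m => X 0 (enum_rank lam)) vK.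
    rewrite !mxE => <-; apply: eq_bigr => p _.
    by rewrite !mxE enum_rankK.
  apply/rowP => q; rewrite [RHS]mxE.
  pose E (p : 'I_m) := gop n (class_coef (parts (enum_val p : young n n))).
  have vE : \sum_p v 0 p *: E p = 0.
    by rewrite gop_sum (eq_gop _ vcl) /gop big1 // => t _; rewrite scale0r.
  (* By orthogonality, multiplication by [E q] leaves only the [q]-th term, and the nonzero
     self-adjoint [E q] has a nonzero square. *)
  have := congr1 (fun X => X *m E q) vE; rewrite /= mul0mx mulmx_suml.
  rewrite (bigD1 q) //= big1 ?addr0 => [|p pq]; last first.
    rewrite -scalemxAl class_op_orth ?scaler0 //.
    by rewrite (inj_eq enum_val_inj).
  rewrite -scalemxAl => /eqP; rewrite scaler_eq0; case/orP => [/eqP //|/eqP EE].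
  have := class_op_neq0 (parts (enum_val q : young n n)).
  rewrite (_ : gop _ _ = 0) ?eqxx //.
    by apply: (herm_sqr_eq0 _ EE); exact: class_op_adj.
pose w : 'rV[C]_m := \row_q (rep (enum_val q) == 1%g)%:R.
pose x := w *m invmx K.
have xK : x *m K = w by rewrite /x mulmxKV // -row_free_unit.
exists (fun lam => x 0 (enum_rank lam)).
apply: (@class_fun_ext _ _ rep) => //.
- by move=> u v; apply: eq_bigr => p _; rewrite class_coefJ.
- by move=> u v; rewrite conjg_eq1.
move=> lam; have := congr1 (fun X : 'rV_m => X 0 (enum_rank lam)) xK.
rewrite !mxE enum_rankK => <-; rewrite -sum_enum; apply: eq_bigr => p _.
by rewrite !mxE enum_valK enum_rankK.
Qed.

(** * From dimension [n] to arbitrary dimension [d] *)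

Section Transfer.
Variable d : nat.

Lemma strip_parts N (lam : young n N) : exists2 sh,
  parts lam = sh ++ nseq (N - size sh) 0%N & all (ltn 0) sh.
Proof.
have := young_sorted lam; have := size_parts lam; move: (parts lam) => p {lam}.
elim: p N => [|a p IH] N /=; first by move=> <- _; exists [::].
case: N => // N [szp] hp; have srt : sorted geq p by exact: path_sorted hp.
case: a hp => [|a] hp; last first.
  have [sh pE hsh] := IH N szp srt.
  by exists (a.+1 :: sh) => //=; rewrite pE subSS.
exists [::] => //=; rewrite -szp; congr (_ :: _).
move: hp; rewrite /= (path_sortedE (leT := geq)); last first.
  by move=> x y z yx zy; apply: leq_trans zy yx.
move=> /andP[h _]; elim: p h {IH srt szp} => //= b p IH /andP[b0 hp].
by rewrite -IH //; move: b0; rewrite leqn0 => /eqP ->.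
Qed.

Lemma reshape_index_pad sh m (i : nat) : (i < sumn sh)%N ->
  reshape_index (sh ++ nseq m 0%N) i = reshape_index sh i.
Proof.
move=> hi; have r_lt := reshape_indexP hi; have c_lt := reshape_offsetP hi.
rewrite -{1}(reshape_indexK sh i).
rewrite -[RHS](@flatten_indexKl (sh ++ nseq m 0%N) _ (reshape_offset sh i)).
  by rewrite /flatten_index take_cat r_lt.
by rewrite nth_cat r_lt.
Qed.

Lemma reshape_offset_pad sh m (i : nat) : (i < sumn sh)%N ->
  reshape_offset (sh ++ nseq m 0%N) i = reshape_offset sh i.
Proof.
move=> hi; have r_lt := reshape_indexP hi.
by rewrite /reshape_offset reshape_index_pad // take_cat r_lt.
Qed.

Lemma young_sym_pad sh m : sumn sh = n ->
  young_sym R n d (sh ++ nseq m 0%N) = young_sym R n d sh /\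
  class_coef (sh ++ nseq m 0%N) = class_coef sh.
Proof.
move=> shn.
have rE : rowg n (sh ++ nseq m 0%N) = rowg n sh.
  by apply/setP => s; apply/stabP/stabP => h i; have := h i;
    rewrite !reshape_index_pad ?shn.
have cE : colg n (sh ++ nseq m 0%N) = colg n sh.
  by apply/setP => s; apply/stabP/stabP => h i; have := h i;
    rewrite !reshape_offset_pad ?shn.
by rewrite /young_sym /row_sym /col_alt /class_coef /young_psd_coef
  /row_coef /col_coef rE cE.
Qed.

(* Pigeonhole: two boxes of the first column carry the same basis vector. *)
Lemma col_alt_long sh : sumn sh = n -> all (ltn 0) sh -> (d < size sh)%N ->
  col_alt R n d sh = 0.
Proof.
move=> shn pos long.
have box (r : 'I_d.+1) : exists2 k : 'I_n, reshape_index sh k = r &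
    reshape_offset sh k = 0%N.
  apply: exists_box => //; apply: (all_nthP 0%N pos).
  exact: leq_trans (ltn_ord r) long.
have [b bR bC] := fin_all_exists2 box.
apply/matrix_basisP => g h; rewrite [RHS]mxE.
have /injectivePn[r1 [r2 r12 hr]] : ~~ injectiveb (fun r => h (b r)).
  apply/negP => /injectiveP /leq_card; rewrite !card_ord ltnn //.
have b12 : b r1 != b r2.
  by apply: contra r12 => /eqP e; apply/eqP/val_inj; rewrite /= -!bR e.
have ht : tperm (b r1) (b r2) \in colg n sh by apply: tperm_stab; rewrite !bC.
have := congr1 (fun X : 'M[C]_(tdim n d) => X (enum_rank g) (enum_rank h))
  (col_alt_permr R d ht).
rewrite /= mul_perm_opr odd_tperm b12 expr1 scaleN1r [RHS]mxE.
rewrite (_ : precomp _ _ = h); last first.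
  apply/ffunP => k; rewrite ffunE /basis_map enum_rankK tpermV.
  by case: tpermP => [->|->|].
move=> e; apply/eqP; have /eqP : col_alt R n d sh (enum_rank g) (enum_rank h) +
  col_alt R n d sh (enum_rank g) (enum_rank h) = 0 by rewrite {2}e subrr.
by rewrite -mulr2n -mulr_natl mulf_eq0 pnatr_eq0.
Qed.

Lemma young_symmetrizerE (lam : young n d) :
  young_symmetrizer R lam = young_sym R n d (parts lam).
Proof. by rewrite /young_sym row_symE col_altE. Qed.

Lemma block_gen (lam : young n d) s (Y : 'M[C]_(tdim n d)) :
  ((perm_op R d s *m young_sym R n d (parts lam) *m Y)^T <=
   schur_weyl_block R lam)%MS.
Proof.
rewrite trmx_mul; apply: (submx_trans (submxMl _ _)).
rewrite -young_symmetrizerE.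
by apply: (sumsmx_sup s) => //; rewrite genmxE.
Qed.

(** The identity of [class_coef_complete] relates coefficients, so it holds on every tensor space.
    Diagrams with more than [d] rows contribute zero by [col_alt_long]; any other class sum maps
    into the block of the diagram with the same positive parts. *)
Lemma blocks_full : (1%:M <= \sum_(lam : young n d) schur_weyl_block R lam)%MS.
Proof.
have [x hx] := class_coef_complete.
have one : \sum_lam x lam *: gop d (class_coef (parts lam)) = 1%:M.
  by rewrite gop_sum (eq_gop _ hx) gop_delta.
rewrite -[1%:M]trmx1 -one linear_sum /=; apply: summx_sub => lam _.
rewrite linearZ /= scalemx_sub //.
have [sh lamE pos] := strip_parts lam.
have shn : sumn sh = n.
  by have := young_sum lam; rewrite lamE sumn_cat sumn_nseq mul0n addn0.
have srt : sorted geq sh.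
  by have := young_sorted lam; rewrite lamE; apply: (subseq_sorted) => //;
   [move=> a b c ba cb; apply: leq_trans cb ba | exact: prefix_subseq].
have [_ padE] := young_sym_pad (n - size sh) shn; rewrite lamE padE.
rewrite class_opE linear_sum /=; apply: summx_sub => s _.
have [hd|hd] := leqP (size sh) d; last first.
  by rewrite /young_psd /young_sym col_alt_long // !(mulmx0, mul0mx) trmx0 sub0mx.
have [mu muE] := young_of_seq srt shn hd.
apply: (sumsmx_sup mu) => //.
have [symE _] := young_sym_pad (d - size sh) shn.
rewrite /young_psd -symE -muE mulmxA -mulmxA; exact: block_gen.
Qed.

End Transfer.
End Completeness.

(** * The projections of weak Schur sampling *)

Section WeakSchurSampling.
Variables (R : realType) (n d : nat).
Local Notation C := R[i].
Implicit Types (lam mu : young n d) (X Y : 'M[C]_(tdim n d)).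
Local Notation Pi lam := (@wss_proj R n d lam).

Lemma trmxT_C m p (A : 'M[C]_(m, p)) : A^T^t* = A^t*^T.
Proof. by apply/matrixP => x y; rewrite !mxE. Qed.

(** With $Q$ the projection, the rows of $1-Q$ are orthogonal to [U] and those of $Q$ lie in [U].
    Hence $(1-Q)Q^*=0$, and $Q^*=QQ^*$ is self-adjoint. *)
Lemma proj_ortho_herm m (U : 'M[C]_(m, tdim n d)) : (proj_ortho U)^t* = proj_ortho U.
Proof.
set Q := proj_ortho U.
have h : Q^t* = Q *m Q^t*.
  have := proj_ortho_compl_sub U 1%:M; rewrite mul1mx => /orthomx1P h.
  have [D QD] : exists D, Q = D *m U.
    by apply/submxP; rewrite /Q proj_orthoE.
  apply/eqP; rewrite -subr_eq0 -{1}[Q^t*]mul1mx -mulmxBl.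
  by rewrite [X in _ *m X^t*]QD adjM mulmxA h mul0mx.
have h2 : Q = Q *m Q^t* by rewrite -[LHS]trmxCK {1}h adjM trmxCK.
by rewrite [RHS]h2.
Qed.

Lemma wss_projT lam : (Pi lam)^T = proj_ortho (schur_weyl_block R lam).
Proof. exact: trmxK. Qed.

Lemma wss_proj_herm lam : (Pi lam)^t* = Pi lam.
Proof. by rewrite /wss_proj trmxT_C proj_ortho_herm. Qed.

(* Keeps unification from comparing distinct blocks entry by entry. *)
Opaque wss_proj schur_weyl_block.

Lemma wss_proj_id lam m (X : 'M[C]_(tdim n d, m)) :
  (X^T <= schur_weyl_block R lam)%MS -> Pi lam *m X = X.
Proof. by move=> h; apply: trmx_inj; rewrite trmx_mul wss_projT proj_ortho_id. Qed.

Lemma wss_proj_sub lam : ((Pi lam)^T <= schur_weyl_block R lam)%MS.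
Proof. by rewrite wss_projT proj_orthoE. Qed.

Lemma wss_proj_idem lam : Pi lam *m Pi lam = Pi lam.
Proof. by apply: wss_proj_id; exact: wss_proj_sub. Qed.

Lemma block_orth lam mu : lam != mu ->
  schur_weyl_block R lam *m (schur_weyl_block R mu)^t* = 0.
Proof.
move=> neq; apply/orthomx1P; apply/sumsmx_subP => s _; rewrite genmxE.
rewrite orthomx_sym; apply/sumsmx_subP => t _; rewrite genmxE orthomx_sym.
apply/orthomx1P; rewrite trmxT_C -trmx_mul -[RHS]trmx0; congr (_^T).
rewrite adjM !young_symmetrizerE perm_op_adj mulmxA -[X in X *m _]mulmxA perm_opM.
rewrite gop_perm young_sym_orth ?size_parts ?young_sum ?young_sorted //.
by rewrite (inj_eq (@parts_inj n d)) eq_sym.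
Qed.

Lemma wss_proj_orth lam mu : lam != mu -> Pi lam *m Pi mu = 0.
Proof.
move=> neq; apply: trmx_inj; rewrite trmx_mul trmx0.
rewrite [X in _ *m X = _]wss_projT proj_ortho_0 //.
apply: submx_trans (wss_proj_sub mu) _; apply/orthomx1P.
by apply: block_orth; rewrite eq_sym.
Qed.

(** The difference of the two sides annihilates every block, and the blocks fill the space by
    [blocks_full]. *)
Lemma wss_proj_sum : \sum_lam Pi lam = 1%:M.
Proof.
apply: trmx_inj; rewrite trmx1; apply/eqP; rewrite -subr_eq0.
set S := (\sum_lam Pi lam)^T; rewrite -[_ - _]mul1mx; apply/eqP/sub_kermxP.
apply: submx_trans (blocks_full R n d) _; apply/sumsmx_subP => lam _.
apply/sub_kermxP; rewrite mulmxBr mulmx1; apply/eqP; rewrite subr_eq0; apply/eqP.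
apply: trmx_inj; rewrite trmx_mul trmxK -{1}[(schur_weyl_block _ _)^T](@wss_proj_id lam);
  last by rewrite trmxK.
rewrite mulmxA mulmx_suml (bigD1 lam) //= big1 ?addr0 => [|mu neq].
  by rewrite wss_proj_idem wss_proj_id // trmxK.
by rewrite wss_proj_orth.
Qed.

Lemma wss_proj_psd lam : psdmx (Pi lam).
Proof.
split.
  by apply/is_hermitianmxP; rewrite expr0 scale1r wss_proj_herm.
move=> v; rewrite -wss_proj_idem -{1}wss_proj_herm.
rewrite !mulmxA -adjM -mulmxA mxE sumr_ge0 // => k _.
by rewrite !mxE mulrC mul_conjC_ge0.
Qed.

Lemma wss_proj_scalar lam X (c : C) :
  (forall s, X *m (perm_op R d s *m young_sym R n d (parts lam)) =
     c *: (perm_op R d s *m young_sym R n d (parts lam))) ->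
  X *m Pi lam = c *: Pi lam.
Proof.
move=> h; apply: trmx_inj; rewrite trmx_mul linearZ /=; apply/eqP.
rewrite -subr_eq0 -mul_mx_scalar -mulmxBr; apply/eqP/sub_kermxP.
apply: submx_trans (wss_proj_sub lam) _; apply/sumsmx_subP => s _.
rewrite genmxE; apply/sub_kermxP; rewrite mulmxBr mul_mx_scalar -trmx_mul.
by rewrite young_symmetrizerE h linearZ /= subrr.
Qed.

(** Commuting with the permutations keeps the block stable, and stability under both [X] and its
    adjoint gives commutation with the orthogonal projection. *)
Lemma wss_proj_comm lam X :
  (forall s, X *m perm_op R d s = perm_op R d s *m X) ->
  (forall s, X^t* *m perm_op R d s = perm_op R d s *m X^t*) ->
  X *m Pi lam = Pi lam *m X.
Proof.
have stable Y : (forall s, Y *m perm_op R d s = perm_op R d s *m Y) ->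
    Pi lam *m (Y *m Pi lam) = Y *m Pi lam.
  move=> hY; apply: wss_proj_id; rewrite trmx_mul.
  apply: submx_trans (submxMr _ (wss_proj_sub lam)) _.
  rewrite sumsmxMr; apply/sumsmx_subP => s _.
  rewrite (eqmxMr _ (genmxE _)) -trmx_mul young_symmetrizerE mulmxA.
  have hg k : Y *m gop d k = gop d k *m Y.
    rewrite /gop mulmx_sumr mulmx_suml; apply: eq_bigr => t _.
    by rewrite -scalemxAl -scalemxAr hY.
  rewrite hY /young_sym gopM -mulmxA hg -gopM mulmxA.
  exact: block_gen.
move=> hX hX'; rewrite -(stable X hX); apply: adj_inj.
by rewrite !adjM !wss_proj_herm -mulmxA stable.
Qed.
End WeakSchurSampling.

(** * Operators commuting with unitaries and permutations *)

Section DoubleCommutant.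
Variables (R : realType) (n d : nat).
Local Notation C := R[i].
Implicit Types (s t : 'S_n) (M H : 'M[C]_d).
Local Notation P s := (@perm_op R n d s).

(** Take $z^{n!}=-1$: as $m$ divides $n!$, $z^m=1$ would give $1=-1$. The powers of such a $z$ tell
    apart all multiplicities from $0$ to $n$. *)
Lemma unimodular_free : exists z : C, `|z| = 1 /\
  forall m, (0 < m <= n)%N -> z ^+ m != 1.
Proof.
pose z : C := (n`!).-root (-1); have zN : z ^+ n`! = -1 by rewrite rootCK ?fact_gt0.
exists z; split.
  apply/eqP; rewrite -(@pexpr_eq1 _ _ n`!) ?fact_gt0 //.
  by rewrite -normrX zN normrN1.
move=> m hm; apply/eqP => zm; have /dvdnP[q qE] := dvdn_fact hm.
have : (1 : C) == -1 by rewrite -zN qE mulnC exprM zm expr1n.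
by rewrite -subr_eq0 opprK -(natrD _ 1 1) pnatr_eq0.
Qed.

Definition content (g : {ffun 'I_n -> 'I_d}) (c : 'I_d) := #|[set k | g k == c]%SET|.

Lemma prod_content (D : 'I_d -> C) (g : {ffun 'I_n -> 'I_d}) :
  \prod_k D (g k) = \prod_c D c ^+ content g c.
Proof.
rewrite (partition_big g xpredT) //=; apply: eq_bigr => c _.
rewrite (eq_bigr (fun=> D c)); last by move=> k /eqP ->.
by rewrite prodr_const; congr (_ ^+ _); apply: eq_card => k; rewrite inE.
Qed.

Lemma power_diag (D : 'rV[C]_d) : tensor_power n (diag_mx D) =
  diag_mx (\row_a \prod_k D 0 (basis_map a k)).
Proof.
apply/matrixP => a b; rewrite !mxE.
have [<-|neq] := eqVneq a b.
  by rewrite mulr1n; apply: eq_bigr => k _; rewrite !mxE eqxx mulr1n.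
rewrite mulr0n.
case: (boolP [forall k, basis_map a k == basis_map b k]) => [/forallP h|].
  by case/eqP: neq; apply: basis_map_inj; apply/ffunP => k; exact/eqP.
rewrite negb_forall => /existsP[k hk]; rewrite (bigD1 k) //= mxE.
by rewrite (negbTE hk) mulr0n mul0r.
Qed.

Lemma tensor_powerM M M' : tensor_power n (M *m M') = tensor_power n M *m tensor_power n M'.
Proof. by rewrite !tens_power tensM. Qed.

Lemma tensor_power_adj M : (tensor_power n M)^t* = tensor_power n (M^t*).
Proof. by rewrite !tens_power tens_adj. Qed.

Lemma tensor_power_unitary M : M \is unitarymx -> tensor_power n M \is unitarymx.
Proof.
move=> /unitarymxP h; apply/unitarymxP.
by rewrite tensor_power_adj -tensor_powerM h tens_power tens1.
Qed.

Variable T : 'M[C]_(tdim n d).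
Hypothesis T_unitary : forall V : 'M[C]_d, V \is unitarymx ->
  T *m tensor_power n V = tensor_power n V *m T.
Hypothesis T_perm : forall s, T *m P s = P s *m T.

(** Testing on the diagonal unitary with [z] in place [c] and 1 elsewhere shows that a nonzero entry
    [T a b] forces equal contents of [a] and [b], hence equal diagonal entries there of every
    diagonal tensor power. *)
Lemma commute_diag (D : 'rV[C]_d) :
  T *m tensor_power n (diag_mx D) = tensor_power n (diag_mx D) *m T.
Proof.
rewrite power_diag; apply/matrixP => a b; rewrite mul_mx_diag mul_diag_mx !mxE.
have [->|Tab] := eqVneq (T a b) 0; first by rewrite mul0r mulr0.
rewrite mulrC; congr (_ * _); rewrite !prod_content.
apply: eq_bigr => c _; congr (_ ^+ _).
have [z [z1 zfree]] := unimodular_free.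
pose Z : 'rV[C]_d := \row_e (if e == c then z else 1).
have ZU : diag_mx Z \is unitarymx.
  apply/unitarymxP; apply/matrixP => x y.
  rewrite mul_diag_mx !mxE; have [<-|] := eqVneq x y; last first.
    by move=> _; rewrite mulr0n conjC0 mulr0.
  rewrite ?eqxx mulr1n -normCK; case: ifP => _; last by rewrite normr1 expr1n.
  by rewrite z1 expr1n.
have := T_unitary ZU; rewrite power_diag => /matrixP/(_ a b).
rewrite mul_mx_diag mul_diag_mx !mxE [RHS]mulrC => /(mulfI Tab).
rewrite !prod_content.
have ZE g : \prod_e Z 0 e ^+ content g e = z ^+ content g c.
  rewrite (bigD1 c) //= big1 ?mulr1 ?mxE ?eqxx // => e ec.
  by rewrite mxE (negbTE ec) expr1n.
rewrite !ZE => zE.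
have content_le g : (content g c <= n)%N.
  by rewrite -[leqRHS](card_ord n) max_card.
have z0 : z != 0 by rewrite -normr_eq0 z1 oner_eq0.
have aux p q : (p <= n)%N -> (q < p)%N -> z ^+ p <> z ^+ q.
  move=> pn qp e; have hpq : (0 < p - q <= n)%N.
    by rewrite subn_gt0 qp (leq_trans (leq_subr _ _)).
  have /negP := zfree _ hpq; apply; apply/eqP.
  apply: (mulIf (expf_neq0 q z0)).
  by rewrite -exprD subnK ?(ltnW qp) // mul1r.
by case: (ltngtP (content (basis_map b) c) (content (basis_map a) c)) => // lt;
  [case: (aux _ _ (content_le _) lt) | case: (aux _ _ (content_le _) lt)].
Qed.

Lemma commute_herm H : H^t* = H -> T *m tensor_power n H = tensor_power n H *m T.
Proof.
move=> hH; have /orthomx_spectralP {1 2}-> : H \is normalmx.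
  by apply/normalmxP; rewrite hH.
have U := spectral_unitarymx H.
rewrite invmx_unitary // !tensor_powerM.
by rewrite !mulmxA T_unitary ?trmxC_unitary // -[_ *m T *m _]mulmxA commute_diag
  !mulmxA -[_ *m T *m _]mulmxA T_unitary // !mulmxA.
Qed.

(* Along a complex line through two Hermitian matrices the commutator is      *)
(* polynomial, so vanishing at integer points it vanishes identically.        *)
Lemma commute_power M : T *m tensor_power n M = tensor_power n M *m T.
Proof.
pose H1 := 2^-1 *: (M + M^t*); pose H2 := (- 'i * 2^-1) *: (M - M^t*).
have adjD (A B : 'M[C]_d) : (A + B)^t* = A^t* + B^t*.
  by apply/matrixP => x y; rewrite !mxE rmorphD.
have adjN (A : 'M[C]_d) : (- A)^t* = - A^t*.
  by apply/matrixP => x y; rewrite !mxE rmorphN.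
have two : (2^-1 : C)^* = 2^-1 by rewrite fmorphV rmorph_nat.
have hH1 : H1^t* = H1 by rewrite adjZ adjD trmxCK two addrC.
have hH2 : H2^t* = H2.
  have -> : H2^t* = ('i * 2^-1) *: (M^t* - M).
    rewrite adjZ adjD adjN trmxCK; congr (_ *: _).
    by rewrite rmorphM /= two rmorphN /= conjCi opprK.
  by rewrite /H2 -[M^t* - M]opprB scalerN -scaleNr mulNr.
have ME : M = H1 + 'i *: H2.
  rewrite /H1 /H2 scalerA mulrA mulrN -expr2 sqrCi opprK mul1r -scalerDr.
  rewrite addrACA subrr addr0 -mulr2n -(scaler_nat 2 M) scalerA mulVf ?scale1r //.
apply/eqP; rewrite -subr_eq0; apply/eqP/matrixP => a b; rewrite [RHS]mxE.
clearbody H1 H2; pose q (a' b' : 'I_(tdim n d)) : {poly C} :=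
  \prod_(k < n) ((H1 (basis_map a' k) (basis_map b' k))%:P +
  H2 (basis_map a' k) (basis_map b' k) *: 'X).
have qE a' b' x : (q a' b').[x] = tensor_power n (H1 + x *: H2) a' b'.
  rewrite horner_prod mxE; apply: eq_bigr => k _.
  by rewrite !hornerE !mxE mulrC.
pose p := \sum_c T a c *: q c b - \sum_c T c b *: q a c.
have pE x : p.[x] = (T *m tensor_power n (H1 + x *: H2) -
    tensor_power n (H1 + x *: H2) *m T) a b.
  rewrite hornerD hornerN !horner_sum !mxE; congr (_ - _); apply: eq_bigr => c _.
    by rewrite hornerZ qE.
  by rewrite hornerZ qE mulrC.
rewrite ME -pE; suff -> : p = 0 by rewrite horner0.
apply/eqP; apply: contraT => p0.
(* A nonzero [p] would have [size p] distinct roots, one more than its degree. *)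
have rs_uniq : uniq [seq (m%:R : C) | m <- iota 0 (size p)].
  by rewrite map_inj_uniq ?iota_uniq //; apply: mulrIn; rewrite oner_eq0.
have := max_poly_roots p0 _ rs_uniq.
rewrite size_map size_iota ltnn; apply.
apply/allP => _ /mapP[m _ ->]; rewrite rootE pE commute_herm ?subrr ?mxE //.
by rewrite adjD adjZ hH1 hH2 rmorph_nat.
Qed.

Definition indic_sum (M : 'I_n -> 'M[C]_d) (e : {ffun 'I_n -> bool}) : 'M[C]_d :=
  \sum_j (e j)%:R *: M j.

(** Expand the left side over the maps [f] that choose a matrix for each factor. The signed sum over
    [e] is inclusion-exclusion and keeps exactly the surjective [f], that is, the permutations. *)
Lemma polarization (M : 'I_n -> 'M[C]_d) :
  \sum_(e : {ffun 'I_n -> bool})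
     (\prod_j (-1) ^+ (~~ e j)) *: tensor_power n (indic_sum M e) =
  \sum_(s : 'S_n) tens (fun k => M (s k)).
Proof.
apply/matrixP => a b; rewrite !summxE.
pose x j k := M j (basis_map a k) (basis_map b k).
transitivity (\sum_(f : {ffun 'I_n -> 'I_n}) (\prod_k x (f k) k) *
   \prod_(j < n) (j \in [set f k | k in 'I_n]%SET)%:R).
  under eq_bigr => e _.
    rewrite mxE [X in _ * X]mxE.
    under [X in _ * X]eq_bigr => k _.
      rewrite summxE.
      under eq_bigr do rewrite mxE.
      over.
    rewrite (bigA_distr_bigA (fun k j => (e j)%:R * x j k)) mulr_sumr.
    over.
  rewrite exchange_big /=; apply: eq_bigr => f _.
  have fiber (e : {ffun 'I_n -> bool}) : \prod_k (e (f k))%:R =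
      \prod_j (e j)%:R ^+ #|[pred k | f k == j]| :> C.
    rewrite (partition_big f xpredT) //=; apply: eq_bigr => j _.
    rewrite (eq_bigr (fun=> (e j)%:R)); last by move=> k /eqP ->.
    by rewrite prodr_const.
  under eq_bigr => e _.
    rewrite big_split /= mulrA mulrC.
    rewrite fiber -big_split /=.
    over.
  rewrite -mulr_sumr; congr (_ * _).
  rewrite -(bigA_distr_bigA (fun j (ej : bool) =>
    (-1) ^+ (~~ ej) * ej%:R ^+ #|[pred k | f k == j]|)) /=.
  (* The two values of [e j] contribute $1-0^m$ with $m=|f^{-1}(j)|$: this is 1 if [j] is hit by [f]
     and 0 otherwise. *)
  apply: eq_bigr => j _; rewrite big_bool /= mul1r expr1n expr0n expr1 mulN1r.
  have -> : (#|[pred k | f k == j]| == 0)%N = (j \notin [set f k | k in 'I_n]%SET).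
    apply/eqP/idP => [/eqP|/negP h].
      rewrite -leqn0 leqNgt; apply: contra => /imsetP[k _ ->].
      by apply/card_gt0P; exists k; rewrite inE.
    apply/eqP; rewrite -leqn0 leqNgt; apply/negP => /card_gt0P[k].
    by rewrite inE => /eqP fk; apply: h; apply/imsetP; exists k.
  by case: (j \in _); rewrite ?subr0 ?subrr.
rewrite (bigID (fun f : {ffun 'I_n -> 'I_n} => injectiveb f)) /= addrC big1 ?add0r.
  rewrite (reindex (@pval _)) /=; last first.
    pose in_Sn := insubd (1%g : 'S_n).
    by exists in_Sn => /= f Uf; first apply: val_inj; apply: insubdK.
  apply: eq_big => [s|s _]; first exact: (valP s).
  rewrite mxE [X in _ * X]big1 ?mulr1 => [|j _].
    by apply: eq_bigr => k _; rewrite /x pvalE.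
  rewrite (_ : j \in _) //; apply/imsetP; exists ((s^-1)%g j) => //.
  by rewrite pvalE permKV.
move=> f /injectivePn[k1 [k2 k12 fk]].
case: (boolP [forall j, j \in [set f k | k in 'I_n]%SET]) => [/forallP h|].
  have : (n <= #|[set f k | k in [predD1 'I_n & k2]]%SET|)%N.
    rewrite -[leqLHS](card_ord n) subset_leq_card //; apply/fintype.subsetP => j _.
    have /imsetP[k _ ->] := h j; have [->|kk2] := eqVneq k k2.
      by rewrite -fk; apply: imset_f; rewrite !inE k12.
    by apply: imset_f; rewrite !inE kk2.
  move=> /leq_trans/(_ (leq_imset_card _ _)).
  have := cardD1 k2 'I_n; rewrite card_ord inE /= add1n => nE.
  by rewrite {1}nE ltnn.
by rewrite negb_forall => /existsP[j hj]; rewrite [X in _ * X](bigD1 j) //=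
  (negbTE hj) mul0r mulr0.
Qed.

Lemma commute_sym_tens (M : 'I_n -> 'M[C]_d) :
  T *m (\sum_(s : 'S_n) tens (fun k => M (s k))) =
  (\sum_(s : 'S_n) tens (fun k => M (s k))) *m T.
Proof.
rewrite -polarization mulmx_sumr mulmx_suml; apply: eq_bigr => e _.
by rewrite -scalemxAr -scalemxAl commute_power.
Qed.

Lemma delta_tens a b : delta_mx a b =
  tens (fun k => delta_mx (basis_map a k) (basis_map b k)) :> 'M[C]_(tdim n d).
Proof.
apply/matrixP => x y; rewrite !mxE.
under eq_bigr do rewrite mxE.
rewrite -natr_prod; congr (_%:R).
case: (boolP [forall k, (basis_map x k == basis_map a k) &&
    (basis_map y k == basis_map b k)]) => [/forallP h|].
  have -> : x = a by apply: basis_map_inj; apply/ffunP => k; have /andP[/eqP] := h k.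
  have -> : y = b by apply: basis_map_inj; apply/ffunP => k; have /andP[_ /eqP] := h k.
  by rewrite !eqxx big1 // => k _; rewrite !eqxx.
rewrite negb_forall => /existsP[k hk]; rewrite (bigD1 k) //= (negbTE hk) mul0n.
by case: andP => // -[/eqP xa /eqP yb]; rewrite xa yb !eqxx in hk.
Qed.

(** Matrix units are elementary tensors, and their averages are the symmetrized tensors of
    [commute_sym_tens]; the rest is linearity. *)
Lemma commute_average X :
  T *m (\sum_s P s *m X *m P s^-1%g) = (\sum_s P s *m X *m P s^-1%g) *m T.
Proof.
have deltaC a b : T *m (\sum_s P s *m delta_mx a b *m P s^-1%g) =
    (\sum_s P s *m delta_mx a b *m P s^-1%g) *m T.
  pose M k := delta_mx (basis_map a k) (basis_map b k) : 'M[C]_d.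
  rewrite (_ : \sum_s _ = \sum_(s : 'S_n) tens (fun k => M (s k))).
    exact: commute_sym_tens.
  rewrite [RHS](reindex_inj invg_inj) /=; apply: eq_bigr => s _.
  by rewrite delta_tens perm_op_tens -mulmxA perm_opM mulVg perm_op1 mulmx1.
rewrite (matrix_sum_delta X).
have -> : \sum_s P s *m (\sum_a \sum_b X a b *: delta_mx a b) *m P s^-1%g =
    \sum_a \sum_b X a b *: \sum_s P s *m delta_mx a b *m P s^-1%g.
  under [RHS]eq_bigr do under eq_bigr do rewrite scaler_sumr.
  under [RHS]eq_bigr do rewrite exchange_big /=.
  rewrite [RHS]exchange_big /=; apply: eq_bigr => s _.
  rewrite mulmx_sumr mulmx_suml; apply: eq_bigr => a _.
  rewrite mulmx_sumr mulmx_suml; apply: eq_bigr => b _.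
  by rewrite -scalemxAr -scalemxAl.
rewrite mulmx_sumr mulmx_suml; apply: eq_bigr => a _.
rewrite mulmx_sumr mulmx_suml; apply: eq_bigr => b _.
by rewrite -scalemxAr -scalemxAl deltaC.
Qed.

Lemma commute_gop k : T *m gop d k = gop d k *m T.
Proof.
rewrite /gop mulmx_sumr mulmx_suml; apply: eq_bigr => s _.
by rewrite -scalemxAr -scalemxAl T_perm.
Qed.

(* Schur's lemma: compressing the averages of [commute_average] by [f] shows  *)
(* that [T] commutes with every [f X f], hence is scalar on the range of [f]. *)
Lemma corner_eigen (f : 'M[C]_(tdim n d)) : f^t* = f -> T *m f = f *m T ->
  (forall s, exists e : C, f *m P s *m f = e *: f) -> exists c : C, T *m f = c *: f.
Proof.
move=> fH Tf /fin_all_exists[e he].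
have [->|f0] := eqVneq f 0; first by exists 0; rewrite mulmx0 scaler0.
have heV s : f *m P s^-1%g *m f = (e s)^* *: f.
  apply: adj_inj; rewrite adjM fH adjM fH adjZ fH conjCK perm_op_adj invgK.
  by rewrite mulmxA he.
pose g := \sum_s e s * (e s)^*.
(* [g] is the sum of the $|e_s|^2$, and $e_1=0$ would give $f^2=0$. *)
have g0 : g != 0.
  apply/eqP => /eqP; rewrite psumr_eq0; last by move=> s _; exact: mul_conjC_ge0.
  move=> /allP/(_ 1%g (mem_index_enum _)); rewrite mul_conjC_eq0 => /eqP e1.
  case/eqP: f0; apply: herm_sqr_eq0; first exact: fH.
  by have := he 1%g; rewrite perm_op1 mulmx1 e1 scale0r.
have comm X : T *m (f *m X *m f) = f *m X *m f *m T.
  have gE : f *m (\sum_s P s *m (f *m X *m f) *m P s^-1%g) *m f = g *: (f *m X *m f).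
    rewrite mulmx_sumr mulmx_suml /g scaler_suml; apply: eq_bigr => s _.
    have -> : f *m (P s *m (f *m X *m f) *m P s^-1%g) *m f =
        (f *m P s *m f) *m X *m (f *m P s^-1%g *m f) by rewrite !mulmxA.
    by rewrite he heV -!scalemxAl -scalemxAr scalerA.
  have : g *: (T *m (f *m X *m f)) = g *: (f *m X *m f *m T).
    rewrite scalemxAr -gE scalemxAl -gE; set A := \sum_s _.
    have TA : T *m A = A *m T by exact: commute_average.
    by rewrite -!mulmxA -Tf !mulmxA Tf -[f *m T *m A]mulmxA TA !mulmxA.
  by move=> /(scalerI g0).
have /matrix0Pn[x [y fxy]] := f0.
(* For $E$ the matrix unit at [(b, x)], the entry [(a, y)] of $TfEf=fEfT$ reads
   $(Tf)_{ab}f_{xy}=f_{ab}(fT)_{xy}$. *)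
exists ((f *m T) x y / f x y); apply/matrixP => a b.
have := congr1 (fun X : 'M[C]_(tdim n d) => X a y) (comm (delta_mx b x)).
have deltaE (A B : 'M[C]_(tdim n d)) : (A *m delta_mx b x *m B) a y = A a b * B x y.
  rewrite -(mul_delta_mx (0 : 'I_1)) mulmxA -mulmxA -rowE -colE.
  by rewrite !mxE big_ord1 !mxE.
rewrite !mulmxA deltaE -mulmxA deltaE => h.
apply: (mulIf fxy); rewrite h [in RHS]mxE mulrAC divfK //.
exact: mulrC.
Qed.

Lemma young_psd_eigen sh : sorted geq sh -> sumn sh = n ->
  exists c : C, T *m young_psd R n d sh = c *: young_psd R n d sh.
Proof.
move=> srt shn; apply: corner_eigen; first exact: young_psd_adj.
  by rewrite young_psd_gop commute_gop.
by move=> s; rewrite gop_perm; exact: young_psd_corner.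
Qed.

(** By [young_sym_psd] the symmetrizer maps into the range of [young_psd], on which [T] is scalar;
    the permutations carry this to all generators of the block. *)
Lemma young_block_eigen (lam : young n d) : exists c : C,
  T *m wss_proj R lam = c *: wss_proj R lam.
Proof.
have [c hc] := young_psd_eigen (young_sorted lam) (young_sum lam).
have [Y hY] := young_sym_psd R d (young_sorted lam) (young_sum lam).
exists c; apply: wss_proj_scalar => s.
by rewrite mulmxA T_perm -mulmxA hY (mulmxA T) hc -scalemxAl -scalemxAr.
Qed.

(* If [wss_proj R lam] vanishes, then [0 / 0 = 0] gives the right summand. *)
Lemma trace_blocks (E : 'M[C]_(tdim n d)) : \tr (T *m E) = \sum_(lam : young n d)
  \tr (T *m wss_proj R lam) * (\tr (wss_proj R lam *m E) / \tr (wss_proj R lam)).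
Proof.
rewrite -[T in LHS]mulmx1 -(wss_proj_sum R n d) mulmx_sumr mulmx_suml linear_sum /=.
apply: eq_bigr => lam _; have [c hc] := young_block_eigen lam.
rewrite hc -scalemxAl !linearZ /=.
have [tr0|tr0] := eqVneq (\tr (wss_proj R lam)) 0; last first.
  by rewrite -mulrA; congr (_ * _); rewrite mulrCA divff // mulr1.
have -> : wss_proj R lam = 0; last by rewrite mul0mx !linear0 !(mulr0, mul0r).
by apply: gram_eq0; rewrite wss_proj_herm wss_proj_idem.
Qed.
End DoubleCommutant.

(** * Measurability of the spectrum *)

Section DensityMeasurability.
Variables (R : realType) (d : nat).
Local Notation C := R[i].
Local Notation Cn := (R[i])^o.

Lemma coord_cts (i j : 'I_d.+1) : continuous (fun M : 'M[Cn]_d.+1 => M i j : Cn).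
Proof.
move=> M A hA; exists (fun a b => if (a == i) && (b == j) then A else setT).
  move=> a b; case: ifP => [/andP[/eqP -> /eqP ->]//|_]; exact: filterT.
by move=> N /(_ i j); rewrite !eqxx.
Qed.

Lemma matrix_cts (T : topologicalType) (f : T -> 'M[Cn]_d.+1) :
  (forall i j, continuous (fun x => f x i j : Cn)) -> continuous f.
Proof.
move=> hf x A [Q hQ QA].
have : \forall y \near x, forall ij : 'I_d.+1 * 'I_d.+1, Q ij.1 ij.2 (f y ij.1 ij.2).
  by apply: filter_forall => -[i j]; exact: hf (hQ i j).
by apply: filterS => y hy; apply: QA => i j; exact: (hy (i, j)).
Qed.

Lemma cvg_csum (T I : Type) (F : set_system T) {FF : Filter F} (r : seq I)
  (u : I -> T -> Cn) (l : I -> Cn) :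
  (forall k, u k @ F --> l k) ->
  (fun x => \sum_(k <- r) u k x : Cn) @ F --> (\sum_(k <- r) l k : Cn).
Proof.
move=> h; elim: r => [|k r IH].
  by under eq_fun do rewrite big_nil; rewrite big_nil; exact: cvg_cst.
under eq_fun do rewrite big_cons; rewrite big_cons.
by apply: cvgD; [exact: h|exact: IH].
Qed.

Lemma conj_cts (U : 'M[C]_d.+1) :
  continuous (fun M : 'M[Cn]_d.+1 => (U *m M *m U^t*) : 'M[Cn]_d.+1).
Proof.
apply: matrix_cts => i j M.
rewrite (_ : (fun N : 'M[Cn]_d.+1 => _) = (fun N =>
  \sum_b \sum_a ((U^t*) b j * U i a) *: (N a b : Cn) : Cn)); last first.
  apply/funext => N; rewrite mxE; apply: eq_bigr => b _; rewrite mxE mulr_suml.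
  by apply: eq_bigr => a _; rewrite mulrC mulrA.
apply: (@cvg_csum _ _ _ (nbhs_filter M)) => b.
apply: (@cvg_csum _ _ _ (nbhs_filter M)) => a.
by apply: cvgZl_tmp; exact: coord_cts.
Qed.

Lemma measurable_conj (U : 'M[C]_d.+1) (hU : U \is unitarymx) :
  measurable_fun setT (conj_density hU : density R d.+1 -> density R d.+1).
Proof.
apply: (measurability (@density_open R d.+1)) => // B0 [B [V Vop BE] B0E]; rewrite -{}B0E {}BE.
rewrite setTI; apply: sub_sigma_algebra.
exists ((fun M : 'M[Cn]_d.+1 => (U *m M *m U^t*) : 'M[Cn]_d.+1) @^-1` V) => //.
by apply: open_comp => // M _; exact: conj_cts.
Qed.

Lemma Re_cts : continuous (fun z : Cn => complex.Re z : R).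
Proof.
move=> z A /nbhs_ballP[e e0 hA]; apply/nbhs_ballP; exists (e%:C)%C => /=.
  by rewrite ltcR.
move=> w; rewrite /ball /= => hw; apply: hA; rewrite /ball /=.
rewrite -ltcR -raddfB; exact: le_lt_trans (normc_ge_Re _) hw.
Qed.

Lemma normc_ge_Im (x : C) : (`|complex.Im x|%:C)%C <= `|x|.
Proof.
by case: x => a b; simpc; rewrite -sqrtr_sqr ler_wsqrtr // lerDr sqr_ge0.
Qed.

Lemma Im_cts : continuous (fun z : Cn => complex.Im z : R).
Proof.
move=> z A /nbhs_ballP[e e0 hA]; apply/nbhs_ballP; exists (e%:C)%C => /=.
  by rewrite ltcR.
move=> w; rewrite /ball /= => hw; apply: hA; rewrite /ball /=.
rewrite -ltcR -raddfB; exact: le_lt_trans (normc_ge_Im _) hw.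
Qed.

Lemma measurable_fun_gt (disp : measure_display) (T : measurableType disp)
  (f : T -> R) : (forall c, measurable [set x | c < f x]) -> measurable_fun setT f.
Proof.
move=> hf; apply: (measurability _ (RGenOInfty.measurableE R)).
move=> B0 [B [c BE] B0E]; rewrite -{}B0E {}BE setTI.
rewrite (_ : f @^-1` _ = [set x | c < f x]) //.
by apply/seteqP; split => x /=; rewrite in_itv /= andbT.
Qed.

Lemma measurable_cts (g : 'M[Cn]_d.+1 -> R) : continuous g ->
  measurable_fun setT (fun rho : density R d.+1 => g rho).
Proof.
move=> gc; apply: measurable_fun_gt => c; apply: sub_sigma_algebra.
exists (g @^-1` [set x | c < x]) => //.
by apply: open_comp => [M _|]; [exact: gc|exact: open_gt].
Qed.
End DensityMeasurability.

Section ComplexMeasurable.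
Context {disp : measure_display} {T : measurableType disp} {R : realType}.
Local Notation C := R[i].

Definition cmeasurable (f : T -> C) : Prop :=
  measurable_fun setT (fun x => complex.Re (f x)) /\
  measurable_fun setT (fun x => complex.Im (f x)).

Lemma cmeasurable_cst c : cmeasurable (fun=> c).
Proof. by split; exact: measurable_cst. Qed.

Lemma cmeasurableD f g : cmeasurable f -> cmeasurable g ->
  cmeasurable (fun x => f x + g x).
Proof.
move=> [f1 f2] [g1 g2]; split.
  under eq_fun do rewrite raddfD /=; exact: measurable_funD.
under eq_fun do rewrite raddfD /=; exact: measurable_funD.
Qed.

Lemma cmeasurableM f g : cmeasurable f -> cmeasurable g ->
  cmeasurable (fun x => f x * g x).
Proof.
move=> [f1 f2] [g1 g2]; split.
  rewrite (_ : (fun x => _) = (fun x => complex.Re (f x) * complex.Re (g x) -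
    complex.Im (f x) * complex.Im (g x))).
    by apply: measurable_funB; exact: measurable_funM.
  by apply/funext => x; case: (f x) (g x) => a b [a' b'].
rewrite (_ : (fun x => _) = (fun x => complex.Re (f x) * complex.Im (g x) +
  complex.Im (f x) * complex.Re (g x))).
  by apply: measurable_funD; exact: measurable_funM.
by apply/funext => x; case: (f x) (g x) => a b [a' b'].
Qed.

Lemma cmeasurable_sum (I : Type) (r : seq I) (P : pred I) (f : I -> T -> C) :
  (forall k, cmeasurable (f k)) -> cmeasurable (fun x => \sum_(k <- r | P k) f k x).
Proof.
move=> hf; elim: r => [|k r IH].
  by under eq_fun do rewrite big_nil; exact: cmeasurable_cst.
under eq_fun do rewrite big_cons.
by case: (P k) => //; exact: cmeasurableD.
Qed.

Lemma cmeasurable_prod (I : Type) (r : seq I) (P : pred I) (f : I -> T -> C) :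
  (forall k, cmeasurable (f k)) -> cmeasurable (fun x => \prod_(k <- r | P k) f k x).
Proof.
move=> hf; elim: r => [|k r IH].
  by under eq_fun do rewrite big_nil; exact: cmeasurable_cst.
under eq_fun do rewrite big_cons.
by case: (P k) => //; exact: cmeasurableM.
Qed.

Definition mmeasurable m p (F : T -> 'M[C]_(m, p)) : Prop :=
  forall i j, cmeasurable (fun x => F x i j).

Lemma mmeasurableM m p q (F : T -> 'M[C]_(m, p)) (G : T -> 'M[C]_(p, q)) :
  mmeasurable F -> mmeasurable G -> mmeasurable (fun x => F x *m G x).
Proof.
move=> hF hG a b; under eq_fun do rewrite mxE.
by apply: cmeasurable_sum => k; exact: cmeasurableM.
Qed.

Lemma mmeasurable_cst m p (A : 'M[C]_(m, p)) : mmeasurable (fun=> A).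
Proof. by move=> a b; exact: cmeasurable_cst. Qed.

Lemma cmeasurable_trace m (F : T -> 'M[C]_m) :
  mmeasurable F -> cmeasurable (fun x => \tr (F x)).
Proof. by move=> hF; apply: cmeasurable_sum. Qed.

Lemma mmeasurable_power n m (F : T -> 'M[C]_m) :
  mmeasurable F -> mmeasurable (fun x => tensor_power n (F x)).
Proof.
move=> hF a b; under eq_fun do rewrite mxE.
by apply: cmeasurable_prod => k; exact: hF.
Qed.
End ComplexMeasurable.

Lemma mmeasurable_density (R : realType) d :
  mmeasurable (fun rho : density R d.+1 => rho : 'M[R[i]]_d.+1).
Proof.
move=> a b; split.
  apply: (@measurable_cts R d (fun M => complex.Re (M a b))) => M.
  by apply: (cvg_comp (fun M : 'M[(R[i])^o]_d.+1 => M a b)); [exact: coord_cts|exact: Re_cts].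
apply: (@measurable_cts R d (fun M => complex.Im (M a b))) => M.
by apply: (cvg_comp (fun M : 'M[(R[i])^o]_d.+1 => M a b)); [exact: coord_cts|exact: Im_cts].
Qed.

(** * The ordered spectrum through power sums *)

Section Spectrum.
Variables (R : realType) (d : nat).
Local Notation C := R[i].
Implicit Types rho sigma : density R d.+1.

Lemma spec_diagonalize rho : exists2 W : 'M[C]_d.+1, W \is unitarymx &
  W *m rho *m W^t* = diag_theta (Spec rho).
Proof.
have [hp _] := densityP rho; set V := spectralmx rho.
have VU : V \is unitarymx by exact: spectral_unitarymx.
have : perm_eq (spec_tuple rho)
    [tuple complex.Re (spectral_diag rho 0 c) | c < d.+1] by rewrite perm_sort.
move=> /tuple_permP[s sE].
have PU : perm_mx s \is @unitarymx C _ _.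
  apply/unitarymxP; rewrite tr_perm_mx map_perm_mx -perm_mxM mulgV.
  exact: perm_mx1.
exists (perm_mx s *m V); first exact: mul_unitarymx.
rewrite adjM !mulmxA -[_ *m V *m rho]mulmxA -[_ *m _ *m V^t*]mulmxA spectral_conj //.
rewrite tr_perm_mx map_perm_mx -row_permE -col_permE.
have tE x : tnth (Spec rho) x = complex.Re (spectral_diag rho 0 (s x)).
  rewrite (_ : theta_val (Spec rho) = [tuple tnth
    [tuple complex.Re (spectral_diag rho 0 c) | c < d.+1] (s i) | i < d.+1]).
    by rewrite !tnth_mktuple.
  exact: val_inj sE.
apply/matrixP => x y; rewrite !mxE (inj_eq perm_inj) tE.
have := spectral_diag_ge0 (s x) hp; case: (spectral_diag _ _ _) => a b.
by rewrite lecE /= => /andP[/eqP -> _].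
Qed.

Lemma unitary_adjK (W : 'M[C]_d.+1) : W \is unitarymx -> W^t* *m W = 1%:M.
Proof. by move=> /unitarymxP /mulmx1C. Qed.

Lemma expr_conj_unitary (W M : 'M[C]_d.+1) m : W \is unitarymx ->
  (W *m M *m W^t*) ^+ m = W *m (M ^+ m) *m W^t*.
Proof.
move=> WU; elim: m => [|m IH].
  by rewrite !expr0 mulmx1 (unitarymxP WU).
rewrite !exprS IH -!mulmxE !mulmxA -[_ *m W^t* *m W]mulmxA.
by rewrite (unitary_adjK WU) mulmx1.
Qed.

Lemma trace_conj_unitary (W M : 'M[C]_d.+1) : W \is unitarymx ->
  \tr (W *m M *m W^t*) = \tr M.
Proof. by move=> WU; rewrite mxtrace_mulC mulmxA (unitary_adjK WU) mul1mx. Qed.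

Lemma diag_mx_expr (D : 'rV[C]_d.+1) m : diag_mx D ^+ m = diag_mx (\row_k D 0 k ^+ m).
Proof.
elim: m => [|m IH].
  by apply/matrixP => x y; rewrite expr0 !mxE.
rewrite exprS IH -mulmxE mul_diag_mx; apply/matrixP => x y; rewrite !mxE.
by rewrite mulrnAr exprS.
Qed.

(** Traces of powers are polynomial in the entries and unitarily invariant, and they determine the
    ordered spectrum; measurability and invariance of [Spec] are drawn from them. *)
Definition power_sum rho m : R := complex.Re (\tr ((rho : 'M[C]_d.+1) ^+ m)).

Lemma power_sumE rho m : power_sum rho m = \sum_k tnth (Spec rho) k ^+ m.
Proof.
have [W WU WE] := spec_diagonalize rho.
rewrite /power_sum -(trace_conj_unitary _ WU) -expr_conj_unitary // WE diag_mx_expr.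
rewrite mxtrace_diag raddf_sum; apply: eq_bigr => k _.
by rewrite !mxE -rmorphXn.
Qed.

Lemma Theta_ge0 (t : Theta R d.+1) k : 0 <= tnth t k.
Proof. by have [/(_ k)/andP[]] := thetaP t. Qed.

Lemma Theta_sorted (t : Theta R d.+1) (j k : 'I_d.+1) : (j <= k)%N ->
  tnth t k <= tnth t j.
Proof.
have [_ srt _] := thetaP t => jk; rewrite !(tnth_nth 0).
apply: (sorted_leq_nth (leT := >=%R)) => //.
- by move=> x y z yx zy; apply: le_trans zy yx.
- exact: lexx.
- by rewrite inE size_tuple.
- by rewrite inE size_tuple.
Qed.

Lemma Theta_eq (t u : Theta R d.+1) : (forall k, tnth t k = tnth u k) -> t = u.
Proof.
case: t u => t ht [u hu] /= e; have {}e : t = u by exact: eq_from_tnth.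
by case: u / e hu => hu; congr MkTheta; exact: Prop_irrelevance.
Qed.

Lemma expr_gt_scale (c t : R) : 0 <= c -> c < t -> exists m, d.+1%:R * c ^+ m < t ^+ m.
Proof.
move=> c0 ct; have t0 : 0 < t by exact: le_lt_trans ct.
have z1 : `|c / t| < 1 by rewrite ger0_norm ?divr_ge0 ?(ltW t0) // ltr_pdivrMr // mul1r.
have [->|c_neq0] := eqVneq c 0; first by exists 1%N; rewrite expr1 mulr0.
have z0 : 0 < c / t by rewrite divr_gt0 // lt_neqAle eq_sym c_neq0.
have /cvgrPdist_lt/(_ 1 ltr01)[m _ /(_ m (leqnn m))] := @cvg_geometric R d.+1%:R _ z1.
rewrite /= sub0r normrN ger0_norm ?mulr_ge0 ?exprn_ge0 ?(ltW z0) //= => hm.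
exists m; move: hm; rewrite expr_div_n mulrA ltr_pdivrMr ?mul1r //.
exact: exprn_gt0.
Qed.

(** The difference is $\sum_{j\ge k}\theta_j^m$. If $\theta_k>c$, the term $\theta_k^m$ alone
    outgrows $(d+1)c^m$; if $\theta_k\le c$, none of the at most $d+1$ terms exceeds $c^m$. The
    eigenvalues are thus recovered one by one from the largest down. *)
Lemma Spec_gtP rho (k : 'I_d.+1) (c : R) : 0 <= c ->
  (c < tnth (Spec rho) k) <-> exists m, d.+1%:R * c ^+ m <
    power_sum rho m - \sum_(j < d.+1 | (j < k)%N) tnth (Spec rho) j ^+ m.
Proof.
move=> c0.
have diffE m : power_sum rho m - \sum_(j < d.+1 | (j < k)%N) tnth (Spec rho) j ^+ m =
    \sum_(j < d.+1 | ~~ (j < k)%N) tnth (Spec rho) j ^+ m.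
  by rewrite power_sumE (bigID (fun j : 'I_d.+1 => (j < k)%N)) /= addrAC subrr add0r.
split => [/(expr_gt_scale c0)[m hm]|[m]].
  exists m; rewrite diffE (bigD1 k) /= ?ltnn //; apply: (lt_le_trans hm).
  by rewrite lerDl sumr_ge0 // => j _; apply: exprn_ge0; exact: (Theta_ge0 (Spec rho)).
rewrite diffE; apply: contraTT; rewrite -!leNgt => kc.
apply: (@le_trans _ _ (\sum_(j < d.+1) c ^+ m)); last first.
  by rewrite sumr_const card_ord mulr_natl.
rewrite big_mkcond; apply: ler_sum => j _; case: ifP => [|_]; last exact: exprn_ge0.
rewrite -leqNgt => jk; rewrite lerXn2r ?nnegrE ?(Theta_ge0 (Spec rho)) //.
by apply: le_trans kc; exact: Theta_sorted.
Qed.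

Lemma measurable_power_sum m : measurable_fun setT (power_sum^~ m).
Proof.
suff h : mmeasurable (fun rho : density R d.+1 => (rho : 'M[C]_d.+1) ^+ m).
  by have [] := cmeasurable_trace h.
elim: m => [|m IH].
  by under eq_fun do rewrite expr0; exact: mmeasurable_cst.
under eq_fun do rewrite exprS -mulmxE.
by apply: mmeasurableM => //; exact: mmeasurable_density.
Qed.

Lemma measurable_gt (disp : measure_display) (T : measurableType disp) (f : T -> R)
  (c : R) : measurable_fun setT f -> measurable [set x | c < f x].
Proof.
move=> mf; rewrite (_ : mkset _ = setT `&` f @^-1` `]c, +oo[).
  exact: mf.
by rewrite setTI; apply/seteqP; split => x /=; rewrite in_itv /= andbT.
Qed.

(** Induction on [k]: by [Spec_gtP] a superlevel set is a countable union of conditions on power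
    sums and on the earlier eigenvalues. *)
Lemma measurable_Spec_coord (k : 'I_d.+1) :
  measurable_fun setT (fun rho : density R d.+1 => tnth (Spec rho) k).
Proof.
case: k => k; elim/ltn_ind: k => k IH hk; apply: measurable_fun_gt => c.
have [c0|c0] := ltP c 0.
  rewrite (_ : mkset _ = setT) //; apply/seteqP; split => rho //= _.
  by apply: lt_le_trans c0 _; exact: (Theta_ge0 (Spec rho)).
rewrite (_ : mkset _ = \bigcup_m [set rho | d.+1%:R * c ^+ m < power_sum rho m -
    \sum_(j < d.+1 | (j < k)%N) tnth (Spec rho) j ^+ m]).
  apply: bigcup_measurable => m _; apply: measurable_gt; apply: measurable_funB.
    exact: measurable_power_sum.
  rewrite (_ : (fun x => _) = (fun rho : density R d.+1 => \sum_(j < d.+1)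
     (if (j < k)%N then tnth (Spec rho) j ^+ m else 0))).
    apply: measurable_sum => -[j hj] /=; case: (ltnP j k) => [jk|_]; last exact: measurable_cst.
    by apply: measurable_funX; exact: IH.
  by apply/funext => rho; rewrite big_mkcond.
apply/seteqP; split => rho /=; first by move=> /(Spec_gtP _ _ c0)[m hm]; exists m.
by move=> [m _ hm]; apply/(Spec_gtP _ _ c0); exists m.
Qed.

Lemma measurable_Spec : measurable_fun setT (@Spec R d.+1).
Proof.
have mt : measurable_fun setT (fun rho : density R d.+1 => spec_tuple rho).
  by apply/measurable_fun_tnthP => k; exact: measurable_Spec_coord.
move=> _ B [B' mB' <-]; rewrite !setTI -comp_preimage.
by rewrite -[X in measurable X]setTI; exact: mt.
Qed.

Lemma Spec_power_sum rho sigma :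
  (forall m, power_sum rho m = power_sum sigma m) -> Spec rho = Spec sigma.
Proof.
move=> e; apply: Theta_eq => -[k hk]; elim/ltn_ind: k hk => k IH hk.
have step (r s : density R d.+1) : (forall m, power_sum r m = power_sum s m) ->
    (forall j : 'I_d.+1, (j < k)%N -> tnth (Spec r) j = tnth (Spec s) j) ->
    tnth (Spec r) (Ordinal hk) <= tnth (Spec s) (Ordinal hk).
  move=> rs hj; rewrite leNgt; apply/negP => lt.
  have /(Spec_gtP _ _ (Theta_ge0 _ _))[m] := lt.
  rewrite rs; under eq_bigr do rewrite hj //.
  move=> hm; suff : tnth (Spec s) (Ordinal hk) < tnth (Spec s) (Ordinal hk).
    by rewrite ltxx.
  by apply/(Spec_gtP _ _ (Theta_ge0 _ _)); exists m.
by apply/eqP; rewrite eq_le !step // => -[j hj] jk; rewrite IH.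
Qed.

Lemma Spec_conj (U : 'M[C]_d.+1) (hU : U \is unitarymx) rho :
  Spec (conj_density hU rho) = Spec rho.
Proof.
apply: Spec_power_sum => m.
by rewrite /power_sum /= expr_conj_unitary // trace_conj_unitary.
Qed.
End Spectrum.

(** * Averages of states with spectrum in a given set *)

Section ComplexIntegral.
Context {disp : measure_display} {T : measurableType disp} {R : realType}.
Variables (mu : probability T R) (G : set T).
Hypothesis mG : measurable G.
Local Notation C := R[i].

Definition cbounded (f : T -> C) : Prop :=
  cmeasurable f /\ exists M : R, forall x, `|f x| <= (M%:C)%C.

Definition Cint (f : T -> C) : C :=
  ((\int[mu]_(x in G) complex.Re (f x)) +i* (\int[mu]_(x in G) complex.Im (f x)))%C.

Lemma bounded_integrable (f : T -> R) (M : R) :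
  measurable_fun setT f -> (forall x, `|f x| <= M) -> mu.-integrable G (EFin \o f).
Proof.
move=> mf hM; apply: measurable_bounded_integrable => //.
- by apply: le_lt_trans (probability_le1 mu mG) _; exact: ltry.
- exact: measurable_funTS.
- exists M; split; first exact: num_real.
  by move=> y My x _; apply: le_trans (hM x) (ltW My).
Qed.

Lemma cbounded_integrable f : cbounded f ->
  mu.-integrable G (EFin \o (fun x => complex.Re (f x))) /\
  mu.-integrable G (EFin \o (fun x => complex.Im (f x))).
Proof.
move=> [[mre mim] [M hM]]; split; apply: (@bounded_integrable _ M) => // x.
  by rewrite -lecR; exact: le_trans (normc_ge_Re _) (hM x).
by rewrite -lecR; exact: le_trans (normc_ge_Im _) (hM x).
Qed.

Lemma cbounded_cst c : cbounded (fun=> c).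
Proof.
split; first exact: cmeasurable_cst.
by exists (complex.Re `|c|) => x; rewrite RRe_real ?normr_real.
Qed.

Lemma cboundedD f g : cbounded f -> cbounded g -> cbounded (fun x => f x + g x).
Proof.
move=> [mf [M hM]] [mg [M' hM']]; split; first exact: cmeasurableD.
by exists (M + M') => x; rewrite rmorphD; apply: le_trans (ler_normD _ _) (lerD (hM x) (hM' x)).
Qed.

Lemma cboundedM f g : cbounded f -> cbounded g -> cbounded (fun x => f x * g x).
Proof.
move=> [mf [M hM]] [mg [M' hM']]; split; first exact: cmeasurableM.
exists (M * M') => x; rewrite rmorphM normrM.
by apply: ler_pM; rewrite ?normr_ge0.
Qed.

Lemma cbounded_sum (I : Type) (r : seq I) (f : I -> T -> C) :
  (forall k, cbounded (f k)) -> cbounded (fun x => \sum_(k <- r) f k x).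
Proof.
move=> hf; elim: r => [|k r IH].
  by under eq_fun do rewrite big_nil; exact: cbounded_cst.
by under eq_fun do rewrite big_cons; exact: cboundedD.
Qed.

Lemma cbounded_prod (I : Type) (r : seq I) (f : I -> T -> C) :
  (forall k, cbounded (f k)) -> cbounded (fun x => \prod_(k <- r) f k x).
Proof.
move=> hf; elim: r => [|k r IH].
  by under eq_fun do rewrite big_nil; exact: cbounded_cst.
by under eq_fun do rewrite big_cons; exact: cboundedM.
Qed.

Lemma eq_Cint f g : (forall x, f x = g x) -> Cint f = Cint g.
Proof. by move=> e; rewrite (_ : f = g) //; exact/funext. Qed.

Lemma Cint0 : Cint (fun=> 0) = 0.
Proof. by rewrite /Cint /Rintegral /= integral0. Qed.

Lemma CintD f g : cbounded f -> cbounded g -> Cint (fun x => f x + g x) = Cint f + Cint g.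
Proof.
move=> /cbounded_integrable[f1 f2] /cbounded_integrable[g1 g2]; rewrite /Cint.
under eq_Rintegral do rewrite raddfD /=.
under [X in (_ +i* X)%C]eq_Rintegral do rewrite raddfD /=.
by rewrite !RintegralD.
Qed.

Lemma CintZ c f : cbounded f -> Cint (fun x => c * f x) = c * Cint f.
Proof.
move=> /cbounded_integrable[f1 f2]; case: c => a b; rewrite /Cint.
have -> : \int[mu]_(x in G) complex.Re ((a +i* b)%C * f x) =
    \int[mu]_(x in G) (a * complex.Re (f x) + (- b) * complex.Im (f x)).
  by apply: eq_Rintegral => x _; case: (f x) => u v /=; rewrite mulNr.
have -> : \int[mu]_(x in G) complex.Im ((a +i* b)%C * f x) =
    \int[mu]_(x in G) (a * complex.Im (f x) + b * complex.Re (f x)).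
  by apply: eq_Rintegral => x _; case: (f x).
have Zint (r : R) (h : T -> R) : mu.-integrable G (EFin \o h) ->
    mu.-integrable G (EFin \o (fun x => r * h x)).
  by move=> hh; rewrite (_ : _ \o _ = (fun x => r%:E * (EFin \o h) x)%E);
    [exact: integrableZl|exact/funext].
rewrite !RintegralD ?RintegralZl //; try exact: Zint.
by simpc.
Qed.

Lemma Cint_sum (I : Type) (r : seq I) (f : I -> T -> C) :
  (forall k, cbounded (f k)) ->
  Cint (fun x => \sum_(k <- r) f k x) = \sum_(k <- r) Cint (f k).
Proof.
move=> hf; elim: r => [|k r IH].
  by rewrite big_nil -[RHS]Cint0; apply: eq_Cint => x; rewrite big_nil.
rewrite big_cons -IH -CintD //; last exact: cbounded_sum.
by apply: eq_Cint => x; rewrite big_cons.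
Qed.
End ComplexIntegral.

Section StateAverage.
Variables (R : realType) (n d : nat).
Variable prior : probability (density R d.+1) R.
Hypothesis prior_inv : unitarily_invariant prior.
Local Notation C := R[i].
Implicit Types (rho : density R d.+1) (G : set (Theta R d.+1)).
Local Notation N := (tdim n d.+1).

Lemma density_herm rho : (rho : 'M[C]_d.+1)^t* = rho.
Proof.
have [[/is_hermitianmxP h _] _] := densityP rho.
by rewrite [RHS]h expr0 scale1r.
Qed.

(** $|\rho_{ij}|^2\le\operatorname{Tr}\rho\rho^*=\sum_k\theta_k^2\le\sum_k\theta_k=1$. *)
Lemma density_entry_le1 rho i j : `|(rho : 'M[C]_d.+1) i j| <= 1.
Proof.
rewrite -(@ler_pXn2r _ 2) ?nnegrE // expr1n.
apply: (@le_trans _ _ (\tr ((rho : 'M[C]_d.+1) *m rho^t*))).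
  rewrite trace_gram (bigD1 i) //= (bigD1 j) //= -addrA lerDl.
  by rewrite addr_ge0 ?sumr_ge0 // => k _; rewrite ?sumr_ge0 // => *; rewrite exprn_ge0.
have [W WU WE] := spec_diagonalize rho.
rewrite density_herm mulmxE -expr2 -(trace_conj_unitary _ WU) -expr_conj_unitary // WE.
rewrite diag_mx_expr mxtrace_diag.
have [t01 _ t1] := thetaP (Spec rho).
rewrite -(rmorph1 (real_complex R)) -t1 rmorph_sum /=; apply: ler_sum => k _.
rewrite !mxE -rmorphXn /= lecR expr2.
by have /andP[t0 le1] := t01 k; exact: ler_piMl.
Qed.

Lemma cbounded_power a b : cbounded (fun rho => tensor_power n (rho : 'M[C]_d.+1) a b).
Proof.
rewrite (_ : (fun rho => _) = (fun rho => \prod_(k < n)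
    (rho : 'M[C]_d.+1) (basis_map a k) (basis_map b k))).
  apply: cbounded_prod => k; split; first exact: mmeasurable_density.
  by exists 1 => rho; exact: density_entry_le1.
by apply/funext => rho; rewrite mxE.
Qed.

Lemma cbounded_trace (E : 'M[C]_N) :
  cbounded (fun rho => \tr (tensor_power n (rho : 'M[C]_d.+1) *m E)).
Proof.
apply: cbounded_sum => a; rewrite (_ : (fun rho => _) = (fun rho => \sum_b
    tensor_power n (rho : 'M[C]_d.+1) a b * E b a)).
  apply: cbounded_sum => b; apply: cboundedM; first exact: cbounded_power.
  exact: cbounded_cst.
by apply/funext => rho; rewrite mxE.
Qed.

Section Fixed.
Variable G : set (Theta R d.+1).
Hypothesis mG : measurable G.
Let D : set (density R d.+1) := @Spec R d.+1 @^-1` G.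

Let mD : measurable D.
Proof. by rewrite -[D]setTI; exact: measurable_Spec. Qed.

(** The operator $T_G$, an unnormalized mean state. *)
Definition average : 'M[C]_N :=
  \matrix_(a, b) Cint prior D (fun rho => tensor_power n (rho : 'M[C]_d.+1) a b).

Lemma average_mul (X Y : 'M[C]_N) : X *m average *m Y = \matrix_(a, b)
  Cint prior D (fun rho => (X *m tensor_power n (rho : 'M[C]_d.+1) *m Y) a b).
Proof.
apply/matrixP => a b; rewrite !mxE.
under [LHS]eq_bigr => k _.
  rewrite mxE mulr_suml.
  under eq_bigr => l _.
    rewrite mxE mulrAC -CintZ //; last exact: cbounded_power.
    over.
  rewrite -Cint_sum //; last first.
    by move=> l; apply: cboundedM; [exact: cbounded_cst|exact: cbounded_power].
  over.
rewrite -Cint_sum //; last first.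
  move=> k; apply: cbounded_sum => l.
  by apply: cboundedM; [exact: cbounded_cst|exact: cbounded_power].
apply: eq_Cint => rho; rewrite mxE; apply: eq_bigr => k _; rewrite mxE mulr_suml.
by apply: eq_bigr => l _; rewrite mulrAC.
Qed.

Lemma trace_average (E : 'M[C]_N) : \tr (average *m E) =
  Cint prior D (fun rho => \tr (tensor_power n (rho : 'M[C]_d.+1) *m E)).
Proof.
pose F a (rho : density R d.+1) := (tensor_power n (rho : 'M[C]_d.+1) *m E) a a.
have bF a : cbounded (F a).
  rewrite (_ : F a = (fun rho => \sum_b
      tensor_power n (rho : 'M[C]_d.+1) a b * E b a)).
    apply: cbounded_sum => b; apply: cboundedM; first exact: cbounded_power.
    exact: cbounded_cst.
  by apply/funext => rho; rewrite /F mxE.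
rewrite -[RHS]/(Cint prior D (fun rho => \sum_a F a rho)) (Cint_sum _ mD) //.
rewrite -[average]mul1mx average_mul /mxtrace; apply: eq_bigr => a _.
by rewrite mxE; apply: eq_Cint => rho; rewrite mul1mx.
Qed.

Lemma average_perm s : average *m perm_op R d.+1 s = perm_op R d.+1 s *m average.
Proof.
suff e : perm_op R d.+1 s *m average *m perm_op R d.+1 s^-1%g = average.
  by rewrite -{1}e -mulmxA perm_opM mulgV perm_op1 mulmx1.
rewrite average_mul; apply/matrixP => a b; rewrite mxE [RHS]mxE; apply: eq_Cint => rho.
by rewrite perm_op_power -mulmxA perm_opM mulVg perm_op1 mulmx1.
Qed.

(** The domain is invariant because conjugation preserves the spectrum, the measure because of
    [prior_inv]. *)
Lemma Rint_conj (U : 'M[C]_d.+1) (hU : U \is unitarymx) (f : density R d.+1 -> R) (M : R) :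
  measurable_fun setT f -> (forall x, `|f x| <= M) ->
  \int[prior]_(x in D) f (conj_density hU x) = \int[prior]_(x in D) f x.
Proof.
move=> mf hM; rewrite /Rintegral; congr fine.
have preD : conj_density hU @^-1` D = D.
  by apply/seteqP; split => rho; rewrite /D /= Spec_conj.
have mconj := measurable_conj hU.
have := integral_pushforward mconj (mu := prior) (D := D) (f := EFin \o f).
rewrite preD => <- //; last 1 first.
- apply: (bounded_integrable prior mD (M := M)) => //.
  exact: measurableT_comp.
- by apply: eq_measure_integral => A mA _; exact: prior_inv.
- exact/measurable_EFinP.
Qed.

Lemma average_unitary (U : 'M[C]_d.+1) : U \is unitarymx ->
  average *m tensor_power n U = tensor_power n U *m average.
Proof.
move=> hU; have UU := tensor_power_unitary n hU.
suff e : tensor_power n U *m average *m (tensor_power n U)^t* = average.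
  by rewrite -{1}e -mulmxA (mulmx1C (unitarymxP UU)) mulmx1.
rewrite average_mul; apply/matrixP => a b; rewrite mxE [RHS]mxE.
have [[mre mim] [M hM]] := cbounded_power a b.
transitivity (Cint prior D (fun rho =>
    tensor_power n (conj_density hU rho : 'M[C]_d.+1) a b)).
  by apply: eq_Cint => rho; rewrite tensor_power_adj -!tensor_powerM.
rewrite /Cint; congr Complex.
  apply: (Rint_conj hU mre (M := M)) => rho.
  by rewrite -lecR; exact: le_trans (normc_ge_Re _) (hM rho).
apply: (Rint_conj hU mim (M := M)) => rho.
by rewrite -lecR; exact: le_trans (normc_ge_Im _) (hM rho).
Qed.

Lemma average_trace_blocks (E : 'M[C]_N) :
  Cint prior D (fun rho => \tr (tensor_power n (rho : 'M[C]_d.+1) *m E)) =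
  \sum_(lam : young n d.+1)
    Cint prior D (fun rho => \tr (tensor_power n (rho : 'M[C]_d.+1) *m wss_proj R lam)) *
    (\tr (wss_proj R lam *m E) / \tr (wss_proj R lam)).
Proof.
rewrite -trace_average (trace_blocks average_unitary average_perm).
by apply: eq_bigr => lam _; rewrite trace_average.
Qed.
End Fixed.
End StateAverage.

(** * Integration against bare set functions *)

Section SetFunctionIntegral.
Import HBNNSimple.

(** [outcome_measure] is a bare set function. Integrals of simple functions evaluate it on
    measurable sets only, so a genuine measure can take its place. *)
Lemma eq_set_integral (d : measure_display) (T : measurableType d) (R : realType)
  (m1 m2 : set T -> \bar R) (f : T -> \bar R) :
  (forall B, measurable B -> m1 B = m2 B) ->
  (\int[m1]_x f x = \int[m2]_x f x)%E.
Proof.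
move=> e; rewrite /integral.
have sE : (fun h : {nnsfun T >-> R} => sintegral m1 h) =
          (fun h : {nnsfun T >-> R} => sintegral m2 h).
  apply/funext => h; rewrite /sintegral; apply: eq_fsbigr => x _.
  by rewrite e //; exact: measurable_funPTI.
by congr (ereal_sup _ - ereal_sup _)%E; rewrite sE.
Qed.

End SetFunctionIntegral.

Section TracePositivity.
Variables (R : realType).
Local Notation C := R[i].

(** In an eigenbasis of [X] the trace pairs its eigenvalues with diagonal entries of the conjugated
    [E]. *)
Lemma psd_trace_ge0 m (X E : 'M[C]_m) : psdmx X -> psdmx E -> 0 <= \tr (X *m E).
Proof.
move=> hX hE; set V := spectralmx X.
have VV : V^t* *m V = 1%:M by apply: mulmx1C; exact/unitarymxP/spectral_unitarymx.
have -> : \tr (X *m E) = \tr ((V *m X *m V^t*) *m (V *m E *m V^t*)).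
  rewrite !mulmxA -[_ *m V^t* *m V]mulmxA VV mulmx1.
  by rewrite [RHS]mxtrace_mulC !mulmxA VV mul1mx.
rewrite spectral_conj // /mxtrace sumr_ge0 // => a _.
rewrite mul_diag_mx mxE mulr_ge0 ?spectral_diag_ge0 //.
exact: psdmx_diag (psdmx_conj V hE).
Qed.

Lemma psd_diag_mx m (D : 'rV[C]_m) : (forall a, 0 <= D 0 a) -> psdmx (diag_mx D).
Proof.
move=> D0; split.
  apply/is_hermitianmxP; rewrite expr0 scale1r; apply/matrixP => a b.
  rewrite !mxE; have [->|ab] := eqVneq a b; last by rewrite !mulr0n conjC0.
  by rewrite !mulr1n geC0_conj.
move=> v; rewrite mul_mx_diag mxE sumr_ge0 // => a _; rewrite !mxE.
by rewrite mulrAC [_ * v a 0]mulrC mulr_ge0 // mul_conjC_ge0.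
Qed.

Lemma trace_power n m (M : 'M[C]_m) : \tr (tensor_power n M) = (\tr M) ^+ n.
Proof.
rewrite /mxtrace; under eq_bigr do rewrite mxE.
rewrite (sum_basis (fun g : {ffun 'I_n -> 'I_m} => \prod_k M (g k) (g k))).
rewrite -(bigA_distr_bigA (fun _ j => M j j)) prodr_const card_ord.
by [].
Qed.

Lemma theta_power_psd n d (t : Theta R d.+1) : psdmx (tensor_power n (diag_theta t)).
Proof.
rewrite power_diag; apply: psd_diag_mx => a; rewrite mxE.
by apply: prodr_ge0 => k _; rewrite mxE lecR; exact: Theta_ge0.
Qed.

Lemma density_power_psd n d (rho : density R d.+1) : psdmx (tensor_power n rho).
Proof.
have [W WU WE] := spec_diagonalize rho.
have -> : (rho : 'M[C]_d.+1) = W^t* *m diag_theta (Spec rho) *m W.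
  by rewrite -WE !mulmxA (unitary_adjK WU) mul1mx -mulmxA (unitary_adjK WU) mulmx1.
rewrite !tensor_powerM.
have -> : tensor_power n W = (tensor_power n (W^t*))^t* by rewrite tensor_power_adj trmxCK.
by apply: psdmx_conj; exact: theta_power_psd.
Qed.

Lemma trace_density_power n d (rho : density R d.+1) : \tr (tensor_power n rho) = 1.
Proof. by have [_ ht] := densityP rho; rewrite trace_power ht expr1n. Qed.
End TracePositivity.

(** * Joint laws of spectrum and action *)

Section EffectMeasure.
Variables (R : realType) (dA : measure_display) (A : measurableType dA) (N : nat).
Local Notation C := R[i].
Implicit Types (D : povm R A N) (X : 'M[C]_N).

(** Weak operator convergence tested on basis vectors is entrywise convergence, and the trace is a
    finite linear combination of entries. *)
Lemma trace_effect_cvg D X (F : (set A)^nat) :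
  (forall k, measurable (F k)) -> trivIset setT F ->
  (fun m => \sum_(k < m) complex.Re (\tr (X *m D (F k)))) @ \oo -->
    complex.Re (\tr (X *m D (\bigcup_k F k))).
Proof.
move=> mF tF.
have entry a b : (fun m => \sum_(k < m) D (F k) a b : C^o) @ \oo -->
    (D (\bigcup_k F k) a b : C^o).
  have eE (M : 'M[C]_N) : ((delta_mx a 0 : 'cV[C]_N)^t* *m M *m
      (delta_mx b 0 : 'cV[C]_N)) 0 0 = M a b.
    by rewrite trmx_delta map_delta_mx -rowE -colE !mxE.
  have := @effect_sigma_additive _ _ _ _ D F mF tF (delta_mx a 0) (delta_mx b 0).
  by under eq_fun do under eq_bigr do rewrite eE; rewrite eE.
have trE (M : 'M[C]_N) : \tr (X *m M) = \sum_a \sum_b X a b * M b a.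
  by apply: eq_bigr => a _; rewrite mxE.
have : (fun m => \sum_a \sum_b X a b * (\sum_(k < m) D (F k) b a) : C^o) @ \oo -->
    (\tr (X *m D (\bigcup_k F k)) : C^o).
  rewrite trE; apply: cvg_csum => a; apply: cvg_csum => b.
  by apply: cvgZl_tmp; exact: entry.
move=> h; have : (@complex.Re R) \o (fun m => \sum_a \sum_b X a b * (\sum_(k < m) D (F k) b a))
    @ \oo --> complex.Re (\tr (X *m D (\bigcup_k F k))).
  by apply: (cvg_comp _ _ h); exact: Re_cts.
rewrite (_ : _ \o _ = fun m => \sum_(k < m) complex.Re (\tr (X *m D (F k)))) //.
apply/funext => m /=; rewrite -raddf_sum /=; congr complex.Re.
under [RHS]eq_bigr do rewrite trE.
rewrite [RHS]exchange_big /=; apply: eq_bigr => a _.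
rewrite [RHS]exchange_big /=; apply: eq_bigr => b _.
by rewrite mulr_sumr.
Qed.

(** For the constant sequence of empty sets the partial sums $mc$ converge; consecutive ones differ
    by $c$, so $c=0$. *)
Lemma trace_effect0 D X : complex.Re (\tr (X *m D set0)) = 0.
Proof.
set c := complex.Re _.
have h : (fun m => \sum_(k < m) c) @ \oo --> c.
  have := @trace_effect_cvg D X (fun=> set0) (fun=> measurable0) (@trivIset_set0 _ _ _).
  by rewrite bigcup0.
have hS : (fun m => \sum_(k < m.+1) c) @ \oo --> c.
  by have := h; rewrite -(cvg_shiftS (fun m => \sum_(k < m) c)).
have := cvgB hS h; rewrite subrr => h0.
have hc : (fun m => \sum_(k < m.+1) c - \sum_(k < m) c) = cst c.
  by apply/funext => m; rewrite big_ord_recr /= [X in X - _]addrC addrK.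
have : cst c @ \oo --> (0 : R) by rewrite -hc; exact: h0.
have h1 : cst c @ \oo --> (c : R) by exact: cvg_cst.
by move=> h2; exact: (norm_cvg_unique h1 h2).
Qed.

(* Measures must be nonnegative on all sets, including nonmeasurable ones. *)
Definition eff_measure D X (hX : psdmx X) : set A -> \bar R :=
  fun B => if `[< measurable B >] then (complex.Re (\tr (X *m D B)))%:E else 0%E.

Section Instance.
Variables (D : povm R A N) (X : 'M[C]_N) (hX : psdmx X).

Lemma eff_measureE B : measurable B ->
  eff_measure D hX B = (complex.Re (\tr (X *m D B)))%:E.
Proof. by move=> mB; rewrite /eff_measure asboolT. Qed.

Lemma trace_effect_ge0 B : measurable B -> 0 <= \tr (X *m D B).
Proof. by move=> mB; exact: psd_trace_ge0 hX (effect_psd D mB). Qed.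

Let eff0 : eff_measure D hX set0 = 0%E.
Proof. by rewrite eff_measureE // trace_effect0. Qed.

Let eff_ge0 B : (0 <= eff_measure D hX B)%E.
Proof.
rewrite /eff_measure; case: asboolP => // mB; rewrite lee_fin.
by have := trace_effect_ge0 mB; rewrite lecE => /andP[].
Qed.

Let eff_sigma : semi_sigma_additive (eff_measure D hX).
Proof.
move=> F mF tF mUF; rewrite eff_measureE //.
rewrite (_ : (fun m => _) = EFin \o (fun m => \sum_(k < m) complex.Re (\tr (X *m D (F k))))).
  apply: cvg_EFin; first exact: nearW.
  exact: trace_effect_cvg.
apply/funext => m /=; rewrite big_mkord -sumEFin.
by apply: eq_bigr => k _; rewrite eff_measureE.
Qed.

HB.instance Definition _ := isMeasure.Build _ _ _ (eff_measure D hX) eff0 eff_ge0 eff_sigma.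
End Instance.
End EffectMeasure.

Section Outcome.
Variables (R : realType) (n d : nat) (dA : measure_display) (A : measurableType dA).
Local Notation C := R[i].
Local Notation N := (tdim n d.+1).
Implicit Types (D : povm R A N) (rho : density R d.+1).

Definition outcome D rho : {measure set A -> \bar R} :=
  eff_measure D (density_power_psd n rho).

Lemma outcomeE D rho B : measurable B ->
  outcome D rho B = (complex.Re (\tr (tensor_power n rho *m D B)))%:E.
Proof. exact: eff_measureE. Qed.

Section Kernel.
Variable D : povm R A N.

Let measurable_outcome U : measurable U -> measurable_fun setT (outcome D ^~ U).
Proof.
move=> mU; under eq_fun do rewrite outcomeE //.
by apply/measurable_EFinP; have [[]] := cbounded_trace (D U).
Qed.

HB.instance Definition _ := @isKernel.Build _ _ (density R d.+1) A R (outcome D) measurable_outcome.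

Let outcome_prob rho : outcome D rho setT = 1%E.
Proof. by rewrite outcomeE // effectT mulmx1 trace_density_power. Qed.

HB.instance Definition _ :=
  @Kernel_isProbability.Build _ _ (density R d.+1) A R (outcome D) outcome_prob.
End Kernel.

(** The [unit] coordinate is the source of the constant kernel with which [mkcomp] composes this
    one. *)
Definition joint D (x : unit * density R d.+1) : set (Theta R d.+1 * A) -> \bar R :=
  fun Y => outcome D x.2 ((fun a => (Spec x.2, a)) @^-1` Y).

Lemma measurable_section (t : Theta R d.+1) (Y : set (Theta R d.+1 * A)) :
  measurable Y -> measurable ((fun a => (t, a)) @^-1` Y).
Proof. by move=> mY; rewrite -[X in measurable X]setTI; exact: measurable_pair1. Qed.

Section Joint.
Variables (D : povm R A N) (x : unit * density R d.+1).

Let joint0 : joint D x set0 = 0%E.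
Proof. by rewrite /joint preimage_set0 measure0. Qed.

Let joint_ge0 Y : (0 <= joint D x Y)%E.
Proof. exact: measure_ge0. Qed.

Let joint_sigma : semi_sigma_additive (joint D x).
Proof.
move=> F mF tF mUF; rewrite /joint preimage_bigcup.
apply: measure_semi_sigma_additive.
- by move=> k; exact: measurable_section.
- apply/trivIsetP => /= j k _ _ jk; rewrite -preimage_setI.
  by move/trivIsetP : tF => /(_ _ _ _ _ jk) ->//; rewrite preimage_set0.
- by rewrite -preimage_bigcup; exact: measurable_section.
Qed.

HB.instance Definition _ := isMeasure.Build _ _ _ (joint D x) joint0 joint_ge0 joint_sigma.
End Joint.

Definition joint_kernel D (x : unit * density R d.+1) :
  {measure set (Theta R d.+1 * A) -> \bar R} := joint D x.

Section JointKernel.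
Variable D : povm R A N.

Let measurable_joint Y : measurable Y -> measurable_fun setT (joint_kernel D ^~ Y).
Proof.
move=> mY.
pose Y' : set (density R d.+1 * A) := (fun p => (Spec p.1, p.2)) @^-1` Y.
have mY' : measurable Y'.
  rewrite -[Y']setTI; apply: (measurable_fun_pair _ measurable_snd) => //.
  exact: (measurableT_comp (@measurable_Spec R d) measurable_fst).
have h := @measurable_fun_xsection_finite_kernel _ _ _ _ _ (outcome D) Y' (mem_set mY').
rewrite (_ : joint_kernel D ^~ Y = (fun rho => outcome D rho (xsection Y' rho)) \o snd).
  exact: measurableT_comp.
apply/funext => x /=; rewrite /joint_kernel /= /joint; congr (outcome D x.2 _).
by apply/seteqP; split => a; rewrite /xsection /= inE.
Qed.

HB.instance Definition _ := @isKernel.Build _ _ _ _ R (joint_kernel D) measurable_joint.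

Let joint_prob x : joint_kernel D x setT = 1%E.
Proof. by rewrite /joint_kernel /= /joint preimage_setT prob_kernel. Qed.

HB.instance Definition _ := @Kernel_isProbability.Build _ _ _ _ R (joint_kernel D) joint_prob.
End JointKernel.

Section Compare.
Variable prior : probability (density R d.+1) R.

Definition const_kernel : R.-pker unit ~> density R d.+1 :=
  kprobability (measurable_cst (prior : pprobability (density R d.+1) R)).

(** The joint law of spectrum and action, through which alone [D] enters the Bayes risk. *)
Definition mixture D : {measure set (Theta R d.+1 * A) -> \bar R} :=
  mkcomp const_kernel (joint_kernel D) tt.

Lemma integral_mixture D (f : Theta R d.+1 * A -> \bar R) :
  (forall z, 0 <= f z)%E -> measurable_fun setT f ->
  (\int[prior]_rho \int[outcome D rho]_a f (Spec rho, a) = \int[mixture D]_z f z)%E.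
Proof.
move=> f0 mf; rewrite [RHS]integral_kcomp //.
apply: eq_integral => rho _.
have mp : measurable_fun setT (fun a : A => (Spec rho, a)) by exact: measurable_pair1.
have := ge0_integral_pushforward mp (outcome D rho) measurableT mf (fun _ _ => f0 _).
by rewrite preimage_setT => <-; apply: eq_set_integral.
Qed.

(** Measurable rectangles generate the product and are stable under intersection; the displayed
    integrals are the masses of rectangles. *)
Lemma eq_mixture D D' :
  (forall G B, measurable G -> measurable B ->
     (\int[prior]_(rho in @Spec R d.+1 @^-1` G) outcome D rho B =
      \int[prior]_(rho in @Spec R d.+1 @^-1` G) outcome D' rho B)%E) ->
  forall Y, measurable Y -> mixture D Y = mixture D' Y.
Proof.
move=> e; apply: (measure_unique
    [set G `*` B | G in (@measurable _ (Theta R d.+1)) & B in (@measurable _ A)] (fun=> setT)).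
- exact: measurable_prod_measurableType.
- move=> _ _ [G1 mG1 [B1 mB1 <-]] [G2 mG2 [B2 mB2 <-]].
  by exists (G1 `&` G2); [exact: measurableI|exists (B1 `&` B2);
    [exact: measurableI|rewrite setXI]].
- by move=> _; exists setT => //; exists setT => //; rewrite setXTT.
- by rewrite bigcup_const.
- move=> _ [G mG [B mB <-]].
  have rectE D0 : mixture D0 (G `*` B) =
      (\int[prior]_(rho in @Spec R d.+1 @^-1` G) outcome D0 rho B)%E.
    rewrite /mixture /= /kcomp /= [RHS]integral_mkcond; apply: eq_integral => rho _.
    rewrite patchE /joint_kernel /= /joint; case: ifPn => [/set_mem hG|/negP hG].
      congr (outcome D0 rho _); apply/seteqP; split => a /=; first by case.
      by split.
    rewrite (_ : _ @^-1` _ = set0) ?measure0 //.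
    by apply/seteqP; split => a //= -[hG' _]; apply: hG; exact: mem_set.
  by rewrite !rectE e.
- move=> _; rewrite /mixture /= /kcomp.
  under eq_integral do rewrite prob_kernel.
  by rewrite integral_cst // prob_kernel mule1 ltry.
Qed.

Lemma eq_bayes_integral D D' (f : Theta R d.+1 * A -> \bar R) :
  (forall z, 0 <= f z)%E -> measurable_fun setT f ->
  (forall G B, measurable G -> measurable B ->
     (\int[prior]_(rho in @Spec R d.+1 @^-1` G) outcome D rho B =
      \int[prior]_(rho in @Spec R d.+1 @^-1` G) outcome D' rho B)%E) ->
  (\int[prior]_rho \int[outcome D rho]_a f (Spec rho, a) =
   \int[prior]_rho \int[outcome D' rho]_a f (Spec rho, a))%E.
Proof.
move=> f0 mf e; rewrite (integral_mixture D f0 mf) (integral_mixture D' f0 mf).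
apply: eq_measure_integral => Y mY _.
exact: eq_mixture.
Qed.

Lemma bayes_riskE D (ell : Theta R d.+1 * A -> \bar R) L :
  (forall rho a, L rho a = ell (Spec rho, a)) ->
  bayes_risk prior L D = (\int[prior]_rho \int[outcome D rho]_a ell (Spec rho, a))%E.
Proof.
move=> hL; apply: eq_integral => rho _.
rewrite (_ : (fun a => L rho a) = (fun a => ell (Spec rho, a))); last exact/funext.
by apply: eq_set_integral => B mB; rewrite outcomeE.
Qed.
End Compare.
End Outcome.

Section FiniteMixture.
Context {disp : measure_display} {T : measurableType disp} {R : realType}.

(** The weighted sum is rebuilt as a measure [m'] one index at a time, and agrees with [m] on
    measurable sets. *)
Lemma integral_finite_mixture (I : finType) (p : I -> R)
  (k : I -> {measure set T -> \bar R}) (m : {measure set T -> \bar R}) (f : T -> \bar R) :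
  (forall j, 0 <= p j) ->
  (forall B, measurable B -> m B = (\sum_j (p j)%:E * k j B)%E) ->
  (forall x, 0 <= f x)%E -> measurable_fun setT f ->
  (\int[m]_x f x = \sum_j (p j)%:E * \int[k j]_x f x)%E.
Proof.
move=> p0 mE f0 mf.
have [m' m'E m'f] : exists2 m' : {measure set T -> \bar R},
    (forall B, m' B = (\sum_j (p j)%:E * k j B)%E) &
    (\int[m']_x f x = \sum_j (p j)%:E * \int[k j]_x f x)%E.
  elim: (index_enum I) => [|j s [m' m'E m'f]].
    exists mzero => [B|]; first by rewrite big_nil.
    by rewrite big_nil integral_measure_zero.
  exists (measure_add (mscale (NngNum (p0 j)) (k j)) m') => [B|].
    by rewrite big_cons -m'E; exact: measure_addE.
  rewrite big_cons ge0_integral_measure_add // m'f; congr (_ + _)%E.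
  by rewrite ge0_integral_mscale.
rewrite -m'f; apply: eq_measure_integral => B mB _.
by rewrite m'E; exact: mE.
Qed.
End FiniteMixture.

Section PsdClosure.
Variable R : realType.
Local Notation C := R[i].

Lemma psdmx_scale m (c : C) (M : 'M[C]_m) : 0 <= c -> psdmx M -> psdmx (c *: M).
Proof.
move=> c0 [/is_hermitianmxP hM pM]; split.
  apply/is_hermitianmxP; rewrite expr0 scale1r adjZ geC0_conj //; congr (_ *: _).
  by rewrite {1}hM expr0 scale1r.
by move=> v; rewrite -scalemxAr -scalemxAl mxE mulr_ge0.
Qed.

Lemma psdmx_sum m (I : finType) (F : I -> 'M[C]_m) :
  (forall k, psdmx (F k)) -> psdmx (\sum_k F k).
Proof.
move=> hF; split.
  apply/is_hermitianmxP; rewrite expr0 scale1r adj_sum; apply: eq_bigr => k _.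
  by have [/is_hermitianmxP h _] := hF k; rewrite expr0 scale1r in h.
move=> v; rewrite mulmx_sumr mulmx_suml summxE sumr_ge0 // => k _.
by have [_] := hF k.
Qed.

Lemma real_complex_cts : continuous (fun x : R => (x%:C)%C : C^o).
Proof.
move=> x B /nbhs_ballP[e /= e0 hB]; apply/nbhs_ballP; exists (complex.Re e) => /=.
  by move: e0; rewrite ltcE => /andP[].
move=> y; rewrite /ball /= => xy; apply: hB; rewrite /ball /=.
rewrite -raddfB /= normc_def /= expr0n addr0 sqrtr_sqr.
by move: e0 xy; case: e => a b; rewrite !ltcE /= => /andP[/eqP -> _] ->; rewrite eqxx.
Qed.
End PsdClosure.

(** * Decision rules and measurements *)

Section Rules.
Variables (R : realType) (n d : nat) (dA : measure_display) (A : measurableType dA).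
Local Notation C := R[i].
Local Notation N := (tdim n d.+1).
Implicit Types (D : povm R A N) (rho : density R d.+1) (lam : young n d.+1).

Definition rule_effect (delta : R.-pker (young n d.+1) ~> A) (B : set A) : 'M[C]_N :=
  \sum_(lam : young n d.+1) ((fine (delta lam B))%:C)%C *: wss_proj R lam.

Section RulePovm.
Variable delta : R.-pker (young n d.+1) ~> A.

Lemma rule_fin lam B : measurable B -> delta lam B \is a fin_num.
Proof.
move=> mB; rewrite ge0_fin_numE // (le_lt_trans _ (ltry 1)) //.
by rewrite -(prob_kernel (s := delta) lam) le_measure // ?inE.
Qed.

Let rule_psd B : measurable B -> psdmx (rule_effect delta B).
Proof.
move=> mB; apply: psdmx_sum => lam; apply: psdmx_scale; last exact: wss_proj_psd.
by rewrite lecR fine_ge0.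
Qed.

Let rule_sigma (F : (set A)^nat) : (forall k, measurable (F k)) -> trivIset setT F ->
  forall u v : 'cV[C]_N,
    (fun m => \sum_(k < m) (u^t* *m rule_effect delta (F k) *m v) 0 0 : C^o)
      @ \oo --> ((u^t* *m rule_effect delta (\bigcup_k F k) *m v) 0 0 : C^o).
Proof.
move=> mF tF u v.
have E B : (u^t* *m rule_effect delta B *m v) 0 0 = \sum_(lam : young n d.+1)
    (u^t* *m wss_proj R lam *m v) 0 0 * ((fine (delta lam B))%:C)%C.
  rewrite mulmx_sumr mulmx_suml summxE; apply: eq_bigr => lam _.
  by rewrite -scalemxAr -scalemxAl mxE mulrC.
rewrite E.
rewrite (_ : (fun m => _) = (fun m => \sum_(lam : young n d.+1)
    (u^t* *m wss_proj R lam *m v) 0 0 *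
    ((\sum_(k < m) fine (delta lam (F k)))%:C)%C)); last first.
  apply/funext => m; under eq_bigr do rewrite E.
  rewrite exchange_big /=; apply: eq_bigr => lam _.
  by rewrite -mulr_sumr rmorph_sum.
apply: cvg_csum => lam; apply: cvgZl_tmp.
apply: (@cvg_comp _ _ _ (fun m => \sum_(k < m) fine (delta lam (F k)))
  (fun x : R => (x%:C)%C : C^o) _ _ _ _ (@real_complex_cts R _)).
have mU : measurable (\bigcup_k F k) by exact: bigcup_measurable.
have := @measure_semi_sigma_additive _ _ _ (delta lam) F mF tF mU.
rewrite -{1}(fineK (rule_fin lam mU)) => /fine_cvg.
rewrite (_ : _ \o _ = fun m => \sum_(k < m) fine (delta lam (F k))) //.
apply/funext => m /=; rewrite big_mkord.
rewrite (eq_bigr (fun k : 'I_m => (fine (delta lam (F k)))%:E)) ?sumEFin // => k _.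
by rewrite fineK // rule_fin.
Qed.

Let rule_total : rule_effect delta setT = 1%:M.
Proof.
rewrite -(wss_proj_sum R n d.+1); apply: eq_bigr => lam _.
by rewrite prob_kernel /= scale1r.
Qed.

Definition rule_povm : povm R A N := Povm rule_psd rule_sigma rule_total.
End RulePovm.

Lemma wss_prob_ge0 rho lam : 0 <= wss_prob rho lam.
Proof.
have := psd_trace_ge0 (density_power_psd n rho) (wss_proj_psd R lam).
by rewrite lecE => /andP[].
Qed.

Lemma trace_rule (delta : R.-pker (young n d.+1) ~> A) rho B :
  \tr (tensor_power n rho *m rule_effect delta B) = \sum_(lam : young n d.+1)
    ((fine (delta lam B))%:C)%C * \tr (tensor_power n rho *m wss_proj R lam).
Proof.
rewrite /rule_effect mulmx_sumr linear_sum /=.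
by apply: eq_bigr => lam _; rewrite -scalemxAr linearZ.
Qed.

Lemma outcome_rule (delta : R.-pker (young n d.+1) ~> A) rho B : measurable B ->
  outcome (rule_povm delta) rho B =
  (\sum_(lam : young n d.+1) (wss_prob rho lam)%:E * delta lam B)%E.
Proof.
move=> mB; rewrite outcomeE //= trace_rule raddf_sum /=.
rewrite -sumEFin; apply: eq_bigr => lam _.
rewrite -[X in (_ * X)%E](fineK (rule_fin delta lam mB)) -EFinM.
congr EFin; rewrite /wss_prob; case: (\tr _) => a b /=.
by rewrite mul0r subr0 mulrC.
Qed.

Lemma wss_risk_rule (prior : probability (density R d.+1) R) (ell : Theta R d.+1 * A -> \bar R) L
  (delta : R.-pker (young n d.+1) ~> A) :
  (forall x, 0 <= ell x)%E -> measurable_fun setT ell ->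
  (forall rho a, L rho a = ell (Spec rho, a)) ->
  wss_risk prior L delta = bayes_risk prior L (rule_povm delta).
Proof.
move=> ell0 mell hL; rewrite (bayes_riskE _ _ hL); apply: eq_integral => rho _.
have mf : measurable_fun setT (fun a => ell (Spec rho, a)).
  by apply: measurableT_comp => //; exact: measurable_pair1.
rewrite (integral_finite_mixture (p := fun lam => wss_prob rho lam) (k := delta)) //.
- apply: eq_bigr => lam _; congr (_ * _)%E.
  by apply: eq_integral => a _; rewrite hL.
- by move=> lam; exact: wss_prob_ge0.
- by move=> B mB; exact: outcome_rule.
Qed.

(** The maximally mixed state on the block, or the zero matrix if the block vanishes. *)
Definition block_state lam : 'M[C]_N :=
  ((complex.Re (\tr (wss_proj R lam)))^-1%:C)%C *: wss_proj R lam.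

Lemma block_trace lam : \tr (wss_proj R lam) = ((complex.Re (\tr (wss_proj R lam)))%:C)%C.
Proof.
have := psd_trace_ge0 (wss_proj_psd R lam) (wss_proj_psd R lam).
by rewrite wss_proj_idem => /ger0_Im; case: (\tr _) => a b /= ->.
Qed.

Lemma block_state_psd lam : psdmx (block_state lam).
Proof.
apply: psdmx_scale (wss_proj_psd R lam); rewrite lecR invr_ge0.
have := psd_trace_ge0 (wss_proj_psd R lam) (wss_proj_psd R lam).
by rewrite wss_proj_idem lecE => /andP[].
Qed.

(* The diagrams with vanishing block occur with probability zero. *)
Definition decision D lam : {measure set A -> \bar R} :=
  if \tr (wss_proj R lam) == 0 then (\d_(point : A) : {measure set A -> \bar R})
  else (eff_measure D (block_state_psd lam) : {measure set A -> \bar R}).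

Section Decision.
Variable D : povm R A N.

Let measurable_decision U : measurable U -> measurable_fun setT (decision D ^~ U).
Proof. by []. Qed.

HB.instance Definition _ := @isKernel.Build _ _ (young n d.+1) A R (decision D) measurable_decision.

Let decision_prob lam : decision D lam setT = 1%E.
Proof.
rewrite /decision; case: eqVneq => [_|tr0]; first by rewrite /= diracT.
transitivity (complex.Re (\tr (block_state lam *m D setT)))%:E.
  exact: eff_measureE.
rewrite effectT mulmx1 linearZ /= block_trace -rmorphM /= mulVf //.
by apply: contra_neq tr0 => tr0; rewrite block_trace tr0.
Qed.

HB.instance Definition _ :=
  @Kernel_isProbability.Build _ _ (young n d.+1) A R (decision D) decision_prob.
End Decision.

Lemma integral_outcome (prior : probability (density R d.+1) R) D G B :
  measurable G -> measurable B ->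
  (\int[prior]_(rho in @Spec R d.+1 @^-1` G) outcome D rho B)%E =
  (complex.Re (Cint prior (@Spec R d.+1 @^-1` G)
     (fun rho => \tr (tensor_power n (rho : 'M[C]_d.+1) *m D B))))%:E.
Proof.
move=> mG mB.
have mSG : measurable (@Spec R d.+1 @^-1` G).
  by rewrite -[X in measurable X]setTI; exact: measurable_Spec.
under eq_integral do rewrite outcomeE //.
have [int _] := cbounded_integrable prior mSG (cbounded_trace (D B)).
by rewrite /Cint /= /Rintegral fineK //; exact: integrable_fin_num.
Qed.

(** By [average_trace_blocks], passing from [D B] to its block averages preserves the trace against
    $T_G$, and on the nonzero blocks these averages are the probabilities of [decision]. *)
Lemma decision_average (prior : probability (density R d.+1) R) D G B : unitarily_invariant prior ->
  measurable G -> measurable B ->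
  (\int[prior]_(rho in @Spec R d.+1 @^-1` G) outcome D rho B =
   \int[prior]_(rho in @Spec R d.+1 @^-1` G) outcome (rule_povm (decision D)) rho B)%E.
Proof.
move=> prior_inv mG mB; rewrite !integral_outcome //; congr (complex.Re _)%:E.
have mSG : measurable (@Spec R d.+1 @^-1` G).
  by rewrite -[X in measurable X]setTI; exact: measurable_Spec.
rewrite (average_trace_blocks prior_inv mG).
transitivity (Cint prior (@Spec R d.+1 @^-1` G) (fun rho => \sum_(lam : young n d.+1)
    ((fine (decision D lam B))%:C)%C * \tr (tensor_power n (rho : 'M[C]_d.+1) *m wss_proj R lam))).
  rewrite (Cint_sum _ mSG); last first.
    move=> lam; apply: cboundedM; first exact: cbounded_cst.
    exact: cbounded_trace.
  apply: eq_bigr => lam _; rewrite (CintZ _ mSG); last exact: cbounded_trace.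
  rewrite mulrC /decision; have [tr0|tr0] := eqVneq (\tr (wss_proj R lam)) 0.
    (* A projection of trace zero vanishes, so this diagram contributes zero on both sides. *)
    rewrite (_ : Cint _ _ _ = 0) ?mulr0 // -(Cint0 prior (@Spec R d.+1 @^-1` G)).
    apply: eq_Cint => rho; rewrite (_ : wss_proj R lam = 0) ?mulmx0 ?linear0 //.
    by apply: gram_eq0; rewrite wss_proj_herm wss_proj_idem.
  rewrite (_ : (eff_measure D (block_state_psd lam) : {measure set A -> \bar R}) B =
    (complex.Re (\tr (block_state lam *m D B)))%:E); last exact: eff_measureE.
  congr (_ * _); rewrite -scalemxAl linearZ /=.
  have := psd_trace_ge0 (wss_proj_psd R lam) (effect_psd D mB).
  move: (\tr (wss_proj R lam *m D B)) => z /ger0_Im zI.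
  rewrite {1}block_trace; case: z zI => a b /= ->.
  by rewrite mul0r subr0 rmorphM fmorphV /= mulrC.
by apply: eq_Cint => rho; rewrite /= trace_rule.
Qed.
End Rules.

(** * Posterior Bayes actions *)

Section Bayes.
Variables (R : realType) (n d : nat) (dA : measure_display) (A : measurableType dA).
Local Notation C := R[i].
Local Notation N := (tdim n d.+1).
Implicit Types (rho : density R d.+1) (lam : young n d.+1).

(** The tensor power of a diagonalizing unitary commutes with the permutations, hence with the
    projection, and drops out of the trace. *)
Lemma wss_prob_Spec rho lam : wss_prob (diag_theta (Spec rho)) lam = wss_prob rho lam.
Proof.
have [W WU <-] := spec_diagonalize rho; rewrite /wss_prob; congr complex.Re.
have comm : tensor_power n W *m wss_proj R lam = wss_proj R lam *m tensor_power n W.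
  apply: wss_proj_comm => s; first by rewrite perm_op_power.
  by rewrite tensor_power_adj perm_op_power.
set Q := tensor_power n W in comm *.
have QQ : Q^t* *m Q = 1%:M.
  by rewrite /Q tensor_power_adj -tensor_powerM (unitary_adjK WU) tens_power tens1.
rewrite !tensor_powerM -(tensor_power_adj n W) -/Q -!mulmxA mxtrace_mulC -!mulmxA -comm.
by rewrite (mulmxA (Q^t*)) QQ mul1mx.
Qed.

Lemma measurable_wss_prob lam :
  measurable_fun setT (fun rho => wss_prob rho lam).
Proof. by have [[]] := cbounded_trace (wss_proj R lam). Qed.

Lemma measurable_theta_val : measurable_fun setT (@theta_val R d.+1).
Proof. by move=> _ B mB; exists B. Qed.

Lemma measurable_wss_prob_theta lam :
  measurable_fun setT (fun t : Theta R d.+1 => wss_prob (diag_theta t) lam).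
Proof.
have h : mmeasurable (fun t : Theta R d.+1 => diag_theta t).
  move=> a b; rewrite (_ : (fun t => _) = (fun t : Theta R d.+1 =>
      ((tnth t a)%:C)%C *+ (a == b))); last first.
    by apply/funext => t; rewrite !mxE; case: eqP => [->|].
  have mt : measurable_fun setT (fun t : Theta R d.+1 => tnth t a).
    exact: (measurableT_comp (measurable_tnth a) measurable_theta_val).
  case: (a == b); last by under eq_fun do rewrite mulr0n; exact: cmeasurable_cst.
  by under eq_fun do rewrite mulr1n; split => //=; exact: measurable_cst.
have [] // := cmeasurable_trace (mmeasurableM (mmeasurable_power h)
  (mmeasurable_cst (wss_proj R lam))).
Qed.

(** * The risk of a rule as a sum over diagrams *)

Section RiskDensity.
Variable prior : probability (density R d.+1) R.
Variable ell : Theta R d.+1 * A -> \bar R.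
Hypothesis ell_ge0 : forall x, (0 <= ell x)%E.
Hypothesis ell_meas : measurable_fun setT ell.

(** The posterior expected loss times the evidence of [lam], left unnormalized so that it makes
    sense at zero evidence. *)
Definition risk_density lam (a : A) : \bar R :=
  (\int[prior]_rho ((wss_prob rho lam)%:E * ell (Spec rho, a)))%E.

Let integrand lam (z : density R d.+1 * A) : \bar R :=
  ((wss_prob z.1 lam)%:E * ell (Spec z.1, z.2))%E.

Let integrand_ge0 lam z : (0 <= integrand lam z)%E.
Proof. by rewrite mule_ge0 // lee_fin wss_prob_ge0. Qed.

Let integrand_meas lam : measurable_fun setT (integrand lam).
Proof.
apply: emeasurable_funM.
  apply/measurable_EFinP.
  exact: (measurableT_comp (measurable_wss_prob lam) measurable_fst).
apply: (measurableT_comp ell_meas); apply: (measurable_fun_pair _ measurable_snd).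
exact: (measurableT_comp (@measurable_Spec R d) measurable_fst).
Qed.

Lemma risk_density_ge0 lam a : (0 <= risk_density lam a)%E.
Proof. by apply: integral_ge0 => rho _; exact: (integrand_ge0 lam (rho, a)). Qed.

Lemma risk_density_meas lam : measurable_fun setT (risk_density lam).
Proof. exact: (measurable_fun_fubini_tonelli_G (m1 := prior) _ (integrand_meas lam)
  (integrand_ge0 lam)). Qed.

(** A name for [delta lam] that carries the probability structure used in Tonelli's theorem. *)
Definition rule_law (delta : R.-pker (young n d.+1) ~> A) lam : set A -> \bar R := delta lam.

HB.instance Definition _ delta lam := Measure.on (rule_law delta lam).

Let rule_law_setT delta lam : rule_law delta lam setT = 1%E.
Proof. exact: prob_kernel. Qed.

HB.instance Definition _ delta lam :=
  Measure_isProbability.Build _ _ _ (rule_law delta lam) (rule_law_setT delta lam).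

(** Tonelli, once for each diagram; the rule can then be optimized separately at each [lam]. *)
Lemma wss_risk_density L (delta : R.-pker (young n d.+1) ~> A) :
  (forall rho a, L rho a = ell (Spec rho, a)) ->
  wss_risk prior L delta =
  (\sum_(lam : young n d.+1) \int[delta lam]_a risk_density lam a)%E.
Proof.
move=> hL.
have mF lam : measurable_fun setT
    (fun rho => \int[rule_law delta lam]_a integrand lam (rho, a))%E.
  exact: (measurable_fun_fubini_tonelli_F (m2 := rule_law delta lam) _
    (integrand_meas lam) (integrand_ge0 lam)).
transitivity (\int[prior]_rho \sum_(lam : young n d.+1)
    \int[rule_law delta lam]_a integrand lam (rho, a))%E.
  apply: eq_integral => rho _; apply: eq_bigr => lam _.
  rewrite -ge0_integralZl //.
  - by apply: eq_integral => a _; rewrite hL.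
  - rewrite (_ : L rho = (fun a => ell (Spec rho, a))); last exact/funext.
    by apply: measurableT_comp => //; exact: measurable_pair1.
  - by move=> a _; rewrite hL.
  - by rewrite lee_fin wss_prob_ge0.
rewrite ge0_integral_sum //; last first.
  by move=> lam rho _; apply: integral_ge0 => a _; exact: (integrand_ge0 lam (rho, a)).
apply: eq_bigr => lam _.
exact: (fubini_tonelli (m1 := prior) (m2 := rule_law delta lam) _ (integrand_meas lam)
  (integrand_ge0 lam)).
Qed.

Lemma wss_risk_dirac L (a : young n d.+1 -> A) (a_meas : measurable_fun setT a) :
  (forall rho a, L rho a = ell (Spec rho, a)) ->
  wss_risk prior L (kdirac a_meas) = (\sum_(lam : young n d.+1) risk_density lam (a lam))%E.
Proof.
move=> hL; rewrite (wss_risk_density _ hL); apply: eq_bigr => lam _.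
rewrite /kdirac integral_dirac //; last exact: risk_density_meas.
by rewrite diracT mul1e.
Qed.

Lemma wss_risk_min L (a : young n d.+1 -> A) (a_meas : measurable_fun setT a)
  (delta : R.-pker (young n d.+1) ~> A) :
  (forall rho a, L rho a = ell (Spec rho, a)) ->
  (forall lam b, risk_density lam (a lam) <= risk_density lam b)%E ->
  (wss_risk prior L (kdirac a_meas) <= wss_risk prior L delta)%E.
Proof.
move=> hL hmin; rewrite (wss_risk_dirac _ hL) (wss_risk_density _ hL).
apply: lee_sum => lam _.
have -> : risk_density lam (a lam) = (\int[delta lam]_b cst (risk_density lam (a lam)) b)%E.
  by rewrite integral_cst // prob_kernel mule1.
apply: ge0_le_integral => //.
- by move=> b _; exact: risk_density_ge0.
- exact: risk_density_meas.
- by move=> b _; exact: hmin.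
Qed.

End RiskDensity.

(** * The posterior through the joint law of spectrum and diagram *)

Section Posterior.
Variable prior : probability (density R d.+1) R.
Variable lam : young n d.+1.

Definition weighted_dirac (x : unit * density R d.+1) : {measure set (Theta R d.+1) -> \bar R} :=
  mscale (NngNum (wss_prob_ge0 x.2 lam)) (\d_(Spec x.2)).

Lemma weighted_diracE x B : weighted_dirac x B =
  ((wss_prob x.2 lam)%:E * (\1_B (Spec x.2))%:E)%E.
Proof. by []. Qed.

Let measurable_weighted_dirac U : measurable U -> measurable_fun setT (weighted_dirac ^~ U).
Proof.
move=> mU; under eq_fun do rewrite weighted_diracE.
apply: emeasurable_funM; apply/measurable_EFinP.
  exact: (measurableT_comp (measurable_wss_prob lam) measurable_snd).
apply: (measurableT_comp (measurable_indic mU)).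
exact: (measurableT_comp (@measurable_Spec R d) measurable_snd).
Qed.

HB.instance Definition _ := @isKernel.Build _ _ _ _ R weighted_dirac measurable_weighted_dirac.

Let weighted_dirac_uub : measure_fam_uub weighted_dirac.
Proof.
have [_ [M hM]] := @cbounded_trace R n d (wss_proj R lam).
(* The uniform bound has to be strict, whence [M + 1]. *)
exists (M + 1) => x; rewrite weighted_diracE indicT mule1 lte_fin.
rewrite ltr_pwDr // -lecR; apply: le_trans (hM x.2).
by apply: le_trans (normc_ge_Re _); rewrite lecR ler_norm.
Qed.

HB.instance Definition _ :=
  @Kernel_isFinite.Build _ _ _ _ R weighted_dirac weighted_dirac_uub.

Definition joint_law : {measure set (Theta R d.+1) -> \bar R} :=
  mkcomp (const_kernel prior) weighted_dirac tt.

Lemma integral_joint_law (f : Theta R d.+1 -> \bar R) :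
  (forall t, 0 <= f t)%E -> measurable_fun setT f ->
  (\int[joint_law]_t f t = \int[prior]_rho ((wss_prob rho lam)%:E * f (Spec rho)))%E.
Proof.
move=> f0 mf; rewrite [LHS]integral_kcomp //; apply: eq_integral => rho _.
by rewrite ge0_integral_mscale // integral_dirac // diracT mul1e.
Qed.

Lemma joint_lawE B : measurable B ->
  joint_law B = (\int[spectral_prior prior]_(t in B) (wss_prob (diag_theta t) lam)%:E)%E.
Proof.
move=> mB; rewrite (ge0_integral_pushforward (@measurable_Spec R d)) //.
- rewrite [RHS]integral_mkcond; apply: eq_integral => rho _.
  rewrite patchE weighted_diracE /= wss_prob_Spec indicE.
  have -> : (Spec rho \in B) = (rho \in @Spec R d.+1 @^-1` B).
    by apply/idP/idP; rewrite !inE.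
  by case: ifPn => _; rewrite ?mule1 ?mule0.
- apply: measurable_funTS; apply/measurable_EFinP; exact: measurable_wss_prob_theta.
- move=> t _; rewrite lee_fin.
  have := psd_trace_ge0 (theta_power_psd n t) (wss_proj_psd R lam).
  by rewrite lecE => /andP[].
Qed.

End Posterior.

(** By Bayes' formula [joint_law] is the evidence times the posterior, so [risk_density] is the
    evidence times the posterior loss; a nonnegative factor preserves the order. *)
Lemma posterior_action_min (prior : probability (density R d.+1) R)
  (ell : Theta R d.+1 * A -> \bar R) (post : young n d.+1 -> probability (Theta R d.+1) R)
  (a : young n d.+1 -> A) :
  (forall x, 0 <= ell x)%E -> measurable_fun setT ell ->
  is_posterior (spectral_prior prior) post -> is_posterior_bayes_action ell post a ->
  forall lam b, (risk_density prior ell lam (a lam) <= risk_density prior ell lam b)%E.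
Proof.
move=> ell0 mell hpost hbayes lam b.
have msec c : measurable_fun setT (fun t : Theta R d.+1 => ell (t, c)).
  by apply: measurableT_comp => //; exact: measurable_pair2.
pose ev := evidence (spectral_prior prior) lam.
have evE : joint_law prior lam setT = ev by rewrite joint_lawE.
have ev_ge0 : (0 <= ev)%E by rewrite -evE.
have ev_fin : ev \is a fin_num.
  have [pint _] := cbounded_integrable prior measurableT
    (@cbounded_trace R n d (wss_proj R lam)).
  have -> : ev = (\int[prior]_rho (wss_prob rho lam)%:E)%E.
    rewrite -evE -[LHS]mul1e -integral_cst // integral_joint_law //.
    by apply: eq_integral => rho _; rewrite mule1.
  exact: integrable_fin_num pint.
have lawE B : measurable B -> joint_law prior lam B = (ev * post lam B)%E.
  (* At zero evidence the joint law vanishes, so the formula holds for any choice of posterior. *)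
  move=> mB; have [ev0|ev_gt0] := eqVneq ev 0%E.
    rewrite ev0 mul0e; apply/eqP; rewrite eq_le measure_ge0 andbT.
    by rewrite -ev0 -evE le_measure // inE.
  have ev_pos : (0 < ev)%E by rewrite lt_neqAle eq_sym ev_gt0.
  by rewrite (hpost lam ev_pos B mB) -joint_lawE // -/ev muleCA divee // mule1.
have densE c : risk_density prior ell lam c = (ev * \int[post lam]_t ell (t, c))%E.
  rewrite /risk_density -(integral_joint_law prior lam (fun t => ell0 (t, c)) (msec c)).
  have ev_nng : (0 <= fine ev)%R by rewrite fine_ge0.
  transitivity (((NngNum ev_nng)%:num)%:E * \int[post lam]_t ell (t, c))%E; last first.
    by rewrite /= fineK.
  rewrite -(ge0_integral_mscale (post lam) measurableT (NngNum ev_nng) (msec c)) //.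
  apply: eq_measure_integral => B mB _.
  by rewrite lawE // -[in LHS](fineK ev_fin).
by rewrite !densE; apply: lee_wpmul2l => //; exact: hbayes.
Qed.
End Bayes.

Theorem theorem5p4 (R : realType) (n d : nat) (n_gt0 : (0 < n)%N)
    (dA : measure_display) (A : measurableType dA) (A_borel : standard_borel R A)
    (ell : Theta R d.+1 * A -> \bar R)
    (ell_ge0 : forall x, (0 <= ell x)%E)
    (ell_meas : measurable_fun setT ell)
    (L : density R d.+1 -> A -> \bar R)
    (L_spectral : forall rho a, L rho a = ell (Spec rho, a))
    (prior : probability (density R d.+1) R)
    (prior_inv : unitarily_invariant prior) :
  (forall D : povm R A (tdim n d.+1),
     exists delta : R.-pker (young n d.+1) ~> A,
       bayes_risk prior L D = wss_risk prior L delta) /\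
  ereal_inf (range (fun D : povm R A (tdim n d.+1) => bayes_risk prior L D)) =
  ereal_inf (range (fun delta : R.-pker (young n d.+1) ~> A =>
                      wss_risk prior L delta)) /\
  (forall (post : young n d.+1 -> probability (Theta R d.+1) R)
          (a : young n d.+1 -> A)
          (a_meas : measurable_fun [set: young n d.+1] a),
     is_posterior (spectral_prior prior) post ->
     is_posterior_bayes_action ell post a ->
     [/\ wss_risk prior L (kdirac a_meas) =
           ereal_inf (range (fun D : povm R A (tdim n d.+1) =>
                               bayes_risk prior L D)),
         wss_risk prior L (kdirac a_meas) =
           ereal_inf (range (fun delta : R.-pker (young n d.+1) ~> A =>
                               wss_risk prior L delta)) &
         exists D : povm R A (tdim n d.+1),
           [/\ is_wss_then a D,
               bayes_risk prior L D = wss_risk prior L (kdirac a_meas) &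
               bayes_optimal prior L D]]).
Proof.
have to_rule (D : povm R A (tdim n d.+1)) : bayes_risk prior L D = wss_risk prior L (decision D).
  rewrite (wss_risk_rule _ _ ell_ge0 ell_meas L_spectral).
  rewrite !(bayes_riskE _ _ L_spectral).
  apply: eq_bayes_integral => // G B mG mB.
  exact: decision_average.
have to_povm (delta : R.-pker (young n d.+1) ~> A) :
    wss_risk prior L delta = bayes_risk prior L (rule_povm delta).
  exact: (wss_risk_rule _ _ ell_ge0 ell_meas L_spectral).
(* Both families attain the same set of risks, so the equality of the infima is immediate. *)
have rangeE : range (fun D : povm R A (tdim n d.+1) => bayes_risk prior L D) =
    range (fun delta : R.-pker (young n d.+1) ~> A => wss_risk prior L delta).
  apply/seteqP; split => _ [x _ <-].
    by exists (decision x); [|exact: esym (to_rule x)].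
  by exists (rule_povm x); [|exact: esym (to_povm x)].
split; first by move=> D; exists (decision D); exact: to_rule.
rewrite rangeE; split => // post a a_meas hpost hbayes.
have hmin (delta : R.-pker (young n d.+1) ~> A) :
      (wss_risk prior L (kdirac a_meas) <= wss_risk prior L delta)%E.
  apply: (wss_risk_min ell_ge0 ell_meas a_meas delta L_spectral).
  exact: posterior_action_min hpost hbayes.
have inf_eq : wss_risk prior L (kdirac a_meas) =
    ereal_inf (range (fun delta : R.-pker (young n d.+1) ~> A => wss_risk prior L delta)).
  apply/eqP; rewrite eq_le; apply/andP; split.
    by apply: le_ereal_inf_tmp => _ [delta _ <-].
  by apply: ereal_inf_lbound; exists (kdirac a_meas).
(* The Dirac weights reduce each effect of [rule_povm] to the sum of the projections with [a lam] in
   [B]. *)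
split => //; exists (rule_povm (kdirac a_meas)); split.
- move=> B mB; rewrite /= /rule_effect [RHS]big_mkcond /=; apply: eq_bigr => lam _.
  rewrite indicE.
  case: (a lam \in B) => /=.
    by rewrite scale1r.
  by rewrite scale0r.
- by rewrite to_povm.
- by move=> D'; rewrite -to_povm to_rule.
Qed.
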